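(* Let $X=(X_1,\ldots,X_n)'$ be an $n$-dimensional Lévy process such that: (D) $X_k(t)\to-\infty$ almost surely as $t\to\infty$, for every $k=1,\ldots,n$; (G) for $j=1,\ldots,n-1$, $X_{j+1}(t)=K_{j+1}X_j(t)+\Upsilon_{j+1}(t)$, where $K_2,\ldots,K_n$ are strictly positive constants, $\Upsilon_2,\ldots,\Upsilon_n$ are nonnegative subordinators, and $X_1,\Upsilon_2,\ldots,\Upsilon_n$ are mutually independent. For $k\in\{1,\ldots,n\}$ let $\mathbb P_k^{\downarrow}$ be the law under $\mathbb P$ of $\{X(G_k+t)-X(G_k):t\ge0\}$, where $G_k$ is the first epoch at which $X_k$ attains its maximum, and let $\mathbb E_k^{\downarrow}$ denote expectation under $\mathbb P_k^{\downarrow}$. Then for $\alpha,\beta\in\mathbb R_+^n$, \[ \mathbb E_k^{\downarrow}\,e^{-\langle\alpha,G\rangle-\langle\beta,\overline X\rangle} =\prod_{j=k}^{n-1}\frac{\mathbb E\exp\Big(-\Big[\sum_{\ell=j+1}^n\alpha_\ell+\sum_{\ell=j+2}^n\theta_\ell^\Upsilon\big(\sum_{i=\ell}^nK_\ell^i\beta_i\big)\Big]G_{j+1}-\Big[\sum_{\ell=j+1}^nK_{j+1}^\ell\beta_\ell\Big]\overline X_{j+1}\Big)}{\mathbb E\exp\Big(-\Big[\sum_{\ell=j+1}^n\alpha_\ell+\sum_{\ell=j+1}^n\theta_\ell^\Upsilon\big(\sum_{i=\ell}^nK_\ell^i\beta_i\big)\Big]G_j-\Big[\sum_{\ell=j+1}^nK_j^\ell\beta_\ell\Big]\overline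 X_j\Big)}. \]
   Context: A Lévy process is a càdlàg process with stationary, independent increments started at $0$; $X$ is taken to be the coordinate process on the canonical path space, with law $\mathbb P$ and expectation $\mathbb E$. For each $k$, $\overline X_k=\sup_{t\ge0}X_k(t)$ and $G_k=\inf\{t\ge0:X_k(t)=\overline X_k\text{ or }X_k(t-)=\overline X_k\}$, where $X_k(t-)$ is the left limit at $t$; $\overline X=(\overline X_1,\ldots,\overline X_n)'$ and $G=(G_1,\ldots,G_n)'$. Under $\mathbb P_k^{\downarrow}$, $\overline X$ and $G$ are the same functionals of the coordinate process, whose law is now $\mathbb P_k^{\downarrow}$; this law can be regarded as the law of $X$ given that $X_k$ stays nonpositive. For $1\le j\le\ell\le n$, $K_j^\ell=\prod_{i=j+1}^\ell K_i$, with $K_j^j=1$. For $j=2,\ldots,n$ and $\beta\ge0$, $\theta_j^\Upsilon(\beta)=-\log\mathbb E\,e^{-\beta\Upsilon_j(1)}$. $\langle\cdot,\cdot\rangle$ is the scalar product on $\mathbb R^n$; empty sums are $0$ and empty products are $1$.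
   Formalization: In defining P_k^↓, X(G_k) is read as X(G_k−) when X_k's maximum is only a left limit at G_k (else n=1, X(t)=t−N(t), N Poisson of rate 2, refutes the claim); accordingly paths have value 0 at 0−, which X̄_k and G_k take into account. Paths started at 0 are unaffected. *)

(* Defs.v *)
(* MathComp-Analysis, over an arbitrary [R : realType]. *)
From HB Require Import structures.
From mathcomp Require Import all_boot all_order all_algebra.
From mathcomp Require Import all_classical all_reals all_analysis.

Set Implicit Arguments.
Unset Strict Implicit.
Unset Printing Implicit Defensive.
Import Order.TTheory GRing.Theory Num.Theory.
Import numFieldNormedType.Exports.
Local Open Scope classical_set_scope.
Local Open Scope ring_scope.

Definition left_limit (R : realType) (f : R -> R) (t : R) : R :=
  lim (f s @[s --> t^'-]).

Definition cadlag (R : realType) (f : R -> R) : Prop :=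
  (forall t, 0 <= t -> f s @[s --> t^'+] --> f t) /\
  (forall t, 0 < t -> cvg (f s @[s --> t^'-])).

(* The canonical path space D([0, oo), R^n). Paths are extended by 0 to
   negative times; this only fixes the convention X(0-) = 0. A path need not
   start at 0 (starting at 0 is part of being a Levy process). *)
Record cadlag_path (R : realType) (n : nat) := CadlagPath {
  path_fun :> 'I_n -> R -> R ;
  path_cadlag : forall i, cadlag (path_fun i) ;
  path_neg : forall i t, t < 0 -> path_fun i t = 0 }.

(* The sigma-algebra generated by the real functions [f i], [i] in [D]. *)
Definition sigma_gen (R : realType) (T I : Type) (D : set I)
    (f : I -> T -> R) : set (set T) :=
  <<s \bigcup_(i in D) preimage_set_system setT (f i) measurable >>.

Section path_space.
Variables (R : realType) (n : nat).
Local Notation path := (cadlag_path R n).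

Lemma zero_path_cadlag (i : 'I_n) : cadlag (fun _ : R => 0 : R).
Proof. by split=> t _; [exact: cvg_cst|exact: is_cvg_cst]. Qed.

Definition zero_path : path :=
  @CadlagPath R n (fun _ _ => 0) zero_path_cadlag (fun _ _ _ => erefl).

HB.instance Definition _ := gen_eqMixin path.
HB.instance Definition _ := gen_choiceMixin path.
HB.instance Definition _ := isPointed.Build path zero_path.

Definition coord_process (i : 'I_n) (t : R) (w : path) : R := w i t.

Definition path_sigma : set (set path) :=
  sigma_gen [set it : 'I_n * R | 0 <= it.2] (fun it => coord_process it.1 it.2).

Let path_sigma0 : path_sigma set0.
Proof. exact: sigma_algebra0. Qed.

Let path_sigmaC A : path_sigma A -> path_sigma (~` A).
Proof. exact: sigma_algebraC. Qed.

Let path_sigma_bigcup (F : (set path)^nat) :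
  (forall i, path_sigma (F i)) -> path_sigma (\bigcup_i F i).
Proof. exact: sigma_algebra_bigcup. Qed.

Definition path_display : measure_display.
Proof. exact. Qed.

HB.instance Definition _ := @isMeasurable.Build path_display path path_sigma
  path_sigma0 path_sigmaC path_sigma_bigcup.

End path_space.

Section levy.
Context (d : measure_display) (T : measurableType d) (R : realType).
Variable P : probability T R.

Definition mutually_independent (J : finType) (F : J -> set (set T)) : Prop :=
  forall (S : {set J}) (A : J -> set T), (forall j, j \in S -> F j (A j)) ->
    P (\bigcap_(j in [set` S]) A j) = (\prod_(j in S) P (A j))%E.

Definition stationary_increments (m : nat) (Y : 'I_m -> R -> T -> R) : Prop :=
  forall s t : R, 0 <= s -> 0 <= t ->
  forall B : set (m.-tuple R), measurable B ->
    pushforward P (fun w => [tuple Y i (t + s) w - Y i t w | i < m]) B =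
    pushforward P (fun w => [tuple Y i s w | i < m]) B.

Definition independent_increments (m : nat) (Y : 'I_m -> R -> T -> R) : Prop :=
  forall (t : nat -> R) (N : nat), 0 <= t 0%N ->
    {homo t : a b / (a <= b)%N >-> a <= b} ->
    mutually_independent (fun j : 'I_N =>
      sigma_gen setT (fun i w => Y i (t j.+1) w - Y i (t j) w)).

Definition levy_process (m : nat) (Y : 'I_m -> R -> T -> R) : Prop :=
  [/\ forall i t, 0 <= t -> measurable_fun setT (Y i t),
      {ae P, forall w, forall i, cadlag (fun t => Y i t w)},
      {ae P, forall w, forall i, Y i 0 w = 0},
      stationary_increments Y &
      independent_increments Y].

Definition subordinator (Y : R -> T -> R) : Prop :=
  levy_process (fun _ : 'I_1 => Y) /\
  {ae P, forall w, forall s t, 0 <= s -> s <= t -> Y s w <= Y t w}.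

(* The Laplace exponent theta(b) = - log E exp(- b Y(1)). *)
Definition laplace_exponent (Y : R -> T -> R) (b : R) : R :=
  - ln (fine 'E_P[fun w => expR (- (b * Y 1 w))%R]%E).

End levy.

Section functionals.
Variables (R : realType) (n : nat).
Implicit Types (w : cadlag_path R n) (k : 'I_n).

(* The supremum of X_k. The extra 0 is the value X_k(0-): it is irrelevant for
   a path started at 0, but post-maximum paths can start with a jump.
   [sup] is 0 by convention if X_k is not bounded above, which has probability
   0 when X_k drifts to -oo. *)
Definition Xbar k w : R :=
  sup ([set 0] `|` [set w k t | t in [set t | 0 <= t]]).

Definition G k w : R :=
  inf [set t | 0 <= t /\ (w k t = Xbar k w \/ left_limit (w k) t = Xbar k w)].

(* The position of X at the epoch at which X_k attains its maximum: X(G_k) if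
   X_k(G_k) is the maximum, and X(G_k-) if the maximum is only approached from
   the left (X_k jumps down at G_k). This is what makes the post-maximum
   process stay nonpositive in its k-th coordinate: for instance, if
   X_1(t) = t - N(t) with N a Poisson process of rate 2, the maximum is always
   followed by a downward jump, and X_1(G_1 + t) - X_1(G_1) taken literally
   increases right after time 0. *)
Definition X_at_max k w (i : 'I_n) : R :=
  if w k (G k w) == Xbar k w then w i (G k w) else left_limit (w i) (G k w).

Definition post_max_fun k w (i : 'I_n) (t : R) : R :=
  if t < 0 then 0 else w i (G k w + t) - X_at_max k w i.

Lemma G_ge0 k w : 0 <= G k w.
Proof.
rewrite /G; set S := (X in inf X).
have [->|/set0P S0] := eqVneq S set0; first by rewrite inf0.
by apply: lb_le_inf => // t [].
Qed.

Lemma cvg_shift_right (c u : R) : c + x @[x --> u^'+] --> (c + u)^'+.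
Proof.
move=> A [e e0 Ae]; exists e => // x xe ux; apply: Ae; rewrite /= ?ltrD2l//.
by move: xe; rewrite /ball_/= opprD addrACA subrr add0r.
Qed.

Lemma cvg_shift_left (c u : R) : c + x @[x --> u^'-] --> (c + u)^'-.
Proof.
move=> A [e e0 Ae]; exists e => // x xe ux; apply: Ae; rewrite /= ?ltrD2l//.
by move: xe; rewrite /ball_/= opprD addrACA subrr add0r.
Qed.

Lemma post_max_cadlag k w (i : 'I_n) : cadlag (post_max_fun k w i).
Proof.
have [rc lc] := path_cadlag w i; split=> t t0.
- have Gt0 : 0 <= G k w + t by rewrite addr_ge0 ?G_ge0.
  rewrite {2}/post_max_fun ltNge t0/=.
  have : w i (G k w + s) - X_at_max k w i @[s --> t^'+] -->
      w i (G k w + t) - X_at_max k w i.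
    apply: cvgB; last exact: cvg_cst.
    exact: (cvg_comp (fun s => G k w + s) (w i) (@cvg_shift_right _ _) (rc _ Gt0)).
  apply: cvg_trans; apply: near_eq_cvg; near=> s.
  rewrite /post_max_fun ifF//; apply/negbTE; rewrite -leNgt.
  by apply: le_trans t0 (ltW _); near: s; exact: nbhs_right_gt.
- have Gt0 : 0 < G k w + t by rewrite ltr_wpDl ?G_ge0.
  have : cvg (w i (G k w + s) - X_at_max k w i @[s --> t^'-]).
    apply: is_cvgB; last exact: is_cvg_cst.
    have /cvg_ex[l wl] := lc _ Gt0; apply/cvg_ex; exists l.
    exact: (cvg_comp (fun s => G k w + s) (w i) (@cvg_shift_left _ _) wl).
  move=> /cvg_ex[l wl]; apply/cvg_ex; exists l; move: wl.
  apply: cvg_trans; apply: near_eq_cvg; near=> s.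
  rewrite /post_max_fun ifF//; apply/negbTE; rewrite -leNgt.
  by apply/ltW; near: s; exact: nbhs_left_gt.
Unshelve. all: by end_near. Qed.

Lemma post_max_neg k w (i : 'I_n) (t : R) : t < 0 -> post_max_fun k w i t = 0.
Proof. by rewrite /post_max_fun => ->. Qed.

(* The path {X(G_k + t) - X(G_k) : t >= 0}, with X(G_k) as in [X_at_max]. *)
Definition post_max k w : cadlag_path R n :=
  CadlagPath (@post_max_cadlag k w) (@post_max_neg k w).

(* The law P_k^down: the image of P under [post_max k]. *)
Definition down_law (P : probability (cadlag_path R n) R) k
    : set (cadlag_path R n) -> \bar R :=
  pushforward P (post_max k).

End functionals.

(* K_j^l, the product of K_i over j < i <= l. *)
Definition Kprod (R : realType) (n : nat) (K : 'I_n -> R) (j l : 'I_n) : R :=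
  \prod_(i < n | (j < i <= l)%N) K i.

(* Coordinates are numbered 0, ..., n. For j < n, [fst_ix j] and [snd_ix j] are
   the consecutive coordinates j and j + 1. *)
Definition fst_ix (n : nat) (j : 'I_n) : 'I_n.+1 := widen_ord (leqnSn n) j.
Definition snd_ix (n : nat) (j : 'I_n) : 'I_n.+1 := lift ord0 j.

(* Main.v *)
Require Import Defs.
From HB Require Import structures.
From mathcomp Require Import all_boot all_order all_algebra.
From mathcomp Require Import all_classical all_reals all_analysis.
From mathcomp Require Import measurable_realfun.
From mathcomp Require Import ring lra zify.

(** Fix [k] and split the path at the epoch [G_k] of the maximum of [X_k]. The
  post-maximum path is independent of [(G_k, X(G_k))]; since the drivers
  [Ups_l], [l > k], are independent of [X_k], they can be evaluated at [G_k] at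
  the price of a killing rate [theta_l]; and [X_j - K_k^j X_k] is nondecreasing
  for [j >= k], so the maxima of [X_j] after [G_k] are those of the whole path.
  Hence, for nonnegative weights [a], [b],

    E exp(- sum_{j >= k} (a_j G_j + b_j Xbar_j)) = N_k(a, b) * E_k^down(a, b),

  where [N_k(a, b)] only involves [(G_k, Xbar_k)]; write [D_k] for its value
  when [a_k] and [b_k] are replaced by [0]. With this replacement the left-hand
  side is that of the identity at [k + 1], while [E_k^down] does not change, so
  [E_k^down = (N_{k+1} / D_k) E_{k+1}^down], which is iterated up to the last
  coordinate.

  The splitting is proved for the random walk obtained by sampling [X] on a
  grid of mesh [1/(m+1)], where the event that the walk is first maximal at
  step [i] is the intersection of a past and a future event. In the limit, ties
  for the maximum are broken by giving [X_1] an extra drift [-1/(p+1)]: letting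
  [m] and then [p] tend to infinity, the grid argmax converges to the first
  argmax for every path, so that no uniqueness of the maximum is needed. *)

Set Implicit Arguments.
Unset Strict Implicit.
Unset Printing Implicit Defensive.
Import Order.TTheory GRing.Theory Num.Theory.
Import numFieldNormedType.Exports.
Local Open Scope classical_set_scope.
Local Open Scope ring_scope.

(** * Independence *)

(** The grid identity does not pass to the limit by itself. The grid argmax of X_k may approach G_k
    from either side, whereas [X_at_max] takes all coordinates on the side prescribed by X_k; the
    position of X_j at the grid argmax is sure to converge to [X_at_max] once X_j - K_k^j X_k is
    known not to jump at G_k. That the later drivers do not jump there follows from the killing
    formula itself: used a few grid steps before and after the argmax, it yields two Laplace
    transforms that are arbitrarily close, and their difference controls the expected jump.

    The extra drift reaches X_j with factor K_1^j, so it cancels in X_j - K_k^j X_k and the order of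
    the argmaxes is kept. Its preference for early epochs fades as p grows, and the grid must be
    fine compared to it; this dictates the order of the two limits.

    Killing requires the argmax to be a function of X_1, Ups_2, ..., Ups_k alone. Since (G) only
    holds almost surely, X_k is replaced by a version built from these drivers. *)

Section independence.
Context d (T : measurableType d) (R : realType) (P : probability T R).
Local Open Scope ereal_scope.

(** As functions of [A], both sides are finite measures: the image under [X] of [P] restricted to
    [B], and the law of [X] scaled by [P B]. They agree on a generating pi-system that contains the
    whole space. *)
Lemma pi_system_indepl d1 (T1 : measurableType d1) (G : set (set T1))
    (X : T -> T1) (B : set T) :
  measurable = <<s G >> -> setI_closed G -> G setT ->
  measurable_fun setT X -> measurable B ->
  (forall A, G A -> P (X @^-1` A `&` B) = P (X @^-1` A) * P B) ->
  forall A, measurable A -> P (X @^-1` A `&` B) = P (X @^-1` A) * P B.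
Proof.
move=> mG GI GT mX mB PG A mA.
have PB0 : (0 <= fine (P B))%R by rewrite fine_ge0.
have PBE : P B = (NngNum PB0)%:num%:E by rewrite /= fineK// fin_num_measure.
rewrite [RHS]muleC PBE.
apply: (@measure_unique _ _ _ G (fun=> setT) mG GI _ _ 
  (measure_function_pushforward__canonical__measure_function_Measure (mrestr P mB) mX)
  (mscale (NngNum PB0) (measure_function_pushforward__canonical__measure_function_Measure P mX))) => //.
- by apply/seteqP; split => // x _; exists 0%N.
- move=> C GC /=; rewrite /mscale /pushforward/= /mrestr.
  by rewrite [LHS]PG// muleC fineK// fin_num_measure.
- move=> _ /=; rewrite /pushforward /mrestr preimage_setT setTI.
  by rewrite (le_lt_trans (probability_le1 P mB))// ltry.
Qed.

Lemma pi_system_indep d1 d2 (T1 : measurableType d1) (T2 : measurableType d2)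
    (G1 : set (set T1)) (G2 : set (set T2)) (X : T -> T1) (Y : T -> T2) :
  measurable = <<s G1 >> -> setI_closed G1 -> G1 setT ->
  measurable = <<s G2 >> -> setI_closed G2 -> G2 setT ->
  measurable_fun setT X -> measurable_fun setT Y ->
  (forall A B, G1 A -> G2 B ->
    P (X @^-1` A `&` Y @^-1` B) = P (X @^-1` A) * P (Y @^-1` B)) ->
  forall A B, measurable A -> measurable B ->
    P (X @^-1` A `&` Y @^-1` B) = P (X @^-1` A) * P (Y @^-1` B).
Proof.
move=> m1 I1 GT1 m2 I2 GT2 mX mY PG A B mA mB.
have pm e (U : measurableType e) (Z : T -> U) C : measurable_fun setT Z -> measurable C ->
    measurable (Z @^-1` C).
  by move=> mZ mC; rewrite -[X in measurable X]setTI; exact: mZ.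
apply: (@pi_system_indepl _ _ G1) => //; first exact: pm.
move=> {mA} {}A GA; rewrite setIC muleC.
have mA : measurable A by rewrite m1; exact: sub_sigma_algebra.
apply: (@pi_system_indepl _ _ G2) => //; first exact: pm.
by move=> {mB} {}B GB; rewrite setIC muleC PG.
Qed.

(** Independence makes the law of the pair a product measure; Tonelli's theorem then separates the
    two factors. *)
Lemma ge0_indep_integralM d1 d2 (T1 : measurableType d1) (T2 : measurableType d2)
    (X : T -> T1) (Y : T -> T2) (f : T1 -> \bar R) (g : T2 -> \bar R) :
  measurable_fun setT X -> measurable_fun setT Y ->
  (forall A B, measurable A -> measurable B ->
    P (X @^-1` A `&` Y @^-1` B) = P (X @^-1` A) * P (Y @^-1` B)) ->
  measurable_fun setT f -> measurable_fun setT g ->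
  (forall x, 0 <= f x) -> (forall y, 0 <= g y) ->
  \int[P]_w (f (X w) * g (Y w)) = \int[P]_w f (X w) * \int[P]_w g (Y w).
Proof.
move=> mX mY XY mf mg f0 g0.
pose X' : {mfun T >-> T1} := HB.pack X (isMeasurableFun.Build _ _ _ _ X mX).
pose Y' : {mfun T >-> T2} := HB.pack Y (isMeasurableFun.Build _ _ _ _ Y mY).
have mXY : measurable_fun setT (fun w => (X w, Y w)) by exact: measurable_fun_pair.
pose XY' : {mfun T >-> (T1 * T2)%type} := HB.pack (fun w => (X w, Y w)) (isMeasurableFun.Build _ _ _ _ _ mXY).
have m12 : measurable_fun setT (fun p : T1 * T2 => f p.1 * g p.2).
  apply: emeasurable_funM; first by apply: measurableT_comp mf _; exact: measurable_fst.
  by apply: measurableT_comp mg _; exact: measurable_snd.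
have p0 p : 0 <= f p.1 * g p.2 by rewrite mule_ge0.
have IX : \int[P]_w f (X w) = \int[distribution P X']_x f x.
  by rewrite ge0_integral_distribution.
have IY : \int[P]_w g (Y w) = \int[distribution P Y']_x g x.
  by rewrite ge0_integral_distribution.
transitivity (\int[distribution P XY']_p (f p.1 * g p.2)).
  by rewrite ge0_integral_distribution.
transitivity (\int[(distribution P X' \x distribution P Y')%E]_p (f p.1 * g p.2)).
  apply: eq_measure_integral => A mA _.
  by apply/esym; apply: product_measure_unique => // B C mB mC; exact: XY.
rewrite fubini_tonelli1//= /fubini_F/=.
under eq_integral do rewrite ge0_integralZl//.
by rewrite ge0_integralZr// ?integral_ge0// IX IY.
Qed.

End independence.

(** * Measurability and first argmax of sequences *)

Section measurable_sets.
Context d (T : measurableType d) (R : realType).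

Lemma measurable_set_true (b : T -> bool) :
  measurable_fun setT b -> measurable [set t | b t].
Proof.
by move=> mb; rewrite -[X in measurable X]setTI; exact: (mb measurableT [set true]).
Qed.

Lemma measurable_set_lt (f g : T -> R) : measurable_fun setT f ->
  measurable_fun setT g -> measurable [set t | f t < g t].
Proof. by move=> mf mg; apply: measurable_set_true; exact: measurable_fun_ltr. Qed.

Lemma measurable_set_le (f g : T -> R) : measurable_fun setT f ->
  measurable_fun setT g -> measurable [set t | f t <= g t].
Proof. by move=> mf mg; apply: measurable_set_true; exact: measurable_fun_ler. Qed.

Lemma measurable_set_forall (I : countType) (Q : I -> T -> Prop) :
  (forall i, measurable [set t | Q i t]) -> measurable [set t | forall i, Q i t].
Proof.
move=> mQ; rewrite [X in measurable X](_ : _ =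
    \bigcap_a (if unpickle a is Some i then [set t | Q i t] else setT)).
  by apply: bigcapT_measurable => a; case: unpickle.
apply/seteqP; split => t /= Qt i; first by move=> _; case: unpickle => //= j; exact: Qt.
by have := Qt (pickle i) Logic.I; rewrite pickleK.
Qed.

Lemma measurable_set_exists (I : countType) (Q : I -> T -> Prop) :
  (forall i, measurable [set t | Q i t]) -> measurable [set t | exists i, Q i t].
Proof.
move=> mQ; rewrite [X in measurable X](_ : _ = ~` [set t | forall i, ~ Q i t]).
  by apply: measurableC; apply: measurable_set_forall => i; apply: measurableC; exact: mQ.
apply/seteqP; split => [t [i Qt] nQ|t /= /existsNP[i /contrapT Qt]]; last by exists i.
exact: nQ Qt.
Qed.

Lemma measurable_set_imply (p : Prop) (Q : T -> Prop) :
  (p -> measurable [set t | Q t]) -> measurable [set t | p -> Q t].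
Proof.
move=> mQ; have [hp|np] := pselect p.
  rewrite (_ : mkset _ = [set t | Q t]); first exact: mQ.
  by apply/seteqP; split => t /=; [exact|].
by rewrite (_ : mkset _ = setT)//; apply/seteqP; split => // t _ /np.
Qed.

Lemma measurable_set_and (Q1 Q2 : T -> Prop) : measurable [set t | Q1 t] ->
  measurable [set t | Q2 t] -> measurable [set t | Q1 t /\ Q2 t].
Proof. by move=> m1 m2; exact: measurableI. Qed.

(** A countable gluing; it gives the measurability of quantities read at a random grid index. *)
Lemma measurable_fun_nat_index d' (T' : measurableType d') (F : nat -> T -> T')
    (k : T -> nat) :
  (forall i, measurable_fun setT (F i)) -> (forall i, measurable [set t | k t = i]) ->
  measurable_fun setT (fun t => F (k t) t).
Proof.
move=> mF mk _ B mB; rewrite setTI.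
rewrite [X in measurable X](_ : _ = [set t | exists i, k t = i /\ B (F i t)]).
  apply: measurable_set_exists => i; apply: measurable_set_and; first exact: mk.
  by rewrite -[X in measurable X]setTI; exact: mF.
by apply/seteqP; split => t /=; [exists (k t)|move=> [i [<-]]].
Qed.

End measurable_sets.

Section first_argmax.
Context {R : realType}.
Implicit Types u : nat -> R.

Definition is_first_argmax u i :=
  (forall a, (a < i)%N -> u a < u i) /\ (forall a, u a <= u i).

Definition first_argmax u := xget 0%N [set i | is_first_argmax u i].

Lemma first_argmax_uniq u i j : is_first_argmax u i -> is_first_argmax u j -> i = j.
Proof.
move=> [i1 i2] [j1 j2]; apply/eqP; rewrite eqn_leq; apply/andP; split;
  rewrite leqNgt; apply/negP.
- by move=> /i1; rewrite ltNge j2.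
- by move=> /j1; rewrite ltNge i2.
Qed.

Lemma first_argmaxE u i : is_first_argmax u i -> first_argmax u = i.
Proof.
move=> ui; rewrite /first_argmax; case: xgetP => [j _ /=|/(_ i)//].
by move/first_argmax_uniq; exact.
Qed.

Lemma is_first_argmaxP u : (exists i, is_first_argmax u i) ->
  is_first_argmax u (first_argmax u).
Proof. by move=> [i ui]; rewrite (first_argmaxE ui). Qed.

(** The first condition concerns the values up to step [i], the second only the increments after it.
    This separation into past and future is what independence of increments acts on. *)
Lemma is_first_argmax_split u i : is_first_argmax u i <->
  (forall a, (a < i)%N -> u a < u i) /\ (forall a, u (i + a)%N - u i <= 0).
Proof.
split=> -[h1 h2]; split=> // a; first by rewrite subr_le0.
have [/h1/ltW//|ia] := ltnP a i.
by rewrite -(subnKC ia) -subr_le0.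
Qed.

Lemma first_argmax_exists u : (exists N, forall a, (N <= a)%N -> u a <= u 0%N) ->
  exists i, is_first_argmax u i.
Proof.
move=> [N uN].
pose i0 := [arg max_(i > (ord0 : 'I_N.+1)) u i]%O.
have ui0 a : u a <= u i0.
  rewrite /i0; case: arg_maxP => //= i _ ui.
  have [aN|Na] := leqP a N; first exact: (ui (Ordinal (aN : (a < N.+1)%N))).
  by rewrite (le_trans (uN _ (ltnW Na)))// (ui ord0).
(* [arg max] need not return the smallest maximiser; [ex_minn] selects it, which gives the strict
   inequalities before it. *)
have ex : exists i, [forall j : 'I_N.+1, (u j <= u i)%R] && (u i0 <= u i)%R.
  by exists i0; rewrite lexx andbT; apply/forallP.
pose i := ex_minn ex; exists i; rewrite /i; case: ex_minnP => m /andP[_ mi0] mmin.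
have um a : u a <= u m by rewrite (le_trans (ui0 a)).
split=> // a am; rewrite lt_neqAle um andbT; apply/eqP => uam.
suff : (m <= a)%N by rewrite leqNgt am.
by apply: mmin; rewrite uam um andbT; apply/forallP.
Qed.

Lemma measurable_is_first_argmax d (T : measurableType d) (u : T -> nat -> R) i :
  (forall a, measurable_fun setT (fun t => u t a)) ->
  measurable [set t | is_first_argmax (u t) i].
Proof.
move=> mu; apply: measurable_set_and; apply: measurable_set_forall => a.
- by apply: measurable_set_imply => _; exact: measurable_set_lt.
- exact: measurable_set_le.
Qed.

Lemma measurable_first_argmax d (T : measurableType d) (u : T -> nat -> R) i :
  (forall a, measurable_fun setT (fun t => u t a)) ->
  measurable [set t | first_argmax (u t) = i].
Proof.
move=> mu.
have mi j := measurable_is_first_argmax j mu.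
(* The second set accounts for the default value [0] of [xget] when no first argmax exists. *)
rewrite [X in measurable X](_ : _ = [set t | is_first_argmax (u t) i] `|`
  ([set t | i = 0%N] `&` [set t | forall j, ~ is_first_argmax (u t) j])); last first.
  apply/seteqP; split => t /=.
    rewrite /first_argmax; case: xgetP => [j _ /= uj <-|]; [by left|].
    by move=> un <-; right.
  move=> [|[-> un]]; first exact: first_argmaxE.
  by rewrite /first_argmax; case: xgetP => // j _ /un.
apply: measurableU; first exact: mi.
apply: measurableI.
  by have [->|/eqP ni] := eqVneq i 0%N;
    [rewrite (_ : mkset _ = setT)//; apply/seteqP; split
    |rewrite (_ : mkset _ = set0)//; apply/seteqP; split => t //=].
by apply: measurable_set_forall => j; apply: measurableC; exact: mi.
Qed.

End first_argmax.

(** * The product sigma-algebra on sequences *)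

Section sequence_space.
Context d (V : measurableType d).
Local Open Scope ereal_scope.

(** The cylinder sets, a pi-system generating the product sigma-algebra. Only finitely many
    coordinates are constrained, so that [iid_seq] gives their probabilities. *)
Definition rectangles : set (set (nat -> V)) :=
  [set A | exists B : nat -> set V, [/\ forall a, measurable (B a),
     exists N, forall a, (N <= a)%N -> B a = setT
     & A = [set y | forall a, B a (y a)]]].

Definition seqType := g_sigma_algebraType rectangles.

Lemma setI_closed_rectangles : setI_closed rectangles.
Proof.
move=> _ _ [B [mB [N BN] ->]] [C [mC [M CM] ->]].
exists (fun a => B a `&` C a); split.
- by move=> a; exact: measurableI.
- exists (maxn N M) => a; rewrite geq_max => /andP[Na Ma].
  by rewrite BN// CM// setIT.
- apply/seteqP; split => [y [yB yC] a|y yBC]; first by split; [exact: yB|exact: yC].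
  by split => a; have [] := yBC a.
Qed.

Lemma rectanglesT : rectangles setT.
Proof.
exists (fun=> setT); split => //; first by exists 0%N.
by apply/seteqP; split.
Qed.

Lemma measurable_seq_coord a : measurable_fun setT (fun y : seqType => y a).
Proof.
move=> _ B mB; rewrite setTI; apply: sub_sigma_algebra.
exists (fun b => if b == a then B else setT); split.
- by move=> b; case: ifP.
- by exists a.+1 => b ab; rewrite gtn_eqF.
- apply/seteqP; split => y /=; first by move=> By b; case: eqP => // ->.
  by move=> /(_ a); rewrite eqxx.
Qed.

Lemma measurable_fun_seq d' (T : measurableType d') (y : T -> seqType) :
  (forall a, measurable_fun setT (fun t => y t a)) -> measurable_fun setT y.
Proof.
move=> my; apply: (@measurability _ _ T seqType setT y rectangles erefl) => _ [_ [B [mB _ ->]] <-].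
rewrite setTI.
rewrite [X in measurable X](_ : _ = [set t | forall a, B a (y t a)])//.
apply: measurable_set_forall => a.
by rewrite -[X in measurable X]setTI; exact: my.
Qed.

Lemma measure_seq_unique (R : realType) (m1 m2 : {measure set seqType -> \bar R}) :
  m1 setT < +oo ->
  (forall A, rectangles A -> m1 A = m2 A) -> forall A, measurable A -> m1 A = m2 A.
Proof.
move=> m1T m12; apply: (@measure_unique _ R seqType rectangles (fun=> setT) erefl
  setI_closed_rectangles _ _ m1 m2) => //.
- by move=> _; exact: rectanglesT.
- by apply/seteqP; split => // x _; exists 0%N.
Qed.

End sequence_space.

(** * Random walks *)

Section random_walk.
Context d (T : measurableType d) (R : realType) (P : probability T R).
Context dV (V : measurableType dV).
Local Open Scope ereal_scope.
Variable xi : nat -> T -> V.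

(** Independence and identical distribution in one formula: every factor on the right is computed
    with [xi 0]. *)
Definition iid_seq := forall N (B : nat -> set V), (forall a, measurable (B a)) ->
  P [set w | forall a, (a < N)%N -> B a (xi a w)] =
  \prod_(a < N) P (xi 0%N @^-1` B a).

Hypothesis mxi : forall a, measurable_fun setT (xi a).
Hypothesis iid : iid_seq.

Let walk w : seqType V := fun a => xi a w.

Definition seq_shift i (y : seqType V) : seqType V := fun a => y (i + a)%N.
(** The past is padded with [point] to an infinite sequence, so that past and future take values in
    the same measurable space. *)
Definition seq_trunc i (y : seqType V) : seqType V :=
  fun a => if (a < i)%N then y a else point.

Lemma measurable_seq_shift i : measurable_fun setT (seq_shift i).
Proof. by apply: measurable_fun_seq => a; exact: measurable_seq_coord. Qed.

Lemma measurable_seq_trunc i : measurable_fun setT (seq_trunc i).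
Proof.
apply: measurable_fun_seq => a; rewrite /seq_trunc.
by case: (a < i)%N; [exact: measurable_seq_coord|exact: measurable_cst].
Qed.

Let measurable_walk : measurable_fun setT walk.
Proof. exact: measurable_fun_seq. Qed.

Let iid_shift i N (B : nat -> set V) : (forall a, measurable (B a)) ->
  P [set w | forall a, (a < N)%N -> B a (xi (i + a)%N w)] =
  \prod_(a < N) P (xi 0%N @^-1` B a).
Proof.
move=> mB.
(* The first [i] coordinates are left free and contribute factors equal to 1. *)
have := @iid (i + N)%N (fun a => if (a < i)%N then setT else B (a - i)%N).
rewrite big_split_ord/= big1 ?mul1e; last first.
  by move=> a _; rewrite ltn_ord preimage_setT probability_setT.
under eq_bigr do rewrite ltnNge leq_addr/= addKn.
move=> <-; last by move=> a; case: ifP.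
congr (P _); apply/seteqP; split => w /= H a aN.
  case: ifPn => //; rewrite -leqNgt => ia.
  by have := H (a - i)%N; rewrite subnKC//; apply; rewrite ltn_subLR.
have := H (i + a)%N; rewrite ltn_add2l => /(_ aN).
by rewrite ltnNge leq_addr/= addKn.
Qed.

Lemma iid_shift_law i A : measurable A ->
  P ((fun w => seq_shift i (walk w)) @^-1` A) = P (walk @^-1` A).
Proof.
have ms : measurable_fun setT (fun w => seq_shift i (walk w)).
  by apply: measurableT_comp => //; exact: measurable_seq_shift.
apply: (@measure_seq_unique _ _ _
 (measure_function_pushforward__canonical__measure_function_Measure P ms)
 (measure_function_pushforward__canonical__measure_function_Measure P measurable_walk)).
  by rewrite /= /pushforward preimage_setT probability_setT ltry.
move=> {}A [B [mB [N BN] ->]]; rewrite /= /pushforward.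
transitivity (\prod_(a < N) P (xi 0%N @^-1` B a)); [rewrite -(iid_shift i)//|rewrite -(iid_shift 0)//];
  congr (P _); apply/seteqP; split => w /= H a; by [
    move=> _; exact: H|have [/H//|/BN ->//] := ltnP a N].
Qed.

Lemma iid_past_future i A B : measurable A -> measurable B ->
  P ((fun w => seq_trunc i (walk w)) @^-1` A `&`
     (fun w => seq_shift i (walk w)) @^-1` B) =
  P ((fun w => seq_trunc i (walk w)) @^-1` A) *
  P ((fun w => seq_shift i (walk w)) @^-1` B).
Proof.
have ms : measurable_fun setT (fun w => seq_shift i (walk w)).
  by apply: measurableT_comp => //; exact: measurable_seq_shift.
have mt : measurable_fun setT (fun w => seq_trunc i (walk w)).
  by apply: measurableT_comp => //; exact: measurable_seq_trunc.
move: A B; apply: (@pi_system_indep _ _ _ P _ _ (seqType V) (seqType V) _ _ _ _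
  erefl (@setI_closed_rectangles _ _) (@rectanglesT _ _)
  erefl (@setI_closed_rectangles _ _) (@rectanglesT _ _) mt ms).
move=> _ _ [B [mB _ ->]] [C [mC [N CN] ->]].
(* The truncated sequence equals [point] from index [i] on: a rectangle that excludes [point] at
   such an index has empty preimage, and both sides vanish. *)
have [Bp|/existsNP[a /not_implyP[ia nBa]]] :=
  pselect (forall a, (i <= a)%N -> B a point); last first.
  rewrite (_ : _ @^-1` _ = set0) ?set0I ?measure0 ?mul0e//.
  by apply/seteqP; split => // w /= /(_ a); rewrite /seq_trunc ltnNge ia.
have -> : (fun w => seq_trunc i (walk w)) @^-1` [set y | forall a, B a (y a)] =
    [set w | forall a, (a < i)%N -> B a (xi a w)].
  apply/seteqP; split => w /= H a; first by move=> ai; have := H a; rewrite /seq_trunc ai.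
  by rewrite /seq_trunc; case: ltnP => [/H|/Bp].
have -> : (fun w => seq_shift i (walk w)) @^-1` [set y | forall a, C a (y a)] =
    [set w | forall a, (a < N)%N -> C a (xi (i + a)%N w)].
  by apply/seteqP; split => w /= H a; [move=> _; exact: H|have [/H//|/CN ->//] := ltnP a N].
rewrite iid// iid_shift//.
have := @iid (i + N)%N (fun a => if (a < i)%N then B a else C (a - i)%N).
rewrite big_split_ord/=.
under eq_bigr do rewrite ltn_ord.
under [X in _ * X]eq_bigr do rewrite ltnNge leq_addr/= addKn.
move=> <-; last by move=> a; case: ifP.
congr (P _); apply/seteqP; split => [w /= [H1 H2] a aN|w /= H].
  case: ltnP => [/H1//|ia].
  by have := H2 (a - i)%N; rewrite subnKC//; apply; rewrite ltn_subLR.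
split=> a aN.
  by have := H a; rewrite aN; apply; exact: ltn_addr.
have := H (i + a)%N; rewrite ltn_add2l => /(_ aN).
by rewrite ltnNge leq_addr/= addKn.
Qed.

Lemma iid_integralM i (f g : seqType V -> \bar R) :
  measurable_fun setT f -> measurable_fun setT g ->
  (forall y, 0 <= f y) -> (forall y, 0 <= g y) ->
  \int[P]_w (f (seq_trunc i (walk w)) * g (seq_shift i (walk w))) =
  \int[P]_w f (seq_trunc i (walk w)) * \int[P]_w g (walk w).
Proof.
move=> mf mg f0 g0.
have ms : measurable_fun setT (fun w => seq_shift i (walk w)).
  by apply: measurableT_comp => //; exact: measurable_seq_shift.
have mt : measurable_fun setT (fun w => seq_trunc i (walk w)).
  by apply: measurableT_comp => //; exact: measurable_seq_trunc.
rewrite (@ge0_indep_integralM _ _ _ _ _ _ _ _ (fun w => seq_trunc i (walk w)) (fun w => seq_shift i (walk w)) f g)//.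
  congr (_ * _).
  have -> : \int[P]_w g (seq_shift i (walk w)) =
      \int[pushforward P (fun w => seq_shift i (walk w))]_y g y.
    by rewrite ge0_integral_pushforward.
  have -> : \int[P]_w g (walk w) = \int[pushforward P walk]_y g y.
    by rewrite ge0_integral_pushforward.
  apply: (@eq_measure_integral _ (seqType V) R setT
    (measure_function_pushforward__canonical__measure_function_Measure P measurable_walk)
    (measure_function_pushforward__canonical__measure_function_Measure P ms)) => A mA _.
  exact: iid_shift_law.
exact: iid_past_future.
Qed.

End random_walk.

(** * Splitting an i.i.d. sequence at a first argmax *)

Section splitting.
Context d (T : measurableType d) (R : realType) (P : probability T R).
Context dV (V : measurableType dV).
Local Open Scope ereal_scope.
Variables (xi : nat -> T -> V) (u : seqType V -> nat -> R).
Hypothesis mxi : forall a, measurable_fun setT (xi a).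
Hypothesis iid : iid_seq P xi.
Hypothesis mu : forall a, measurable_fun setT (fun y => u y a).
Hypothesis u_trunc : forall i y a, (a <= i)%N -> u (seq_trunc i y) a = u y a.
Hypothesis u_shift : forall i y a, u (seq_shift i y) a = (u y (i + a)%N - u y i)%R.

Let walk w : seqType V := fun a => xi a w.
Let tau w := first_argmax (u (walk w)).

Hypothesis tau_exists : {ae P, forall w, exists i, is_first_argmax (u (walk w)) i}.

Let measurable_walk : measurable_fun setT walk.
Proof. exact: measurable_fun_seq. Qed.

Let mtau i : measurable [set w | tau w = i].
Proof.
by apply: measurable_first_argmax => a; exact: measurableT_comp (mu a) measurable_walk.
Qed.

Let ladder i := [set y | forall a, (a < i)%N -> (u y a < u y i)%R].
Let nonpos := [set y | forall a, (u y a <= 0)%R].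

Let mladder i : measurable (ladder i).
Proof.
apply: measurable_set_forall => a; apply: measurable_set_imply => _.
exact: measurable_set_lt.
Qed.

Let mnonpos : measurable nonpos.
Proof. by apply: measurable_set_forall => a; exact: measurable_set_le. Qed.

Section identity.
Variables (Phi : nat -> seqType V -> \bar R) (Psi : seqType V -> \bar R).
Hypothesis mPhi : forall i, measurable_fun setT (Phi i).
Hypothesis mPsi : measurable_fun setT Psi.
Hypothesis Phi_trunc : forall i y, Phi i (seq_trunc i y) = Phi i y.
Hypothesis Phi0 : forall i y, 0 <= Phi i y.
Hypothesis Psi0 : forall y, 0 <= Psi y.
Hypothesis Psi1 : forall y, Psi y <= 1.

(** Almost surely exactly one index is both a strict record and followed by a walk that stays
    nonpositive. For each index the two events are independent, and by stationarity the future
    factor is the same for all indices, so it leaves the sum. *)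
Lemma splitting_sum :
  \int[P]_w (Phi (tau w) (walk w) * Psi (seq_shift (tau w) (walk w))) =
  (\sum_(i <oo) \int[P]_w ((\1_(ladder i) (walk w))%:E * Phi i (walk w))) *
  \int[P]_w ((\1_nonpos (walk w))%:E * Psi (walk w)).
Proof.
pose F i y := (\1_(ladder i) y)%:E * Phi i y.
pose H y := (\1_nonpos y)%:E * Psi y.
have mF i : measurable_fun setT (F i).
  by apply: emeasurable_funM => //; exact/measurable_EFinP/measurable_indic.
have mH : measurable_fun setT H.
  by apply: emeasurable_funM => //; exact/measurable_EFinP/measurable_indic.
have F0 i y : 0 <= F i y by rewrite mule_ge0// lee_fin.
have H0 y : 0 <= H y by rewrite mule_ge0// lee_fin.
have FT i y : F i (seq_trunc i y) = F i y.
  rewrite /F Phi_trunc; congr ((_ : R)%:E * _); rewrite !indicE; congr ((_ : bool)%:R).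
  apply/idP/idP; rewrite !inE => yL a ai; have := yL a ai;
    by rewrite !u_trunc// ltnW.
have mFH i : measurable_fun setT (fun w => F i (walk w) * H (seq_shift i (walk w))).
  apply: emeasurable_funM; first exact: measurableT_comp (mF i) measurable_walk.
  apply: measurableT_comp => //; apply: measurableT_comp => //.
  exact: measurable_seq_shift.
transitivity (\int[P]_w \sum_(i <oo) F i (walk w) * H (seq_shift i (walk w))).
  apply: ge0_ae_eq_integral => //.
  - apply: (@measurable_fun_nat_index _ _ _ _ (fun i w => Phi i (walk w) * Psi (seq_shift i (walk w))) tau) => // i.
    apply: emeasurable_funM; first exact: measurableT_comp.
    apply: measurableT_comp => //; apply: measurableT_comp => //.
    exact: measurable_seq_shift.
  - by apply: ge0_emeasurable_sum => // *; rewrite mule_ge0.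
  - by move=> *; rewrite mule_ge0.
  - by move=> *; apply: nneseries_ge0 => *; rewrite mule_ge0.
  (* Only the term of index [tau w] survives: a nonzero term would make its index a first argmax,
     and that is unique. *)
  - apply: filterS tau_exists => w [i wi] _.
    have -> : tau w = i by exact: first_argmaxE.
    rewrite (@nneseriesD1 _ _ i)//; last by move=> *; rewrite mule_ge0.
    have [wi1 wi2] := (is_first_argmax_split _ _).1 wi.
    rewrite eseries0 ?adde0.
      rewrite /F /H !indicE !mem_set ?mul1e// => a.
      by rewrite u_shift.
    move=> j _ ji.
    have [wj|nwj] := pselect (ladder j (walk w)); last first.
      by rewrite /F indicE memNset// mul0e mul0e.
    have [wj'|nwj'] := pselect (nonpos (seq_shift j (walk w))); last first.
      by rewrite /H indicE memNset// mul0e mule0.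
    exfalso; move/eqP: ji; apply; apply: (@first_argmax_uniq _ (u (walk w))) => //.
    by apply/is_first_argmax_split; split => // a; rewrite -u_shift.
rewrite integral_nneseries//; last by move=> *; rewrite mule_ge0.
under eq_eseriesr => i _.
  under eq_integral do rewrite -FT.
  rewrite (iid_integralM mxi iid)//.
  under eq_integral do rewrite FT.
  over.
have H1 y : H y <= 1 by rewrite /H indicE; case: (_ \in _); rewrite ?mul1e ?mul0e ?lee01.
have mHw : measurable_fun setT (fun w => H (walk w)) by exact: measurableT_comp mH measurable_walk.
(* The common factor must be finite to be pulled out of the series; this is where [Psi1] enters. *)
have intH : \int[P]_w H (walk w) = (fine (\int[P]_w H (walk w)))%:E.
  rewrite fineK// ge0_fin_numE ?integral_ge0//.
  apply: (@le_lt_trans _ _ (\int[P]_w cst 1 w)); first exact: ge0_le_integral.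
  by rewrite integral_cst// mul1e (le_lt_trans (probability_le1 P measurableT))// ltry.
rewrite -[RHS]/((\sum_(i <oo) \int[P]_w F i (walk w)) * \int[P]_w H (walk w)).
rewrite intH muleC -nneseriesZl; last by move=> i _; exact: integral_ge0.
by apply: eq_eseriesr => i _; rewrite muleC.
Qed.

End identity.

(** The identity [splitting_sum] is used four times, with [Phi] and [Psi] kept or replaced by 1. The
    case of two constants gives [c1 * d1 = 1], whence cP dP = (cP d1) (c1 dP). *)
Lemma splitting (Phi : nat -> seqType V -> \bar R) (Psi : seqType V -> \bar R) :
  (forall i, measurable_fun setT (Phi i)) -> measurable_fun setT Psi ->
  (forall i y, Phi i (seq_trunc i y) = Phi i y) ->
  (forall i y, 0 <= Phi i y) -> (forall y, 0 <= Psi y) -> (forall y, Psi y <= 1) ->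
  \int[P]_w (Phi (tau w) (walk w) * Psi (seq_shift (tau w) (walk w))) =
  \int[P]_w Phi (tau w) (walk w) * \int[P]_w Psi (seq_shift (tau w) (walk w)).
Proof.
move=> mPhi mPsi PhiT Phi0 Psi0 Psi1.
have one0 : forall y : seqType V, 0 <= (cst 1 y : \bar R) by move=> y; exact: lee01.
have m1 : measurable_fun [set: seqType V] (cst (1 : \bar R)) by exact: measurable_cst.
have one1 : forall y : seqType V, (cst 1 y : \bar R) <= 1 by move=> y; exact: lexx.
have E11 := @splitting_sum (fun=> cst 1) (cst 1) (fun=> m1) m1 (fun _ _ => erefl) (fun=> one0) one0 one1.
have EP1 := splitting_sum mPhi m1 PhiT Phi0 one0 one1.
have E1P := @splitting_sum (fun=> cst 1) Psi (fun=> m1) mPsi (fun _ _ => erefl) (fun=> one0) Psi0 Psi1.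
have EPP := splitting_sum mPhi mPsi PhiT Phi0 Psi0 Psi1.
set cP := (X in X * _) in EPP EP1; set dP := (X in _ * X) in EPP E1P.
set c1 := (X in X * _) in E11 E1P; set d1 := (X in _ * X) in E11 EP1.
have {}E11 : 1 = c1 * d1.
  rewrite -E11; under eq_integral do rewrite /= mule1.
  by rewrite integral_cst// mul1e; exact/esym/probability_setT.
have {}EP1 : \int[P]_w Phi (tau w) (walk w) = cP * d1.
  by rewrite -EP1; apply: eq_integral => w _; rewrite /= mule1.
have {}E1P : \int[P]_w Psi (seq_shift (tau w) (walk w)) = c1 * dP.
  by rewrite -E1P; apply: eq_integral => w _; rewrite /= mul1e.
move: EPP EP1 E1P => -> -> ->.
by rewrite [c1 * _]muleC muleACA [d1 * c1]muleC -E11 mule1.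
Qed.

End splitting.

(** * Levy increments along a grid *)

Section increments.
Context d (T : measurableType d) (R : realType) (P : probability T R).

Lemma sigma_gen_measurable_fun (I : Type) (D : set I) (f : I -> T -> R) i : D i ->
  measurable_fun setT
   (f i : g_sigma_algebraType (\bigcup_(j in D) preimage_set_system setT (f j) measurable) -> R).
Proof. by move=> Di _ B mB; apply: sub_sigma_algebra; exists i => //; exists B. Qed.

Lemma sigma_gen_sub (I : Type) (D : set I) (f : I -> T -> R) A :
  (forall i, D i -> measurable_fun setT (f i)) -> sigma_gen D f A -> measurable A.
Proof.
move=> mf; apply: smallest_sub; first exact: sigma_algebra_measurable.
by move=> _ [i Di [B mB <-]]; exact: mf.
Qed.

Variables (m : nat) (Y : 'I_m -> R -> T -> R) (h : R).
Hypotheses (Ylevy : levy_process P Y) (h0 : 0 <= h).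

Definition increments (a : nat) (w : T) : m.-tuple R :=
  [tuple Y i (h * a.+1%:R) w - Y i (h * a%:R) w | i < m].

Lemma measurable_increments a : measurable_fun setT (increments a).
Proof.
have [mY _ _ _ _] := Ylevy.
apply/measurable_fun_tnthP => i.
rewrite (_ : _ \o _ = (fun w => Y i (h * a.+1%:R) w - Y i (h * a%:R) w)); last first.
  by apply/funext => w /=; rewrite tnth_mktuple.
by apply: measurable_funB; apply: mY; rewrite mulr_ge0.
Qed.

Lemma iid_increments : iid_seq P increments.
Proof.
move=> N B mB; have [mY _ _ stat indep] := Ylevy.
have h_homo : {homo (fun j : nat => h * j%:R) : a b / (a <= b)%N >-> a <= b}.
  by move=> a b ab; rewrite ler_wpM2l// ler_nat.
have h00 : 0 <= h * 0%:R by rewrite mulr0.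
have H := indep (fun j => h * j%:R) N h00 h_homo [set: 'I_N]%SET
  (fun j => increments j @^-1` B j).
transitivity (P (\bigcap_(j in [set` [set: 'I_N]%SET]) (increments j @^-1` B j))).
  congr (P _); apply/seteqP; split => [w /= wB j _|w /= wB a aN]; first exact: wB.
  by have := wB (Ordinal aN); apply; rewrite /= inE.
rewrite H.
  rewrite big_mkcond/=; apply: eq_bigr => j _; rewrite inE.
  (* Stationarity compares an increment with [Y i h] itself; the law of the latter links step [j] to
     step 0. *)
  transitivity (pushforward P (fun w => [tuple Y i h w | i < m]) (B j)).
    rewrite -(stat h (h * j%:R))// ?mulr_ge0// /pushforward.
    apply: (congr1 (fun f => P (f @^-1` B j))); apply/funext => w; apply: eq_from_tnth => i; rewrite !tnth_mktuple.
    by rewrite -natr1 mulrDr mulr1.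
  rewrite -(stat h 0)// /pushforward.
  by apply: (congr1 (fun f => P (f @^-1` B j))); apply/funext => w; apply: eq_from_tnth => i; rewrite !tnth_mktuple mulr0 mulr1 add0r.
move=> j _.
  pose f (i : 'I_m) w := Y i (h * j.+1%:R) w - Y i (h * j%:R) w.
  have mj : measurable_fun setT (increments j :
      g_sigma_algebraType (\bigcup_(i in setT) preimage_set_system setT (f i) measurable) -> _).
    apply/measurable_fun_tnthP => i.
    rewrite (_ : _ \o _ = f i); last by apply/funext => w /=; rewrite tnth_mktuple.
    exact: sigma_gen_measurable_fun.
  by have := mj measurableT _ (mB j); rewrite setTI.
Qed.

End increments.

Lemma measurable_sum_cond d (T : measurableType d) (R : realType) (I : Type)
    (s : seq I) (Q : pred I) (h : I -> T -> R) :
  (forall i, Q i -> measurable_fun setT (h i)) ->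
  measurable_fun setT (fun x => \sum_(i <- s | Q i) h i x).
Proof.
move=> mh; under eq_fun do rewrite big_mkcond/=.
by apply: measurable_sum => i; case Qi: (Q i); [exact: mh|exact: measurable_cst].
Qed.

Lemma measurable_EFin_expR d (T : measurableType d) (R : realType) (f : T -> R) :
  measurable_fun setT f -> measurable_fun setT (fun w => (expR (f w))%:E).
Proof. by move=> mf; apply/measurable_EFinP; exact: measurableT_comp. Qed.

(** * Laplace transforms of subordinators on a grid *)

Section laplace.
Context d (T : measurableType d) (R : realType) (P : probability T R).

Lemma integral_expR_gt0 (f : T -> R) : measurable_fun setT f ->
  (0 < \int[P]_w (expR (f w))%:E)%E.
Proof.
move=> mf; rewrite lt0e integral_ge0 ?andbT; last first.
  by move=> w _; rewrite lee_fin expR_ge0.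
apply/eqP => I0.
have mE : measurable_fun setT (fun w => (expR (f w))%:E) by exact: measurable_EFin_expR.
have /(ae_eq_integral_abs P measurableT mE) : (\int[P]_w `|(expR (f w))%:E| = 0)%E.
  by rewrite -[RHS]I0; apply: eq_integral => w _; rewrite gee0_abs// lee_fin expR_ge0.
move=> [N [mN N0 subN]].
have : P setT = 0%E.
  apply/eqP; rewrite -measure_le0 -N0; apply: le_measure; rewrite ?inE//.
  move=> w _; apply: subN => /= /(_ I) [] /eqP.
  by rewrite expR_eq0.
by rewrite probability_setT => /eqP; rewrite onee_eq0.
Qed.

Lemma integral_expRN_le1 (f : T -> R) : measurable_fun setT f ->
  {ae P, forall w, 0 <= f w} -> (\int[P]_w (expR (- f w))%:E <= 1)%E.
Proof.
move=> mf f0.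
apply: (@le_trans _ _ (\int[P]_w cst 1%E w)%E); last first.
  by rewrite integral_cst// mul1e; exact: probability_le1.
apply: ae_ge0_le_integral => //.
- by apply: measurable_EFin_expR; exact: measurableT_comp.
- by apply: filterS f0 => w fw _ /=; rewrite lee_fin expR_le1 oppr_le0.
Qed.

Definition partial_sum m (y : seqType (m.-tuple R)) (i : 'I_m) (a : nat) : R :=
  \sum_(b < a) tnth (y b) i.

Lemma measurable_partial_sum m (i : 'I_m) a :
  measurable_fun setT (fun y : seqType (m.-tuple R) => partial_sum y i a).
Proof.
apply: measurable_sum_cond => b _.
apply: (@measurableT_comp _ _ _ _ _ _ (fun v : m.-tuple R => tnth v i)).
  exact: measurable_tnth.
exact: measurable_seq_coord.
Qed.

Lemma partial_sum_trunc m i (y : seqType (m.-tuple R)) j a : (a <= i)%N ->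
  partial_sum (seq_trunc i y) j a = partial_sum y j a.
Proof.
move=> ai; apply: eq_bigr => b _; rewrite /seq_trunc.
by rewrite (leq_trans (ltn_ord b) ai).
Qed.

Lemma partial_sum_shift m i (y : seqType (m.-tuple R)) j a :
  partial_sum (seq_shift i y) j a = partial_sum y j (i + a) - partial_sum y j i.
Proof.
rewrite /partial_sum big_split_ord/= [RHS]addrAC subrr add0r.
by apply: eq_bigr => b _.
Qed.

Lemma partial_sum_increments m (Y : 'I_m -> R -> T -> R) h j a w :
  partial_sum (fun b => increments Y h b w) j a = Y j (h * a%:R) w - Y j 0 w.
Proof.
rewrite /partial_sum.
under eq_bigr do rewrite tnth_mktuple.
rewrite -(big_mkord xpredT (fun b => Y j (h * b.+1%:R) w - Y j (h * b%:R) w)).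
by rewrite telescope_sumr// mulr0.
Qed.

(** Independence and stationarity make the transform multiplicative along the grid, hence a power
    [l ^+ a]. With mesh [m.+1%:R^-1], time 1 is the grid point of index [m.+1], which ties [l] to
    [laplace_exponent]. *)
Lemma subordinator_laplace (Y : R -> T -> R) (c : R) (m a : nat) :
  subordinator P Y -> 0 <= c -> let h := m.+1%:R^-1 in
  (\int[P]_w (expR (- (c * Y (h * a%:R) w)))%:E =
   (expR (- (laplace_exponent P Y c * (h * a%:R))))%:E)%E.
Proof.
move=> [Ylevy Ymono] c0 h.
have h0 : 0 <= h by rewrite invr_ge0.
have [mY _ Y0 _ _] := Ylevy.
have mYt t : 0 <= t -> measurable_fun setT (Y t) by move=> t0; exact: mY ord0 _ t0.
have Yge0 : {ae P, forall w, forall t, 0 <= t -> 0 <= Y t w}.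
  apply: filterS2 Ymono Y0 => w Ym /(_ ord0) Y0w t t0.
  by rewrite -Y0w Ym.
pose L t := (\int[P]_w (expR (- (c * Y t w)))%:E)%E.
have mcY t : 0 <= t -> measurable_fun setT (fun w => c * Y t w).
  by move=> t0; apply: measurable_funM => //; exact: mYt.
have ha b : 0 <= h * b%:R by rewrite mulr_ge0.
have LS b : (L (h * b.+1%:R)%R = L (h * b%:R)%R * L (h * 1%:R)%R)%E.
  have mI := measurable_increments Ylevy h0.
  have mp e : measurable_fun setT (fun y : seqType (1.-tuple R) =>
      (expR (- (c * partial_sum y ord0 e)))%:E).
    apply: measurable_EFin_expR; apply: measurableT_comp => //.
    by apply: measurable_funM => //; exact: measurable_partial_sum.
  have p0 e (y : seqType (1.-tuple R)) : (0 <= (expR (- (c * partial_sum y ord0 e)))%:E)%E.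
    by rewrite lee_fin expR_ge0.
  pose walk w : seqType (1.-tuple R) := fun a => increments (fun=> Y) h a w.
  have mwalk : measurable_fun setT walk by exact: measurable_fun_seq.
  have mt : measurable_fun setT (fun w => seq_trunc b (walk w)).
    exact: measurableT_comp (@measurable_seq_trunc _ _ b) mwalk.
  have ms : measurable_fun setT (fun w => seq_shift b (walk w)).
    exact: measurableT_comp (@measurable_seq_shift _ _ b) mwalk.
  have := iid_integralM mI (iid_increments Ylevy h0) b (mp b) (mp 1%N) (p0 b) (p0 1%N).
  set I1 := (\int[P]_w _)%E; set I2 := (\int[P]_w _)%E; set I3 := (\int[P]_w _)%E.
  have -> : I1 = L (h * b.+1%:R).
    apply: ae_eq_integral => //.
    - apply: emeasurable_funM.
      + exact: (measurableT_comp (mp b) mt).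
      + exact: (measurableT_comp (mp 1%N) ms).
    - by apply: measurable_EFin_expR; apply: measurableT_comp => //; exact: mcY.
    - apply: filterS Y0 => w /(_ ord0) Y0w _.
      rewrite partial_sum_trunc// partial_sum_shift !partial_sum_increments Y0w !subr0.
      by rewrite -EFinM -expRD addn1 -opprD -mulrDr addrC subrK.
  have -> : I2 = L (h * b%:R).
    apply: ae_eq_integral => //.
    - exact: (measurableT_comp (mp b) mt).
    - by apply: measurable_EFin_expR; apply: measurableT_comp => //; exact: mcY.
    - apply: filterS Y0 => w /(_ ord0) Y0w _.
      by rewrite partial_sum_trunc// !partial_sum_increments Y0w !subr0.
  have -> // : I3 = L (h * 1%:R).
    apply: ae_eq_integral => //.
    - exact: (measurableT_comp (mp 1%N) mwalk).
    - by apply: measurable_EFin_expR; apply: measurableT_comp => //; exact: mcY.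
    - apply: filterS Y0 => w /(_ ord0) Y0w _.
      by rewrite !partial_sum_increments Y0w !subr0.
have L0 : L (h * 0%:R) = 1%E.
  transitivity (\int[P]_w cst 1%E w)%E.
    apply: ae_eq_integral => //; first by apply: measurable_EFin_expR; apply: measurableT_comp => //; exact: mcY.
    by apply: filterS Y0 => w /(_ ord0) Y0w _; rewrite mulr0 Y0w mulr0 oppr0 expR0.
  by rewrite integral_cst// mul1e; exact: probability_setT.
pose l := fine (L (h * 1%:R)).
have Lgt0 : (0 < L (h * 1%:R)%R)%E.
  by apply: integral_expR_gt0; apply: measurableT_comp => //; exact: mcY.
have Lle1 : (L (h * 1%:R)%R <= 1)%E.
  apply: integral_expRN_le1; first exact: mcY.
  by apply: filterS Yge0 => w Yw; rewrite mulr_ge0// Yw.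
have Ll : L (h * 1%:R) = l%:E.
  by rewrite fineK// ge0_fin_numE ?(ltW Lgt0)// (le_lt_trans Lle1) ?ltry.
have l0 : 0 < l by rewrite -lte_fin -Ll.
have LX b : L (h * b%:R) = (l ^+ b)%:E.
  by elim: b => [|b IH]; rewrite ?L0// LS IH Ll -EFinM -exprSr.
have -> : laplace_exponent P Y c = - (m.+1%:R * ln l).
  have := LX m.+1; rewrite mulVf ?pnatr_eq0// /L /laplace_exponent unlock => ->/=.
  by rewrite lnXn// mulr_natl.
rewrite -[LHS]/(L (h * a%:R)) LX mulNr opprK /h.
by rewrite [m.+1%:R * _]mulrC -mulrA mulVKf ?pnatr_eq0// expRM_natr lnK.
Qed.

End laplace.

(** * Independence of a driver from the earlier ones *)

Section independent_subordinators.
Context d (T : measurableType d) (R : realType) (P : probability T R).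
Variables (N : nat) (Z : 'I_N -> R -> T -> R).
Hypothesis mZ : forall j t, 0 <= t -> measurable_fun setT (Z j t).
Let F (j : 'I_N) := sigma_gen [set t : R | 0 <= t] (Z j).
Hypothesis indep : mutually_independent P F.

(** Intersections of one event per process: a pi-system generating the sigma-algebra of the
    processes of index below [L], on which [mutually_independent] gives the probabilities
    directly. *)
Definition joint_events (L : nat) : set (set T) :=
  [set A | exists B : 'I_N -> set T, (forall j, F j (B j)) /\
     A = [set w | forall j : 'I_N, (j < L)%N -> B j w]].

Let FT j : F j setT.
Proof.
rewrite -(setCK setT) setCT; apply: sigma_algebraC; exact: sigma_algebra0.
Qed.

Let FI j A B : F j A -> F j B -> F j (A `&` B).
Proof.
exact: (@measurableI _ (g_sigma_algebraType
  (\bigcup_(i in [set t : R | 0 <= t]) preimage_set_system setT (Z j i) measurable))).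
Qed.

Let Fm j A : F j A -> measurable A.
Proof. by apply: sigma_gen_sub => t /= t0; exact: mZ. Qed.

Lemma joint_events_le L L' : (L <= L')%N -> joint_events L `<=` joint_events L'.
Proof.
move=> LL' _ [B [FB ->]]; exists (fun j : 'I_N => if (j < L)%N then B j else setT); split.
  by move=> j; case: ifP.
apply/seteqP; split => w /= wB j jL; first by case: ifP => // /wB.
by have := wB j (leq_trans jL LL'); rewrite jL.
Qed.

Lemma setI_closed_joint_events L : setI_closed (joint_events L).
Proof.
move=> _ _ [B [FB ->]] [C [FC ->]]; exists (fun j => B j `&` C j); split.
  by move=> j; exact: FI.
apply/seteqP; split => [w /= [wB wC] j jL|w /= wBC].
  by split; [exact: wB|exact: wC].
by split => j /wBC[].
Qed.

Lemma joint_eventsT L : joint_events L setT.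
Proof. by exists (fun=> setT); split => //; apply/seteqP; split. Qed.

Lemma joint_events_measurable L : joint_events L `<=` measurable.
Proof.
move=> _ [B [FB ->]].
rewrite [X in measurable X](_ : _ =
    \bigcap_(j in [set` [set j : 'I_N | (j < L)%N]%SET]) B j); last first.
  by apply/seteqP; split => w /= wB j => [|jL]; [rewrite /= inE => /wB|apply: wB; rewrite /= inE].
by apply: fin_bigcap_measurable => // j _; exact: Fm (FB j).
Qed.

Notation jointType L := (g_sigma_algebraType (joint_events L)).

Lemma measurable_joint_coord L (j : 'I_N) (t : R) : (j < L)%N -> 0 <= t ->
  measurable_fun setT (Z j t : jointType L -> R).
Proof.
move=> jL t0 _ B mB; rewrite setTI; apply: sub_sigma_algebra.
exists (fun i : 'I_N => if i == j then Z j t @^-1` B else setT); split.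
  move=> i; case: eqP => // ->; apply: sub_sigma_algebra.
  by exists t => //; exists B => //; rewrite setTI.
apply/seteqP; split => w /= wB; first by move=> i _; case: eqP.
by have := wB j jL; rewrite eqxx.
Qed.

Lemma measurable_joint_le L L' d' (T' : measurableType d') (f : T -> T') :
  (L <= L')%N -> measurable_fun setT (f : jointType L -> T') ->
  measurable_fun setT (f : jointType L' -> T').
Proof.
move=> LL' mf _ B mB; have := mf measurableT B mB.
by apply: sub_sigma_algebra2; exact: joint_events_le.
Qed.

Lemma measurable_joint L d' (T' : measurableType d') (f : T -> T') :
  measurable_fun setT (f : jointType L -> T') -> measurable_fun setT f.
Proof.
move=> mf _ B mB; have := mf measurableT B mB.
by apply: smallest_sub; [exact: sigma_algebra_measurable|exact: joint_events_measurable].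
Qed.

(** On the generating pi-system this is mutual independence applied to the indices below [l], then
    to the indices up to [l]; [pi_system_indepl] extends it to the whole sigma-algebra of the
    earlier drivers. *)
Lemma joint_indep (l : 'I_N) (s : R) (f : T -> \bar R) (g : R -> \bar R) : 0 <= s ->
  measurable_fun setT (f : jointType l -> \bar R) -> measurable_fun setT g ->
  (forall w, 0 <= f w)%E -> (forall x, 0 <= g x)%E ->
  (\int[P]_w (f w * g (Z l s w)) = \int[P]_w f w * \int[P]_w g (Z l s w))%E.
Proof.
move=> s0 mf mg f0 g0.
have mid : measurable_fun [set: T] (idfun : T -> jointType l).
  move=> _ A mA; rewrite setTI; move: A mA.
  by apply: smallest_sub; [exact: sigma_algebra_measurable|exact: joint_events_measurable].
apply: (@ge0_indep_integralM _ _ _ P _ _ (jointType l) _ idfun (Z l s)) => //; first exact: mZ.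
move=> A B mA mB.
have FlB : F l (Z l s @^-1` B).
  by apply: sub_sigma_algebra; exists s => //; exists B => //; rewrite setTI.
move: A mA; apply: (@pi_system_indepl _ _ _ P _ (jointType l) _ _ _ erefl
  (@setI_closed_joint_events l) (@joint_eventsT l) mid); first exact: Fm FlB.
move=> _ [C [FC ->]].
have -> : idfun @^-1` [set w | forall j : 'I_N, (j < l)%N -> C j w] =
    \bigcap_(j in [set` [set j : 'I_N | (j < l)%N]%SET]) C j.
  by apply/seteqP; split => w /= wB j => [|jL]; [rewrite /= inE => /wB|apply: wB; rewrite /= inE].
rewrite (@indep [set j : 'I_N | (j < l)%N]%SET C)//.
pose C' (j : 'I_N) := if j == l then Z l s @^-1` B else C j.
have := @indep [set j : 'I_N | (j <= l)%N]%SET C'.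
have -> : \bigcap_(j in [set` [set j : 'I_N | (j <= l)%N]%SET]) C' j =
    \bigcap_(j in [set` [set j : 'I_N | (j < l)%N]%SET]) C j `&` Z l s @^-1` B.
  have neq_l (j : 'I_N) : (j < l)%N -> (j == l) = false.
    by move=> jl; apply/negbTE; rewrite -val_eqE/= ltn_eqF.
  apply/seteqP; split => [w /= wC|w /= [wC wB] j].
    split; last by have := wC l; rewrite /C' eqxx; apply; rewrite /= inE.
    move=> j /=; rewrite inE => jl; have := wC j.
    by rewrite /C' neq_l//; apply; rewrite /= inE ltnW.
  rewrite /= inE leq_eqVlt => /predU1P[/val_inj ->|jl]; first by rewrite /C' eqxx.
  by rewrite /C' neq_l//; apply: wC; rewrite /= inE.
move=> -> ; last by move=> j _; rewrite /C'; case: eqP => [->|].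
rewrite (bigD1 l)/=; last by rewrite inE.
rewrite /C' eqxx muleC; congr (_ * _)%E; apply: eq_big => [j|j].
  by rewrite !inE -val_eqE/= ltn_neqAle andbC.
by rewrite !inE => /andP[_ /negbTE ->].
Qed.

(** Drivers are integrated out one at a time, starting from the highest index: the last one is
    independent of the rest of the integrand, which only involves drivers of smaller index. *)
Lemma joint_laplace (k L : nat) (f : T -> \bar R) (c : 'I_N -> R) (m a : nat) :
  let h := m.+1%:R^-1 in
  (forall l : 'I_N, (k <= l)%N -> subordinator P (Z l)) -> (forall l, 0 <= c l) ->
  measurable_fun setT (f : jointType k -> \bar R) -> (forall w, 0 <= f w)%E ->
  (k <= L <= N)%N ->
  (\int[P]_w (f w * (expR (- (\sum_(l < N | (k <= l < L)%N) c l * Z l (h * a%:R) w)))%:E) =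
   \int[P]_w (f w * (expR (- (\sum_(l < N | (k <= l < L)%N)
      laplace_exponent P (Z l) (c l) * (h * a%:R))))%:E))%E.
Proof.
move=> h sub c0 mf f0.
have ha : 0 <= h * a%:R by rewrite mulr_ge0// invr_ge0.
elim: L => [|L IH] /andP[kL LN].
  by apply: eq_integral => w _; rewrite !big1// => l; rewrite ltn0 andbF.
have [kEL|] := eqVneq k L.+1.
  have sum0 (x : 'I_N -> R) : \sum_(l < N | (k <= l < L.+1)%N) x l = 0.
    by apply: big_pred0 => l; rewrite kEL ltnS ltnNge andNb.
  by apply: eq_integral => w _; rewrite !sum0.
move=> kN; have {}kL : (k <= L)%N by rewrite -ltnS ltn_neqAle kN.
pose l := Ordinal LN.
have split_l (x : 'I_N -> R) : \sum_(j < N | (k <= j < L.+1)%N) x j =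
    \sum_(j < N | (k <= j < L)%N) x j + x l.
  rewrite (bigD1 l)/=; last by rewrite ltnSn andbT.
  rewrite addrC; congr (_ + _); apply: eq_bigl => j.
  by rewrite -andbA -val_eqE/= ltnS [in RHS]ltn_neqAle [in RHS](andbC (_ != _)).
transitivity (\int[P]_w ((f w * (expR (- (\sum_(l < N | (k <= l < L)%N) c l * Z l (h * a%:R) w)))%:E)
   * (expR (- (c l * Z l (h * a%:R) w)))%:E))%E.
  by apply: eq_integral => w _; rewrite split_l opprD expRD EFinM muleA.
have mF : measurable_fun setT ((fun w => f w *
    (expR (- (\sum_(l < N | (k <= l < L)%N) c l * Z l (h * a%:R) w)))%:E)%E : jointType L -> \bar R).
  apply: emeasurable_funM; first exact: measurable_joint_le mf.
  apply: measurable_EFin_expR; apply: measurableT_comp; first exact: oppr_measurable.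
  apply: measurable_sum_cond => j /andP[_ jL]; apply: measurable_funM; first exact: measurable_cst.
  exact: measurable_joint_coord.
have mg : measurable_fun setT (fun x : R => (expR (- (c l * x)))%:E).
  by apply: measurable_EFin_expR; apply: measurableT_comp => //; exact: measurable_funM.
have F0 w : (0 <= f w * (expR (- (\sum_(l < N | (k <= l < L)%N) c l * Z l (h * a%:R) w)))%:E)%E.
  by rewrite mule_ge0// lee_fin expR_ge0.
have g0 x : (0 <= (expR (- (c l * x)))%:E)%E by rewrite lee_fin expR_ge0.
have kLN : (k <= L <= N)%N by rewrite kL ltnW.
rewrite (@joint_indep l _ _ _ ha mF mg F0 g0) (IH kLN) (subordinator_laplace _ _ (sub l kL) (c0 l)).
rewrite -ge0_integralZr.
- by apply: eq_integral => w _; rewrite split_l opprD expRD EFinM muleA.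
- exact: measurableT.
- apply: emeasurable_funM; first exact: (measurable_joint mf).
  exact: measurable_cst.
- by move=> w _; rewrite mule_ge0// lee_fin expR_ge0.
- by rewrite lee_fin expR_ge0.
Qed.

End independent_subordinators.

(** * Suprema of cadlag paths *)

Section cadlag_sup.
Context {R : realType}.

(** Compactness of [0, T] for an ideal [B] of sets. It serves twice: for the sets on which a path is
    bounded above, and for those on which it stays a fixed distance below its supremum. *)
Lemma locally_ideal_itv (B : set R -> Prop) (T : R) :
  (forall A C, B A -> B C -> B (A `|` C)) -> (forall A C, A `<=` C -> B C -> B A) ->
  0 <= T -> B [set s | s < 0] ->
  (forall t, 0 <= t -> t <= T -> exists2 e, 0 < e & B [set s | t - e < s < t + e]) ->
  B [set s | s <= T].
Proof.
move=> BU BS T0 B0 Bloc.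
pose S := [set t | 0 <= t <= T /\ B [set s | s <= t]].
have S0 : S 0.
  split; first by rewrite lexx.
  have [e e0 Be] := Bloc 0 (lexx _) T0.
  apply: BS (BU _ _ B0 Be) => s /= s0.
  have [|s0'] := ltP s 0; [by left|right].
  by rewrite sub0r add0r (lt_le_trans _ s0') ?oppr_lt0// (le_lt_trans s0).
have Sub : has_ubound S by exists T => t [/andP[]].
have SS : has_sup S by split => //; exists 0.
pose x := sup S.
have x0 : 0 <= x by exact: ub_le_sup.
have xT : x <= T by apply: ge_sup; [exists 0|move=> t [/andP[]]].
have [e e0 Be] := Bloc x x0 xT.
have [t [tT Bt] tx] := sup_adherent e0 SS.
(* The supremum [x] can be passed by [e / 2] unless [T] is reached first. *)
have Bmax : B [set s | s <= Num.min T (x + e / 2)].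
  apply: BS (BU _ _ Bt Be) => s /=; rewrite le_min => /andP[_ sx].
  have [|ts] := leP s t; [by left|right].
  by rewrite (lt_trans tx ts) (le_lt_trans sx)// ltrD2l ltr_pdivrMr// ltr_pMr// ltr1n.
have : S (Num.min T (x + e / 2)).
  split => //; rewrite ge_min lexx le_min T0 andbT/=.
  by rewrite addr_ge0// divr_ge0// ltW.
move=> /(ub_le_sup Sub); rewrite -/x ge_min => /orP[Tx|]; last first.
  by rewrite gerDl leNgt divr_gt0.
by move: Bmax; rewrite min_l// (le_trans Tx)// lerDl divr_ge0// ltW.
Qed.

Context {n : nat}.
Implicit Types (w : cadlag_path R n) (k : 'I_n).

Lemma path_right_cvg w k (t e : R) : 0 <= t -> 0 < e ->
  exists2 r, 0 < r & forall s, t <= s < t + r -> `|w k t - w k s| < e.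
Proof.
move=> t0 e0; have /(_ _ t0)/cvgrPdist_lt/(_ _ e0) := (path_cadlag w k).1.
move=> [r /= r0 H]; exists r => // s /andP[]; rewrite le_eqVlt => /predU1P[->|ts] st.
  by rewrite subrr normr0.
by apply: H => //=; rewrite distrC gtr0_norm ?subr_gt0// ltrBlDl.
Qed.

Lemma cvg_left_le0 w k (t : R) : t <= 0 -> w k s @[s --> t^'-] --> (0 : R).
Proof.
move=> t0; apply/cvgrPdist_lt => e e0; exists 1 => [|s _ st]; first exact: ltr01.
by rewrite path_neg ?subrr ?normr0// (lt_le_trans st).
Qed.

Lemma left_limit_le0 w k (t : R) : t <= 0 -> left_limit (w k) t = 0.
Proof. by move=> /(cvg_left_le0 w k) H; apply: cvg_lim. Qed.

Lemma left_limit_cvg w k (t : R) : w k s @[s --> t^'-] --> left_limit (w k) t.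
Proof.
have [t0|t0] := ltP 0 t; first exact: (path_cadlag w k).2.
by rewrite left_limit_le0//; exact: cvg_left_le0.
Qed.

Lemma path_left_cvg w k (t e : R) : 0 < e ->
  exists2 r, 0 < r & forall s, t - r < s < t -> `|left_limit (w k) t - w k s| < e.
Proof.
move=> e0; have /cvgrPdist_lt/(_ _ e0) := @left_limit_cvg w k t.
move=> [r /= r0 H]; exists r => // s /andP[st ts].
by apply: H => //=; rewrite gtr0_norm ?subr_gt0// ltrBlDl -ltrBlDr.
Qed.

Definition path_bounded w k := exists c, forall t, w k t <= c.

Lemma path_bounded_left w k (T : R) : exists c, forall s, s <= T -> w k s <= c.
Proof.
have [T0|T0] := leP 0 T; last by exists 0 => s sT; rewrite path_neg// (le_lt_trans sT).
apply: (@locally_ideal_itv (fun A => exists c, forall s, A s -> w k s <= c)) => //.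
- move=> A C [a Aa] [c Cc]; exists (Num.max a c) => s [/Aa|/Cc] wsc; rewrite le_max wsc ?orbT//.
- by move=> A C AC [c Cc]; exists c => s /AC/Cc.
- by exists 0 => s /= s0; rewrite path_neg.
- move=> t t0 _.
  have [r r0 Hr] := @path_right_cvg w k t 1 t0 ltr01.
  have [l l0 Hl] := @path_left_cvg w k t 1 ltr01.
  exists (Num.min r l); first by rewrite lt_min r0.
  exists (Num.max (w k t + 1) (left_limit (w k) t + 1)) => s /= /andP[ts st].
  have [sts|tss] := ltP s t.
    have : `|left_limit (w k) t - w k s| < 1.
      by apply: Hl; rewrite sts andbT (le_lt_trans _ ts)// lerD2l lerN2 ge_min lexx orbT.
    by rewrite ltr_distlC => /andP[_ /ltW h]; rewrite le_max h orbT.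
  have : `|w k t - w k s| < 1.
    by apply: Hr; rewrite tss/= (lt_le_trans st)// lerD2l ge_min lexx.
  by rewrite ltr_distlC => /andP[_ /ltW h]; rewrite le_max h.
Qed.

Lemma Xbar_has_sup w k : path_bounded w k ->
  has_sup ([set 0] `|` [set w k t | t in [set t | 0 <= t]]).
Proof.
move=> [c wc]; split; first by exists 0; left.
exists c => _ [->|[t _ <-]]//; first by rewrite -(@path_neg _ _ w k (-1)) ?ltrN10.
Qed.

Lemma le_Xbar w k t : path_bounded w k -> w k t <= Xbar k w.
Proof.
move=> /Xbar_has_sup[_ ub]; apply: ub_le_sup => //.
by have [t0|t0] := ltP t 0; [left; rewrite path_neg|right; exists t].
Qed.

Lemma Xbar_adherent w k (e : R) : path_bounded w k -> 0 < e ->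
  exists s, Xbar k w - e < w k s.
Proof.
move=> /Xbar_has_sup wb e0; have [_ [->|[t _ <-]] h] := sup_adherent e0 wb.
  (* The extra element 0 in the definition of [Xbar] is the value of the path at any negative time,
     here -1. *)
  by exists (-1); rewrite path_neg ?ltrN10.
by exists t.
Qed.

Lemma Xbar_ge0 w k : 0 <= Xbar k w.
Proof.
rewrite /Xbar; set S := (X in sup X).
have [hs|/sup_out->//] := pselect (has_sup S).
by apply: ub_le_sup; [exact: hs.2|left].
Qed.

Lemma Xbar_unique w k (M : R) : (forall t, w k t <= M) ->
  (forall e, 0 < e -> exists s, M - e < w k s) -> Xbar k w = M.
Proof.
move=> wM Mw; have wb : path_bounded w k by exists M.
apply/eqP; rewrite eq_le; apply/andP; split; rewrite leNgt; apply/negP => h.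
  have [s] := Xbar_adherent wb (etrans (subr_gt0 _ _) h).
  by rewrite opprB addrC subrK ltNge wM.
have [s] := Mw _ (etrans (subr_gt0 _ _) h).
by rewrite opprB addrC subrK ltNge le_Xbar.
Qed.

(* The first epoch at which [w k] attains its supremum, for paths extended by 0
   to negative times, so that no special role is played by time 0. *)
Definition is_first_max_time w k (g : R) :=
  [/\ 0 <= g,
      forall r, 0 < r -> r <= g -> exists2 e, 0 < e &
        forall s, s <= g - r -> w k s <= Xbar k w - e &
      forall r e, 0 < r -> 0 < e -> exists2 s, s < g + r & Xbar k w - e < w k s].

Lemma is_first_max_time_uniq w k g g' :
  is_first_max_time w k g -> is_first_max_time w k g' -> g = g'.
Proof.
wlog gg' : g g' / g < g'.
  move=> H h h'; have [/H/(_ h h')//|/H/(_ h' h)//|//] := ltgtP g g'.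
move=> [g0 _ h] [g'0 h' _]; exfalso.
(* Up to the midpoint of [g] and [g'] the path is bounded away from its supremum by the property of
   [g'], yet comes arbitrarily close to it by that of [g]. *)
have r0 : 0 < (g' - g) / 2 by rewrite divr_gt0// subr_gt0.
have rg : (g' - g) / 2 <= g'.
  rewrite ler_pdivrMr// mulr_natr mulr2n.
  by rewrite lerBlDr -addrA lerDl addr_ge0.
have [e e0 he] := h' _ r0 rg.
have [s sg] := h _ _ r0 e0.
rewrite ltNge he//; apply: (le_trans (ltW sg)).
by rewrite lerBrDr -addrA -splitr addrC subrK.
Qed.

Definition argmax_times w k : set R :=
  [set t | 0 <= t /\ (w k t = Xbar k w \/ left_limit (w k) t = Xbar k w)].

Lemma left_limit_le w k t c : (forall s, s < t -> w k s <= c) -> left_limit (w k) t <= c.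
Proof.
move=> wc; rewrite leNgt; apply/negP => cl.
have [r r0 /(_ (t - r / 2))] := @path_left_cvg w k t _ (etrans (subr_gt0 _ _) cl).
have r2 : r / 2 < r by rewrite ltr_pdivrMr// ltr_pMr// ltr1n.
have r20 : 0 < r / 2 by rewrite divr_gt0.
rewrite ltrD2l ltrN2 r2 gtrDl oppr_lt0 r20 => /(_ erefl).
rewrite ltr_distlC => /andP[+ _]; rewrite opprB addrC subrK ltNge wc//.
by rewrite gtrDl oppr_lt0.
Qed.

Lemma argmax_times_adherent w k t (r e : R) : argmax_times w k t -> 0 < r -> 0 < e ->
  exists2 s, t - r < s <= t & Xbar k w - e < w k s.
Proof.
move=> [t0 [wt|lt]] r0 e0.
  by exists t; rewrite ?wt ?lexx ?andbT ?gtrDl ?oppr_lt0.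
have [r' r'0 Hr] := @path_left_cvg w k t _ e0.
pose q := Num.min r r' / 2.
have m0 : 0 < Num.min r r' by rewrite lt_min r0.
have q0 : 0 < q by rewrite divr_gt0.
have qm : q < Num.min r r' by rewrite ltr_pdivrMr// ltr_pMr// ltr1n.
exists (t - q).
  by rewrite ltrD2l ltrN2 (lt_le_trans qm) ?ge_min ?lexx//= gerDl oppr_le0 ltW.
have := Hr (t - q); rewrite ltrD2l ltrN2 (lt_le_trans qm) ?ge_min ?lexx ?orbT//.
rewrite gtrDl oppr_lt0 q0 => /(_ erefl).
by rewrite lt ltr_distlC => /andP[].
Qed.

Let B w k (A : set R) := exists2 e, 0 < e & forall s, A s -> w k s <= Xbar k w - e.

Let BU w k A C : B w k A -> B w k C -> B w k (A `|` C).
Proof.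
move=> [e e0 Ae] [f f0 Cf]; exists (Num.min e f); first by rewrite lt_min e0.
by move=> s [/Ae|/Cf] h; rewrite (le_trans h)// lerD2l lerN2 ge_min lexx ?orbT.
Qed.

Let BS w k A C : A `<=` C -> B w k C -> B w k A.
Proof. by move=> AC [e e0 Ce]; exists e => // s /AC/Ce. Qed.

(** At such an epoch the value and the left limit are both strictly below the supremum; half of each
    gap survives on a one-sided neighbourhood. *)
Let Bloc w k t : path_bounded w k -> 0 <= t -> ~ argmax_times w k t ->
  exists2 e, 0 < e & B w k [set s | t - e < s < t + e].
Proof.
move=> wb t0 nat_.
have wt : w k t < Xbar k w.
  by rewrite lt_neqAle le_Xbar// andbT; apply/eqP => wt; apply: nat_; split => //; left.
have lt : left_limit (w k) t < Xbar k w.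
  rewrite lt_neqAle left_limit_le ?andbT; last by move=> s _; exact: le_Xbar.
  by apply/eqP => lt; apply: nat_; split => //; right.
have h1 : 0 < (Xbar k w - w k t) / 2 by rewrite divr_gt0// subr_gt0.
have h2 : 0 < (Xbar k w - left_limit (w k) t) / 2 by rewrite divr_gt0// subr_gt0.
have [r r0 Hr] := @path_right_cvg w k t _ t0 h1.
have [l l0 Hl] := @path_left_cvg w k t _ h2.
exists (Num.min r l); first by rewrite lt_min r0.
apply: (@BS _ _ _ ([set s | t - l < s < t] `|` [set s | t <= s < t + r])).
  move=> s /= /andP[ts st]; have [sts|tss] := ltP s t; [left|right].
    by rewrite (le_lt_trans _ ts)// lerD2l lerN2 ge_min lexx orbT.
  by rewrite (lt_le_trans st)// lerD2l ge_min lexx.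
have split2 (a b c : R) : `|a - b| < (c - a) / 2 -> b <= c - (c - a) / 2.
  rewrite ltr_distlC => /andP[_ /ltW h]; apply: (le_trans h).
  by rewrite -lerBrDr -addrA -opprD -splitr opprB addrC subrK.
apply: BU.
- by exists ((Xbar k w - left_limit (w k) t) / 2) => // s /= /Hl/split2.
- by exists ((Xbar k w - w k t) / 2) => // s /= /Hr/split2.
Qed.

Lemma G_le w k t : argmax_times w k t -> G k w <= t.
Proof. by move=> At; apply: ge_inf => //; exists 0 => s []. Qed.

Lemma argmax_times0 w k : Xbar k w = 0 -> argmax_times w k 0.
Proof. by move=> X0; split => //; right; rewrite left_limit_le0. Qed.

(** By compactness, an interval without argmax times keeps the path away from its supremum. Applied
    up to [T], this shows that argmax times exist; applied before [G k w], it gives the separation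
    required of a first maximum. *)
Lemma G_first_max_time w k : path_bounded w k ->
  (exists T, forall e, 0 < e -> exists2 s, s <= T & Xbar k w - e < w k s) ->
  is_first_max_time w k (G k w) /\ argmax_times w k (G k w).
Proof.
move=> wb [T attT].
have lbA : has_lbound (argmax_times w k) by exists 0 => s [].
have Bitv T' : 0 <= T' -> (forall t, 0 <= t -> t <= T' -> ~ argmax_times w k t) ->
    B w k [set s | s <= T'].
  move=> T'0 nA; apply: (locally_ideal_itv (@BU w k) (@BS w k)) => //.
    have X0 : 0 < Xbar k w.
      rewrite lt_neqAle Xbar_ge0 andbT; apply/eqP => X0.
      exact: (nA 0 (lexx _) T'0 (argmax_times0 (esym X0))).
    by exists (Xbar k w) => // s /= s0; rewrite path_neg// subrr.
  by move=> t t0 tT; apply: Bloc => //; exact: nA.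
have A0 : argmax_times w k !=set0.
  apply: contrapT => /set0P/negP/negPn/eqP A0.
  have [||e e0 He] := Bitv (Num.max T 0); first by rewrite le_max lexx orbT.
    by move=> t _ _; rewrite A0.
  have [s sT] := attT e e0.
  by rewrite ltNge He//= le_max sT.
have hi : has_inf (argmax_times w k) by split.
have [fm1 fm2] : (forall r, 0 < r -> r <= G k w -> exists2 e, 0 < e &
        forall s, s <= G k w - r -> w k s <= Xbar k w - e) /\
      forall r e, 0 < r -> 0 < e -> exists2 s, s < G k w + r & Xbar k w - e < w k s.
  split=> r.
    move=> r0 rG; apply: Bitv; first by rewrite subr_ge0.
    move=> t t0 tG At; have := G_le At; rewrite leNgt (le_lt_trans tG)//.
    by rewrite gtrDl oppr_lt0.
  move=> e r0 e0; have [t At tG] := inf_adherent r0 hi.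
  have [s /andP[_ st] ws] := argmax_times_adherent At ltr01 e0.
  by exists s => //; exact: le_lt_trans tG.
split; first by split => //; exact: G_ge0.
(* Otherwise the path would stay away from its supremum around [G k w], although argmax times
   accumulate there from the right. *)
apply: contrapT => nAG.
have [e e0 [f f0 Hf]] := Bloc wb (@G_ge0 _ _ k w) nAG.
have [t At tG] := inf_adherent e0 hi.
have Gt : G k w < t.
  by rewrite lt_neqAle G_le// andbT; apply/eqP => Gt; apply: nAG; rewrite Gt.
have [s /andP[ts st] ws] := argmax_times_adherent At (etrans (subr_gt0 _ _) Gt) f0.
move: ws; rewrite ltNge Hf//=; rewrite (le_lt_trans st tG) andbT.
rewrite opprB addrC subrK in ts.
by rewrite (lt_trans _ ts)// gtrDl oppr_lt0.
Qed.

Lemma drift_bounded w k : w k t @[t --> +oo] --> -oo -> path_bounded w k /\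
  exists T, forall e, 0 < e -> exists2 s, s <= T & Xbar k w - e < w k s.
Proof.
move=> /cvgrNy_le/(_ (-1)) [T [_ HT]].
have [c Hc] := path_bounded_left w k T.
have wb : path_bounded w k.
  exists (Num.max c 0) => t; have [tT|Tt] := leP t T; first by rewrite le_max Hc.
  by rewrite le_max orbC (le_trans (HT _ Tt)).
(* After [T] the path is at most -1, hence below its value 0 at time -1, which can then serve as the
   witness. *)
split => //; exists (Num.max T (-1)) => e e0.
have [s ws] := Xbar_adherent wb e0.
have [sT|Ts] := leP s T; first by exists s; rewrite // le_max sT.
exists (-1); first by rewrite le_max lexx orbT.
rewrite path_neg ?ltrN10// (lt_le_trans ws)// (le_trans (HT _ Ts))//.
Qed.

End cadlag_sup.

(** * Maxima of the path after G_k *)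

Section post_max_path.
Context {R : realType} {n : nat}.
Implicit Types (w : cadlag_path R n) (i j k : 'I_n).

Definition attains_sup w k := path_bounded w k /\
  exists T, forall e, 0 < e -> exists2 s, s <= T & Xbar k w - e < w k s.

Lemma first_max_timeG w k g : path_bounded w k -> is_first_max_time w k g -> G k w = g.
Proof.
move=> wb gw; have [g0 _ h] := gw.
have [|G1 _] := @G_first_max_time _ _ w k wb; last exact: is_first_max_time_uniq G1 gw.
by exists (g + 1) => e e0; have [s sg ws] := h 1 e ltr01 e0; exists s => //; exact: ltW.
Qed.

Lemma X_at_max_self w k : attains_sup w k -> X_at_max k w k = Xbar k w.
Proof.
move=> [wb att]; have [_ [_]] := G_first_max_time wb att.
by rewrite /X_at_max; case: eqP => [->|nw []].
Qed.

Lemma X_at_max_le w k j c : (forall s, s <= G k w -> w j s <= c) -> X_at_max k w j <= c.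
Proof.
move=> wc; rewrite /X_at_max; case: ifP => _; first exact: wc.
by apply: left_limit_le => s /ltW; exact: wc.
Qed.

Section pair.
Variables (w : cadlag_path R n) (k i j : 'I_n) (c : R).
Hypothesis mono : {homo (fun t => w j t - c * w i t) : s t / s <= t}.

Let cvgv t : w j s - c * w i s @[s --> t^'-] -->
  left_limit (w j) t - c * left_limit (w i) t.
Proof.
apply: cvgB; first exact: left_limit_cvg.
by apply: cvgM; [exact: cvg_cst|exact: left_limit_cvg].
Qed.

(** [X_at_max] takes the same side of G_k in all coordinates, so the right-hand side is the value or
    the left limit of a single nondecreasing function. *)
Lemma le_X_at_maxB s : s < G k w ->
  w j s - c * w i s <= X_at_max k w j - c * X_at_max k w i.
Proof.
move=> sG; rewrite /X_at_max; case: ifP => _; first exact/mono/ltW.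
apply: cvgr_to_ge (@cvgv (G k w)) _; near=> t; apply: mono.
by near: t; exact: nbhs_left_ge.
Unshelve. all: by end_near. Qed.

Lemma X_at_maxB_le s : G k w <= s ->
  X_at_max k w j - c * X_at_max k w i <= w j s - c * w i s.
Proof.
move=> sG; rewrite /X_at_max; case: ifP => _; first exact/mono.
apply: cvgr_to_le (@cvgv (G k w)) _; near=> t; apply: mono.
by apply: le_trans sG; near: t; exact: nbhs_left_le.
Unshelve. all: by end_near. Qed.

Lemma X_at_max_nojump :
  left_limit (w j) (G k w) - c * left_limit (w i) (G k w) =
  w j (G k w) - c * w i (G k w) ->
  X_at_max k w j = c * X_at_max k w i + (w j (G k w) - c * w i (G k w)).
Proof.
by rewrite /X_at_max; case: ifP => _ => [_|<-]; rewrite addrC subrK.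
Qed.

End pair.

Lemma post_maxE w k j t : 0 <= t -> post_max k w j t = w j (G k w + t) - X_at_max k w j.
Proof. by move=> t0; rewrite /= /post_max_fun ltNge t0. Qed.

Lemma post_max_subE w k j s : G k w <= s ->
  post_max k w j (s - G k w) = w j s - X_at_max k w j.
Proof. by move=> Gs; rewrite post_maxE ?subr_ge0// [G k w + _]addrC subrK. Qed.

Section after.
Variables (w : cadlag_path R n) (k j : 'I_n) (c : R).
Hypotheses (c0 : 0 < c) (wk : attains_sup w k) (wj : attains_sup w j).
Hypothesis mono : {homo (fun t => w j t - c * w k t) : s t / s <= t}.

Let X_le : X_at_max k w j <= Xbar j w.
Proof. by apply: X_at_max_le => s _; apply: le_Xbar; case: wj. Qed.

(** Before G_k, X_j lies below its level at G_k by at least [c] times the distance of X_k from its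
    maximum, so the past does not compete for the maximum of X_j. *)
Let before s : s < G k w -> w j s <= X_at_max k w j + c * (w k s - Xbar k w).
Proof.
move=> sG; have := le_X_at_maxB mono sG; rewrite X_at_max_self// mulrBr.
by rewrite lerBlDr -addrA [- _ + _]addrC.
Qed.

Let before_le s : s < G k w -> w j s <= X_at_max k w j.
Proof.
move=> sG; rewrite (le_trans (before sG))// gerDl pmulr_rle0// subr_le0.
by apply: le_Xbar; case: wk.
Qed.

Lemma post_max_Xbar : Xbar j (post_max k w) = Xbar j w - X_at_max k w j.
Proof.
apply: Xbar_unique => [t|e e0].
  have [t0|t0] := ltP t 0; first by rewrite path_neg// subr_ge0.
  by rewrite post_maxE// lerB// le_Xbar//; case: wj.
have [s ws] := Xbar_adherent wj.1 e0.
have [sG|Gs] := ltP s (G k w).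
  (* A near-maximiser before [G k w] is replaced by a negative time, at which the post-maximum path
     is 0, that is, at the level [X_at_max]. *)
  by exists (-1); rewrite path_neg ?ltrN10//; have := before_le sG; lra.
by exists (s - G k w); rewrite post_max_subE//; lra.
Qed.

(** If G_j came first, X_j would approach its supremum before the midpoint of G_j and G_k. There X_k
    is still bounded away from its maximum, and [before] transfers this gap, multiplied by [c], to
    X_j. *)
Lemma G_le_G : G k w <= G j w.
Proof.
have [[_ hk _] _] := G_first_max_time wk.1 wk.2.
have [[j0 _ hj] _] := G_first_max_time wj.1 wj.2.
rewrite leNgt; apply/negP => jk.
pose r := (G k w - G j w) / 2.
have r0 : 0 < r by rewrite divr_gt0// subr_gt0.
have rGj : G j w + r = G k w - r.
  by apply/eqP; rewrite -subr_eq opprK -addrA -splitr addrC subrK.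
have rk : r <= G k w.
  by rewrite -subr_ge0 -rGj addr_ge0// ltW.
have [e e0 he] := hk _ r0 rk.
have [s] := hj r (c * e) r0 (mulr_gt0 c0 e0).
rewrite rGj => sr; have sG : s < G k w by rewrite (lt_trans sr)// gtrDl oppr_lt0.
rewrite ltNge (le_trans (before sG))// lerD// -mulrN ler_pM2l//.
by rewrite lerBlDr addrC he// ltW.
Qed.

Lemma post_max_G : G j (post_max k w) = G j w - G k w.
Proof.
apply: first_max_timeG.
  exists (Xbar j (post_max k w)) => t; apply: le_Xbar.
  exists (Xbar j w - X_at_max k w j) => {}t.
  have [t0|t0] := ltP t 0; first by rewrite path_neg// subr_ge0.
  by rewrite post_maxE// lerB// le_Xbar//; case: wj.
have [[j0 h1 h2] _] := G_first_max_time wj.1 wj.2.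
split; first by rewrite subr_ge0 G_le_G.
- move=> r r0 rG; rewrite post_max_Xbar.
  have rGj : r <= G j w by rewrite (le_trans rG)// gerBl G_ge0.
  have GkGj : G k w <= G j w - r by rewrite lerBrDr addrC -lerBrDr.
  have [e e0 he] := h1 _ r0 rGj.
  exists e => // s sG; have [s0|s0] := ltP s 0.
    rewrite path_neg// addrAC subr_ge0; apply: X_at_max_le => t tG.
    by apply: he; rewrite (le_trans tG).
  rewrite post_maxE// addrAC lerB// he//.
  by rewrite addrC -lerBrDr addrAC.
- move=> r e r0 e0; have [s sG ws] := h2 r e r0 e0; rewrite post_max_Xbar.
  have [sk|ks] := ltP s (G k w).
    exists (-1); first by rewrite (lt_trans (ltrN10 _))// ltr_wpDl// subr_ge0 G_le_G.
    by rewrite path_neg ?ltrN10//; have := before_le sk; lra.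
  exists (s - G k w); first by rewrite addrAC ltrD2r.
  by rewrite post_max_subE//; lra.
Qed.

End after.

Section before.
Variables (w : cadlag_path R n) (k i : 'I_n) (c : R).
Hypotheses (c0 : 0 < c) (wk : attains_sup w k).
Hypothesis mono : {homo (fun t => w k t - c * w i t) : s t / s <= t}.

(** Whenever X_i rises above its level at G_k, so does X_k, by monotonicity of the difference; but
    X_k is then at its maximum. *)
Lemma post_max_Xbar0 : Xbar i (post_max k w) = 0.
Proof.
apply: Xbar_unique => [t|e e0]; last first.
  by exists (-1); rewrite path_neg ?ltrN10// sub0r oppr_lt0.
have [t0|t0] := ltP t 0; first by rewrite path_neg.
rewrite post_maxE//.
have Gt : G k w <= G k w + t by rewrite lerDl.
have := X_at_maxB_le mono Gt.
rewrite X_at_max_self// => H.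
have : c * (w i (G k w + t) - X_at_max k w i) <= w k (G k w + t) - Xbar k w.
  by rewrite mulrBr; lra.
move=> /le_trans; rewrite -(pmulr_rle0 _ c0); apply.
by rewrite subr_le0 le_Xbar//; case: wk.
Qed.

Lemma post_max_G0 : G i (post_max k w) = 0.
Proof.
apply/eqP; rewrite eq_le G_ge0 andbT; apply: G_le.
exact: argmax_times0 post_max_Xbar0.
Qed.


End before.

End post_max_path.

(** * Measurability on path space *)

Section path_measurability.
Context {R : realType} {n : nat}.
Local Notation path := (cadlag_path R n).
Implicit Types (w : path) (i j k : 'I_n).

Lemma measurable_coord i t : measurable_fun setT (fun w => w i t).
Proof.
have [t0|t0] := ltP t 0.
  by rewrite (_ : (fun w => w i t) = cst 0)//; apply/funext => w; rewrite path_neg.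
move=> _ B mB; rewrite setTI; apply: sub_sigma_algebra.
by exists (i, t) => //; exists B => //; rewrite setTI.
Qed.

Lemma measurable_fun_path d (T : measurableType d) (f : T -> path) :
  (forall i t, 0 <= t -> measurable_fun setT (fun x => f x i t)) -> measurable_fun setT f.
Proof.
move=> mf.
pose gens := \bigcup_(it in [set it : 'I_n * R | 0 <= it.2])
  preimage_set_system setT (fun w : path => coord_process it.1 it.2 w) measurable.
apply: (@measurability _ _ T path setT f gens erefl).
move=> _ [_ [[i t] /= t0 [B mB <-]] <-].
rewrite setTI /coord_process -[X in measurable X](_ : setT `&` ((fun x => f x i t) @^-1` B) = _).
  exact: mf.
by rewrite !setTI.
Qed.

(** By right-continuity a strict lower bound at [s] persists just after [s], so suprema and hitting
    conditions may be tested at rational times. *)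
Lemma path_gt_rat w k s r (c : R) : c < w k s -> s < r ->
  exists2 q : rat, s < ratr q < r & c < w k (ratr q).
Proof.
move=> cw sr; have [s0|s0] := ltP s 0.
  have [|q] := @rat_in_itvoo _ s (Num.min r 0).
    by rewrite lt_min sr.
  rewrite in_itv/= lt_min => /andP[sq /andP[qr q0]]; exists q; first by rewrite sq.
  by rewrite path_neg// in cw; rewrite path_neg.
have [e e0 He] := path_right_cvg w k s0 (etrans (subr_gt0 _ _) cw).
have [|q] := @rat_in_itvoo _ s (Num.min r (s + e)).
  by rewrite lt_min sr ltrDl.
rewrite in_itv/= lt_min => /andP[sq /andP[qr qe]]; exists q; first by rewrite sq.
have := He (ratr q); rewrite (ltW sq) qe => /(_ erefl).
by rewrite ltr_distlC => /andP[+ _]; rewrite opprB addrC subrK.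
Qed.

Lemma measurable_set_coord_gt k (t c : R) : measurable [set w : path | c < w k t].
Proof. by apply: measurable_set_lt => //; exact: measurable_coord. Qed.

Lemma measurable_set_coord_le k (t c : R) : measurable [set w : path | w k t <= c].
Proof. by apply: measurable_set_le => //; exact: measurable_coord. Qed.

Lemma measurable_path_bounded k : measurable [set w : path | path_bounded w k].
Proof.
rewrite [X in measurable X](_ : _ =
    [set w : path | exists N : nat, forall q : rat, w k (ratr q) <= N%:R]).
  apply: measurable_set_exists => N; apply: measurable_set_forall => q.
  exact: measurable_set_coord_le.
apply/seteqP; split => w /= [].
  move=> c wc; exists (Num.truncn `|c|).+1 => q.
  rewrite (le_trans (wc _))// (le_trans (ler_norm _))// ltW//.
  by have /andP[] := truncn_itv (normr_ge0 c).
move=> N wN; exists N%:R => t; rewrite leNgt; apply/negP => wt.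
have [q _] := path_gt_rat wt (ltr_pwDr (@ltr01 R) (lexx t)).
by rewrite ltNge wN.
Qed.

Lemma Xbar_unbounded w k : ~ path_bounded w k -> Xbar k w = 0.
Proof.
move=> wb; apply: sup_out => -[_ [c Hc]]; apply: wb; exists (Num.max c 0) => t.
have [t0|t0] := ltP t 0; first by rewrite path_neg// le_max lexx orbT.
by rewrite le_max Hc//; right; exists t.
Qed.

(** [Xbar] and [G] are nonnegative with default value 0, so restricting to levels [c >= 0] discards
    the exceptional paths. *)
Lemma measurable_fun_gt d (T : measurableType d) (f : T -> R) :
  (forall c, 0 <= c -> measurable [set x | c < f x]) -> (forall x, 0 <= f x) ->
  measurable_fun setT f.
Proof.
move=> mf f0.
apply: (@measurability _ _ T _ setT f (@RGenOInfty.G R) (RGenOInfty.measurableE R)).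
move=> _ [_ [c ->] <-]; rewrite setTI.
rewrite [X in measurable X](_ : _ = [set x | c < f x]); last first.
  by apply/seteqP; split => x /=; rewrite in_itv/= andbT.
have [c0|c0] := ltP c 0; last exact: mf.
rewrite (_ : mkset _ = setT)//; apply/seteqP; split => // x _ /=.
exact: lt_le_trans (f0 x).
Qed.

Lemma measurable_Xbar k : measurable_fun setT (fun w => Xbar k w).
Proof.
apply: measurable_fun_gt => [c c0|w]; last exact: Xbar_ge0.
rewrite [X in measurable X](_ : _ =
    [set w : path | path_bounded w k /\ exists q : rat, c < w k (ratr q)]).
  apply: measurable_set_and; first exact: measurable_path_bounded.
  by apply: measurable_set_exists => q; exact: measurable_set_coord_gt.
apply/seteqP; split => w /=.
  move=> cX; have [wb|/Xbar_unbounded X0] := pselect (path_bounded w k); last first.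
    by move: cX; rewrite X0 ltNge c0.
  split => //; have [s] := Xbar_adherent wb (etrans (subr_gt0 _ _) cX).
  rewrite opprB addrC subrK => ws.
  have [q _] := path_gt_rat ws (ltr_pwDr (@ltr01 R) (lexx s)).
  by exists q.
by move=> [wb [q cq]]; rewrite (lt_le_trans cq)// le_Xbar.
Qed.

(** A countable form: for some [N], every rational level that is exceeded at all is exceeded at a
    rational time before [N]. *)
Lemma measurable_attains_sup k : measurable [set w : path | attains_sup w k].
Proof.
rewrite [X in measurable X](_ : _ =
    [set w : path | path_bounded w k /\ exists N : nat, forall b : rat,
      (exists q : rat, ratr b < w k (ratr q)) ->
      exists q : rat, ratr q <= (N%:R : R) /\ ratr b < w k (ratr q)]).
  apply: measurable_set_and; first exact: measurable_path_bounded.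
  apply: measurable_set_exists => N; apply: measurable_set_forall => b.
  rewrite [X in measurable X](_ : _ = ~` [set w : path | exists q : rat, ratr b < w k (ratr q)] `|`
    [set w : path | exists q : rat, ratr q <= (N%:R : R) /\ ratr b < w k (ratr q)]); last first.
    apply/seteqP; split => w /=; last by move=> [nA /nA//|].
    move=> H; have [/H|] := pselect (exists q : rat, ratr b < w k (ratr q)); [by right|by left].
  apply: measurableU; [apply: measurableC|]; apply: measurable_set_exists => q.
    exact: measurable_set_coord_gt.
  have [qN|qN] := boolP (ratr q <= (N%:R : R)).
    rewrite (_ : mkset _ = [set w : path | ratr b < w k (ratr q)]).
      exact: measurable_set_coord_gt.
    by apply/seteqP; split => w /= => [[]|].
  by rewrite (_ : mkset _ = set0)//; apply/seteqP; split => w //= [].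
apply/seteqP; split => w /= [wb].
  (* One unit makes up for truncation, the other for the rational time, which may lie up to 1 to the
     right of [s]. *)
  move=> [T HT]; split => //; exists (Num.truncn `|T|).+2 => b [q bq].
  have e0 : 0 < Xbar k w - ratr b by rewrite subr_gt0 (lt_le_trans bq)// le_Xbar.
  have [s sT] := HT _ e0; rewrite opprB addrC subrK => ws.
  have [q' /andP[sq' q's] bq'] := path_gt_rat ws (ltr_pwDr (@ltr01 R) (lexx s)).
  exists q'; split => //; rewrite (le_trans (ltW q's))// -natr1 lerD2r.
  rewrite (le_trans sT)// (le_trans (ler_norm _))// ltW//.
  by have /andP[] := truncn_itv (normr_ge0 T).
move=> [N HN]; split => //; exists N%:R => e e0.
have [b] := @rat_in_itvoo _ (Xbar k w - e) (Xbar k w) (ltac:(by rewrite gtrDl oppr_lt0)).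
rewrite in_itv/= => /andP[eb bX].
have [|q [qN bq]] := HN b; last by exists (ratr q) => //; exact: lt_trans bq.
have [s] := Xbar_adherent wb (etrans (subr_gt0 _ _) bX).
rewrite opprB addrC subrK => ws.
have [q _] := path_gt_rat ws (ltr_pwDr (@ltr01 R) (lexx s)).
by exists q.
Qed.

(** An unbounded path has [Xbar] equal to 0 by default, so time 0 counts as an argmax time through
    its left limit. A bounded one without attained supremum has no argmax time, and the infimum of
    the empty set is 0. *)
Lemma G_not_attained w k : ~ attains_sup w k -> G k w = 0.
Proof.
move=> natt; have [wb|/Xbar_unbounded/argmax_times0/G_le G0] := pselect (path_bounded w k); last first.
  by apply/eqP; rewrite eq_le G0 G_ge0.
have [A0|] := eqVneq (argmax_times w k) set0.
  by rewrite /G -[X in inf X]/(argmax_times w k) A0 inf0.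
move=> /set0P[t At]; exfalso; apply: natt; split => //; exists t => e e0.
by have [s /andP[_ st] ws] := argmax_times_adherent At ltr01 e0; exists s.
Qed.

(** The event [c < G k w] holds exactly when the supremum is attained and some rational level bounds
    the path up to a rational time beyond [c] but is exceeded later. *)
Lemma measurable_G k : measurable_fun setT (fun w => G k w).
Proof.
apply: measurable_fun_gt => [c c0|w]; last exact: G_ge0.
rewrite [X in measurable X](_ : _ =
    [set w : path | attains_sup w k /\ exists a : rat, exists b : rat,
      c < ratr a /\ ((forall q : rat, (ratr q : R) <= ratr a -> w k (ratr q) <= ratr b) /\
      exists q : rat, ratr b < w k (ratr q))]).
  apply: measurable_set_and; first exact: measurable_attains_sup.
  apply: measurable_set_exists => a; apply: measurable_set_exists => b.
  have [ca|ca] := boolP (c < ratr a); last first.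
    by rewrite (_ : mkset _ = set0)//; apply/seteqP; split => w //= [].
  rewrite (_ : mkset _ = [set w : path | (forall q : rat, (ratr q : R) <= ratr a -> w k (ratr q) <= ratr b) /\
      exists q : rat, ratr b < w k (ratr q)]); last first.
    by apply/seteqP; split => w /= => [[]|].
  apply: measurable_set_and; last first.
    by apply: measurable_set_exists => q; exact: measurable_set_coord_gt.
  apply: measurable_set_forall => q; apply: measurable_set_imply => _.
  exact: measurable_set_coord_le.
apply/seteqP; split => w /=.
  move=> cG; have [wa|/G_not_attained G0] := pselect (attains_sup w k); last first.
    by move: cG; rewrite G0 ltNge c0.
  split => //; have [[_ h _] _] := G_first_max_time wa.1 wa.2.
  pose r := (G k w - c) / 2.
  have r0 : 0 < r by rewrite divr_gt0// subr_gt0.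
  have rE : r + r = G k w - c by rewrite -splitr.
  have [|e e0 He] := h r r0; first by lra.
  have [a] := @rat_in_itvoo _ c (c + r) (ltac:(by rewrite ltrDl)).
  rewrite in_itv/= => /andP[ca ac].
  have [b] := @rat_in_itvoo _ (Xbar k w - e) (Xbar k w) (ltac:(by rewrite gtrDl oppr_lt0)).
  rewrite in_itv/= => /andP[eb bX].
  exists a, b; split => //; split.
    by move=> q qa; rewrite (le_trans (He _ _)) ?(ltW eb)//; lra.
  have [s] := Xbar_adherent wa.1 (etrans (subr_gt0 _ _) bX).
  rewrite opprB addrC subrK => ws.
  have [q _] := path_gt_rat ws (ltr_pwDr (@ltr01 R) (lexx s)).
  by exists q.
move=> [wa [a [b [ca [wab [q bq]]]]]]; rewrite ltNge; apply/negP => Gc.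
have [[_ _ h] _] := G_first_max_time wa.1 wa.2.
have e0 : 0 < Xbar k w - ratr b by rewrite subr_gt0 (lt_le_trans bq)// le_Xbar//; case: wa.
have [|s] := h (ratr a - G k w) (Xbar k w - ratr b) _ e0.
  by rewrite subr_gt0 (le_lt_trans Gc).
rewrite addrC subrK => sa; rewrite opprB addrC subrK => bs.
have [q' /andP[_ q'a]] := path_gt_rat bs sa.
by rewrite ltNge wab// ltW.
Qed.

Lemma inv_nat_lt (e : R) : 0 < e -> exists N : nat, forall m, (N <= m)%N -> m.+1%:R^-1 < e.
Proof.
move=> e0; exists (Num.truncn e^-1) => m Nm.
rewrite -[e]invrK ltf_pV2 ?posrE ?invr_gt0//.
have /andP[_ h] := truncn_itv (ltW (etrans (invr_gt0 _) e0)).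
by rewrite (lt_le_trans h)// ler_nat.
Qed.

Lemma cvg_path_right w i t (x : nat -> R) : 0 <= t ->
  (forall m, t <= x m <= t + m.+1%:R^-1) -> w i (x m) @[m --> \oo] --> w i t.
Proof.
move=> t0 xt; apply/cvgrPdist_lt => e e0.
have [r r0 Hr] := path_right_cvg w i t0 e0.
have [N HN] := inv_nat_lt r0.
exists N => // m /= Nm; have /andP[tx xm] := xt m.
by apply: Hr; rewrite tx (le_lt_trans xm)// ltrD2l HN.
Qed.

Lemma cvg_path_left w i t (x : nat -> R) :
  (forall m, t - m.+1%:R^-1 <= x m < t) -> w i (x m) @[m --> \oo] --> left_limit (w i) t.
Proof.
move=> xt; apply/cvgrPdist_lt => e e0.
have [r r0 Hr] := path_left_cvg w i t e0.
have [N HN] := inv_nat_lt r0.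
exists N => // m /= Nm; have /andP[tx xm] := xt m.
by apply: Hr; rewrite xm andbT (lt_le_trans _ tx)// ltrD2l ltrN2 HN.
Qed.

(** The random time is approximated by the next grid point strictly to its right, which takes
    countably many values; right-continuity gives the limit. *)
Lemma measurable_path_at i (tau : path -> R) : measurable_fun setT tau ->
  measurable_fun setT (fun w => w i (tau w)).
Proof.
move=> mtau.
pose tau' w := Num.max (tau w) 0.
have mtau' : measurable_fun setT tau' by exact: measurable_maxr.
have tau'0 w : 0 <= tau' w by rewrite le_max lexx orbT.
rewrite (_ : (fun w => w i (tau w)) = fun w => if tau w < 0 then 0 else w i (tau' w)); last first.
  by apply/funext => w; rewrite /tau'; case: ltP => // t0; rewrite path_neg.
apply: measurable_fun_ifT => //; first exact: measurable_fun_ltr.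
pose idx m w := Num.truncn (m.+1%:R * tau' w).
apply: (@measurable_fun_cvg _ _ _ _
  (fun m w => w i ((idx m w).+1%:R * m.+1%:R^-1))).
  move=> m; apply: (@measurable_fun_nat_index _ _ _ _ (fun a w => w i (a.+1%:R / m.+1%:R)) (idx m)).
    by move=> a; exact: measurable_coord.
  move=> a; have mm : measurable_fun setT (fun w => m.+1%:R * tau' w).
    exact: measurable_funM.
  rewrite [X in measurable X](_ : _ =
      [set w : path | a%:R <= m.+1%:R * tau' w] `&` [set w : path | m.+1%:R * tau' w < a.+1%:R]).
    by apply: measurableI; [exact: measurable_set_le|exact: measurable_set_lt].
  have m0 w : 0 <= m.+1%:R * tau' w by rewrite mulr_ge0.
  apply/seteqP; split => w /=.
    by move=> <-; have /andP[] := truncn_itv (m0 w).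
  by move=> [h1 h2]; apply: truncn_def; rewrite h1.
move=> w _; apply: cvg_path_right => // m.
have /andP[h1 h2] := truncn_itv (mulr_ge0 (ler0n R m.+1) (tau'0 w)).
rewrite -/(idx m w) in h1 h2.
rewrite ler_pdivlMr// mulrC (ltW h2)/= ler_pdivrMr// mulrDl mulVf ?pnatr_eq0//.
by rewrite -natr1 lerD2r mulrC.
Qed.

Lemma measurable_left_limit_at i (tau : path -> R) : measurable_fun setT tau ->
  measurable_fun setT (fun w => left_limit (w i) (tau w)).
Proof.
move=> mtau; apply: (@measurable_fun_cvg _ _ _ _ (fun m w => w i (tau w - m.+1%:R^-1))).
  by move=> m; apply: measurable_path_at; exact: measurable_funB.
by move=> w _; apply: cvg_path_left => m; rewrite lexx/= gtrDl oppr_lt0 invr_gt0 ltr0n.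
Qed.

Lemma measurable_X_at_max k i : measurable_fun setT (fun w => X_at_max k w i).
Proof.
have mG := measurable_G k.
apply: measurable_fun_ifT; last 2 first.
- exact: measurable_path_at.
- exact: measurable_left_limit_at.
by apply: measurable_fun_eqr; [exact: measurable_path_at|exact: measurable_Xbar].
Qed.

Lemma measurable_post_max k : measurable_fun setT (fun w : path => post_max k w).
Proof.
apply: measurable_fun_path => i t t0.
rewrite (_ : (fun w => _) = fun w => w i (G k w + t) - X_at_max k w i); last first.
  by apply/funext => w; rewrite post_maxE.
apply: measurable_funB; last exact: measurable_X_at_max.
by apply: measurable_path_at; apply: measurable_funD => //; exact: measurable_G.
Qed.

End path_measurability.

(** * Iterated limits *)

(** The limit in m followed by the limit in p, as a single filter on pairs. This filter has no
    countable base, so dominated convergence along it goes through convergence in measure. *)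
Definition iterated_oo : set_system (nat * nat) :=
  [set A | \forall p \near \oo, \forall m \near \oo, A (p, m)].

Global Instance iterated_oo_filter : ProperFilter iterated_oo.
Proof.
split.
  move=> [N _ /(_ N (leqnn N))[M _ /(_ M (leqnn M))]]; exact.
split.
- by exists 0%N => // p _; exists 0%N.
- move=> A B hA hB; apply: (@filterS2 _ \oo _ _ _ _ _ hA hB) => p hAp hBp.
  exact: (@filterI _ \oo _ _ _ hAp hBp).
- move=> A B AB hA; apply: (@filterS _ \oo _ _ _ _ hA) => p hAp.
  by apply: (@filterS _ \oo _ _ _ _ hAp) => m; exact: AB.
Qed.

Section iterated_convergence.
Context d (T : measurableType d) (R : realType) (P : probability T R).

Lemma fine_expectation (f : T -> R) : fine 'E_P[f] = \int[P]_w f w.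
Proof. by rewrite unlock. Qed.

Let integrable01 (f : T -> R) : measurable_fun setT f -> (forall w, 0 <= f w <= 1) ->
  P.-integrable setT (EFin \o f).
Proof.
move=> mf f01; apply: measurable_bounded_integrable => //.
  by rewrite (le_lt_trans (probability_le1 P measurableT))// ltry.
exists 1; split => // x x1 w _; have /andP[f0 f1] := f01 w.
by rewrite /= ger0_norm// (le_trans f1)// ltW.
Qed.

Lemma nonincreasing_measure_small (A : nat -> set T) (e : R) :
  (forall i, measurable (A i)) -> {homo A : n m / (n <= m)%N >-> m `<=` n} ->
  P (\bigcap_i A i) = 0%E -> 0 < e ->
  exists N, forall i, (N <= i)%N -> (P (A i) < e%:E)%E.
Proof.
move=> mA niA A0 e0.
have : (P \o A) x @[x --> \oo] --> P (\bigcap_i A i).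
  apply: nonincreasing_cvg_mu => //.
  - by rewrite (le_lt_trans (probability_le1 P (mA 0%N)))// ltry.
  - exact: bigcapT_measurable.
  - by move=> i j ij; exact/subsetPset/niA.
rewrite A0 => /fine_cvgP[_ /cvgrPdist_lt/(_ _ e0)[N _ HN]].
exists N => i Ni; have := HN i Ni; rewrite /= sub0r normrN ger0_norm ?fine_ge0//.
by rewrite -lte_fin fineK// fin_num_measure.
Qed.

Variables (Z : nat * nat -> T -> R) (L : T -> R).
Hypothesis mZ : forall z, measurable_fun setT (Z z).
Hypothesis mL : measurable_fun setT L.

Let dev (e : R) p m := [set w | e < `|Z (p, m) w - L w|].

Let mdev e p m : measurable (dev e p m).
Proof.
apply: measurable_set_lt => //; apply: measurableT_comp => //.
exact: measurable_funB.
Qed.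

(** [B p] collects the deviations that recur for infinitely many m, and the intersection of the
    [C Q] those recurring for infinitely many p as well; the latter is null. Continuity from above
    is used once in p, then once in m. *)
Lemma iterated_cvg_in_measure (e : R) : 0 < e ->
  {ae P, forall w, Z z w @[z --> iterated_oo] --> L w} ->
  \forall p \near \oo, \forall m \near \oo, (P (dev e p m) < e%:E)%E.
Proof.
move=> e0 ZL.
pose A p M := \bigcup_(m in [set m | (M <= m)%N]) dev e p m.
have mA p M : measurable (A p M) by apply: bigcup_measurable => m _; exact: mdev.
have niA p : {homo A p : n m / (n <= m)%N >-> m `<=` n}.
  by move=> a b ab w [m /= bm Dm]; exists m => //=; exact: leq_trans bm.
pose B p := \bigcap_M A p M.
have mB p : measurable (B p) by exact: bigcapT_measurable.
pose C Q := \bigcup_(p in [set p | (Q <= p)%N]) B p.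
have mC Q : measurable (C Q) by apply: bigcup_measurable.
have niC : {homo C : n m / (n <= m)%N >-> m `<=` n}.
  by move=> a b ab w [m /= bm Dm]; exists m => //=; exact: leq_trans bm.
have C0 : P (\bigcap_Q C Q) = 0%E.
  have [N [mN N0 subN]] := ZL.
  apply/eqP; rewrite -measure_le0 -N0; apply: le_measure; rewrite ?inE//.
    exact: bigcapT_measurable.
  move=> w Cw; apply: subN => /= /cvgrPdist_le/(_ _ e0)[Q _ HQ].
  have [p /= Qp Bp] := Cw Q Logic.I.
  have [M _ HM] := HQ p Qp.
  have [m /= Mm] := Bp M Logic.I.
  by rewrite /dev/= distrC ltNge HM.
have [Q HQ] := nonincreasing_measure_small mC niC C0 e0.
exists Q => // p /= Qp.
have Bp : (P (B p) < e%:E)%E.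
  rewrite (le_lt_trans _ (HQ p Qp))//; apply: le_measure; rewrite ?inE//.
  by move=> w Bw; exists p => //=.
have : (P \o A p) x @[x --> \oo] --> P (\bigcap_i A p i).
  apply: nonincreasing_cvg_mu => //.
  - by rewrite (le_lt_trans (probability_le1 P (mA _ 0%N)))// ltry.
  - exact: mB.
  - by move=> i j ij; exact/subsetPset/niA.
rewrite -/(B p) -[P (B p)]fineK ?fin_num_measure// => /fine_cvgP[_ /cvgrPdist_lt].
have fB : (fine (P (B p)) < e) by rewrite -lte_fin fineK// fin_num_measure.
move=> /(_ _ (etrans (subr_gt0 _ _) fB))[M _ HM].
exists M => // m /= Mm.
apply: (@le_lt_trans _ _ (P (A p m))).
  by apply: le_measure; rewrite ?inE// => w Dw; exists m => /=.
have := HM m Mm; rewrite /= ltr_distlC => /andP[_].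
by rewrite [_ + (_ - _)]addrC subrK -lte_fin fineK// fin_num_measure.
Qed.

(** The integrand [|Z - L|] is at most [e / 2] off the deviation set and at most 1 on it, and that
    set has probability below [e / 2]. *)
Lemma iterated_dominated_cvg :
  (forall z w, 0 <= Z z w <= 1) -> (forall w, 0 <= L w <= 1) ->
  {ae P, forall w, Z z w @[z --> iterated_oo] --> L w} ->
  fine 'E_P[Z z] @[z --> iterated_oo] --> fine 'E_P[L].
Proof.
move=> Z01 L01 ZL; apply/cvgrPdist_le => e e0.
have e20 : 0 < e / 2 by rewrite divr_gt0.
have := iterated_cvg_in_measure e20 ZL.
apply: filterS => p; apply: filterS => m Pdev.
rewrite distrC !fine_expectation -RintegralB//; last 2 first.
- exact: integrable01.
- exact: integrable01.
have mZL : measurable_fun setT (fun w => Z (p, m) w - L w) by exact: measurable_funB.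
have ZL1 w : `|Z (p, m) w - L w| <= 1.
  have /andP[z0 z1] := Z01 (p, m) w; have /andP[l0 l1] := L01 w.
  by rewrite ler_norml; lra.
have iZL : P.-integrable setT (EFin \o (fun w => Z (p, m) w - L w)).
  apply: measurable_bounded_integrable => //.
    by rewrite (le_lt_trans (probability_le1 P measurableT))// ltry.
  exists 1; split => // x x1 w _; by rewrite /= (le_trans (ZL1 w))// ltW.
apply: (le_trans (le_normr_Rintegral _ _)) => //.
have mD := mdev (e / 2) p m.
have fin_e : (\int[P]_w ((e / 2)%:E + (\1_(dev (e / 2) p m) w)%:E) <= e%:E)%E.
  rewrite ge0_integralD//; last 2 first.
  - by move=> w _; rewrite lee_fin ltW.
  - exact/measurable_EFinP/measurable_indic.
  rewrite integral_cst// integral_indic// setIT.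
  rewrite [e in X in (_ <= X)%E]splitr EFinD; apply: leeD; last exact: ltW.
  by rewrite -[leRHS]mule1 lee_pmul2l// ?lte_fin//; exact: probability_le1.
have : (\int[P]_w (`|Z (p, m) w - L w|)%:E <= e%:E)%E.
  apply: le_trans fin_e; apply: ge0_le_integral => //.
  - by apply/measurable_EFinP; exact: measurableT_comp.
  - apply: emeasurable_funD => //; exact/measurable_EFinP/measurable_indic.
  - move=> w _; rewrite -EFinD lee_fin indicE.
    have [wD|wD] := boolP (w \in _); first by rewrite (le_trans (ZL1 w))// lerDr ltW.
    rewrite addr0 leNgt; apply/negP => h; move/negP: wD; apply.
    by rewrite inE.
rewrite /Rintegral => h; rewrite -lee_fin fineK// ge0_fin_numE ?integral_ge0//.
by rewrite (le_lt_trans h)// ltry.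
Qed.

End iterated_convergence.

Lemma ae_iterated_dominated_cvg d (T : measurableType d) (R : realType)
    (P : probability T R) (Z : nat * nat -> T -> R) (L : T -> R) :
  (forall z, measurable_fun setT (Z z)) -> measurable_fun setT L ->
  {ae P, forall w, forall z, 0 <= Z z w <= 1} ->
  {ae P, forall w, Z z w @[z --> iterated_oo] --> L w} ->
  fine 'E_P[Z z] @[z --> iterated_oo] --> fine 'E_P[L].
Proof.
move=> mZ mL Z01 ZL.
(* Clamping to [0, 1] turns almost sure bounds into sure ones without changing the expectations. *)
pose clamp (x : R) := Num.min (Num.max x 0) 1.
have clamp01 x : 0 <= clamp x <= 1.
  by rewrite /clamp le_min ler01 andbT le_max lexx orbT ge_min lexx orbT.
have clampE x : 0 <= x <= 1 -> clamp x = x.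
  by move=> /andP[x0 x1]; rewrite /clamp max_l// min_l.
have mclamp f : measurable_fun setT f -> measurable_fun setT (fun w : T => clamp (f w)).
  by move=> mf; apply: measurable_minr => //; exact: measurable_maxr.
have L01 : {ae P, forall w, 0 <= L w <= 1}.
  apply: filterS2 Z01 ZL => w Zw ZLw; apply/andP; split.
    by apply: cvgr_to_ge ZLw _; apply: nearW => z; case/andP: (Zw z).
  by apply: cvgr_to_le ZLw _; apply: nearW => z; case/andP: (Zw z).
have Eclamp (f : T -> R) : measurable_fun setT f -> {ae P, forall w, 0 <= f w <= 1} ->
    ('E_P[f] = 'E_P[fun w => clamp (f w)])%E.
  move=> mf f01; rewrite unlock; apply: ae_eq_integral => //.
  - exact/measurable_EFinP.
  - exact/measurable_EFinP/mclamp.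
  - by apply: filterS f01 => w fw _ /=; rewrite clampE.
rewrite (Eclamp L)//.
under eq_fun => z do rewrite (Eclamp _ (mZ z) (filterS (fun w H => H z) Z01)).
apply: (iterated_dominated_cvg (Z := fun z w => clamp (Z z w))) => //.
- by move=> z; exact: mclamp.
- exact: mclamp.
- apply: filterS2 ZL (filterI Z01 L01) => w ZLw [Zw Lw]; rewrite clampE//.
  by under eq_fun do rewrite clampE//.
Qed.

(** * Convergence of the tilted grid argmax *)

Section grid_argmax.
Context {R : realType} {n : nat}.
Implicit Types (w : cadlag_path R n) (j : 'I_n) (z : nat * nat).

Definition mesh z : R := z.2.+1%:R^-1.

(* The path [w j] on the grid of mesh [1/(z.2+1)], with an additional drift
   [- c/(z.1+1)]. Letting [z.2] tend to infinity before [z.1], its argmax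
   selects the first argmax of [w j]. *)
Definition tilted w j (c : R) z (a : nat) : R :=
  w j (mesh z * a%:R) - z.1.+1%:R^-1 * (c * (mesh z * a%:R)).

Definition grid_argmax w j c z : nat := first_argmax (tilted w j c z).

Lemma mesh_gt0 z : 0 < mesh z. Proof. by rewrite invr_gt0. Qed.

Lemma mesh_nat_ge0 z (a : nat) : 0 <= mesh z * a%:R.
Proof. by rewrite mulr_ge0// ltW// mesh_gt0. Qed.

Hint Resolve mesh_gt0 mesh_nat_ge0 : core.

Lemma tilted_argmax_exists w j c z : 0 <= c -> w j 0 = 0 ->
  w j t @[t --> +oo] --> -oo -> exists i, is_first_argmax (tilted w j c z) i.
Proof.
move=> c0 w0 /cvgrNy_le/(_ 0)[T [_ HT]]; apply: first_argmax_exists.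
(* From this index on the grid lies beyond [T], where the path is nonpositive, and the tilt only
   lowers it. *)
exists (Num.truncn (`|T| / mesh z)).+1 => a Na.
rewrite {2}/tilted !mulr0 w0 subr0.
have Ta : T < mesh z * a%:R.
  rewrite mulrC -ltr_pdivrMr//.
  have /andP[_ h] := truncn_itv (divr_ge0 (normr_ge0 T) (ltW (mesh_gt0 z))).
  rewrite (@le_lt_trans _ _ (`|T| / mesh z))//.
    by rewrite ler_pM2r ?invr_gt0// ler_norm.
  by rewrite (lt_le_trans h)// ler_nat.
have h0 : 0 <= z.1.+1%:R^-1 * (c * (mesh z * a%:R)).
  by rewrite mulr_ge0 ?invr_ge0// mulr_ge0// mesh_nat_ge0.
by rewrite /tilted subr_le0 (le_trans (HT _ Ta)).
Qed.

Lemma grid_point (x y : R) (p : nat) : 0 <= x -> x < y ->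
  \forall m \near \oo, exists a : nat, x < mesh (p, m) * a%:R < y.
Proof.
move=> x0 xy; have [N HN] := inv_nat_lt (etrans (subr_gt0 _ _) xy).
exists N => // m /= Nm; set h := mesh _.
have h0 : 0 < h by exact: mesh_gt0.
exists (Num.truncn (x / h)).+1.
have /andP[h1 h2] := truncn_itv (divr_ge0 x0 (ltW h0)).
rewrite mulrC -ltr_pdivrMr// h2 -natr1 mulrDl mul1r/=.
have : (Num.truncn (x / h))%:R * h <= x by rewrite -ler_pdivlMr.
by have := HN m Nm; rewrite -/(mesh (p, m)) -/h; lra.
Qed.

Lemma grid_near_max w j (p : nat) (e : R) : w j 0 = 0 -> attains_sup w j -> 0 < e ->
  \forall m \near \oo, exists2 a : nat,
    `|mesh (p, m) * a%:R - G j w| < e & Xbar j w - e < w j (mesh (p, m) * a%:R).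
Proof.
move=> w0 wa e0; have [_ [G0 wG]] := G_first_max_time wa.1 wa.2.
have [wG'|wG'] : w j (G j w) = Xbar j w \/
    (0 < G j w /\ left_limit (w j) (G j w) = Xbar j w).
  case: wG => [|wG]; [by left|].
  (* At time 0 the left limit is 0 by convention and equals [w j 0], so the maximum is then a value
     of the path. *)
  have [G00|] := eqVneq (G j w) 0; last by rewrite eq_sym => Gn0; right; rewrite lt_neqAle Gn0.
  by left; rewrite G00 w0 -wG left_limit_le0// G00.
- have [r r0 Hr] := path_right_cvg w j G0 e0.
  have : G j w < G j w + Num.min r e by rewrite ltrDl lt_min r0.
  move=> /(grid_point p G0); apply: filterS => m [a /andP[Ga aG]]; exists a.
    have : Num.min r e <= e by rewrite ge_min lexx orbT.
    by rewrite ger0_norm; lra.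
  have := Hr (mesh (p, m) * a%:R); rewrite (ltW Ga) wG' (lt_le_trans aG) ?lerD2l ?ge_min ?lexx//.
  by move=> /(_ erefl); rewrite ltr_distlC => /andP[].
- have [Gp lG] := wG'; have [r r0 Hr] := path_left_cvg w j (G j w) e0.
  have : Num.max (G j w - Num.min r e) 0 < G j w.
    by rewrite gt_max Gp andbT gtrDl oppr_lt0 lt_min r0.
  have m0 : 0 <= Num.max (G j w - Num.min r e) 0 by rewrite le_max lexx orbT.
  move=> /(grid_point p m0); apply: filterS => m [a]; rewrite gt_max => /andP[/andP[Ga _] aG].
  have mr : Num.min r e <= r by rewrite ge_min lexx.
  have me : Num.min r e <= e by rewrite ge_min lexx orbT.
  exists a; first by rewrite ler0_norm; lra.
  have := Hr (mesh (p, m) * a%:R); rewrite aG andbT lG.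
  move=> /(_ (ltac:(lra))); rewrite ltr_distlC => /andP[] //.
Qed.

(** The tilted value at the argmax [tau] is compared with that at a grid point [s] near G_j. A weak
    tilt leaves [w j tau] close to the supremum, so [tau] cannot come early; a grid fine enough for
    the given tilt prevents [tau] from coming late. *)
Lemma grid_argmax_near w j c (e : R) : 0 < c -> w j 0 = 0 ->
  w j t @[t --> +oo] --> -oo -> 0 < e ->
  \forall p \near \oo, \forall m \near \oo,
    let tau := mesh (p, m) * (grid_argmax w j c (p, m))%:R in
    `|tau - G j w| < e /\ `|w j tau - Xbar j w| < e.
Proof.
move=> c0 w0 wD e0; have wa : attains_sup w j by exact: drift_bounded.
have [[G0 hG _] _] := G_first_max_time wa.1 wa.2.
(* Any epoch at which the path is within [f] of its supremum lies after [G j w - e]. *)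
have [f f0 [fe Hf]] : exists2 f, 0 < f & f <= e /\ forall s, 0 <= s -> Xbar j w - f < w j s -> G j w - e < s.
  have [eG|Ge] := leP e (G j w).
    have [f f0 Hf] := hG e e0 eG; exists (Num.min e f); first by rewrite lt_min e0.
    rewrite ge_min lexx; split => // s _ ws; rewrite ltNge; apply/negP => /Hf ws'.
    have : Num.min e f <= f by rewrite ge_min lexx orbT.
    lra.
  by exists e => //; split => // s s0 _; lra.
have cG0 : 0 < c * (G j w + 1) by rewrite mulr_gt0// ltr_wpDl.
(* From [p0] on, the tilt at epochs up to [G j w + 1] costs less than [f / 2]. *)
have f2 : 0 < f / 2 / (c * (G j w + 1)) by rewrite !divr_gt0.
have [p0 Hp0] := inv_nat_lt f2.
exists p0 => // p /= /Hp0; set ep := p.+1%:R^-1.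
have ep0 : 0 < ep :> R by rewrite invr_gt0.
rewrite ltr_pdivlMr// => epf.
have epc0 : 0 < ep * c by rewrite mulr_gt0.
(* The bound [f / 2] keeps the total loss below [f]; the bound [e / 2 * (ep * c)] turns a loss of
   [g] into a delay of at most [e / 2]. It depends on [p], so the mesh must be chosen after the
   tilt. *)
pose g := Num.min (Num.min 1 (f / 2)) (Num.min (e / 2) (e / 2 * (ep * c))).
have g0 : 0 < g by rewrite !lt_min ltr01 !divr_gt0//= mulr_gt0// divr_gt0.
have [g1 gf ge gec] : [/\ g <= 1, g <= f / 2, g <= e / 2 & g <= e / 2 * (ep * c)].
  by split; rewrite !ge_min lexx ?orbT.
have := grid_near_max p w0 wa g0; apply: filterS => m [a aG wa'].
have [_ /(_ a)] := is_first_argmaxP (tilted_argmax_exists (p, m) (ltW c0) w0 wD).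
rewrite -/(grid_argmax w j c (p, m)).
set i := grid_argmax _ _ _ _; rewrite /tilted/= -/ep.
set tau := mesh _ * i%:R; set s := mesh _ * a%:R in aG wa' *.
have tau0 : 0 <= tau by exact: mesh_nat_ge0.
have wtau : w j tau <= Xbar j w by exact: le_Xbar wa.1.
rewrite [ep * (c * s)]mulrA [ep * (c * tau)]mulrA => H.
have sG : s < G j w + g by move: aG; rewrite ltr_distl => /andP[].
have H1 : ep * c * s <= ep * c * (G j w + g) by rewrite ler_pM2l// ltW.
have H2 : ep * c * (G j w + g) <= f / 2.
  apply: le_trans (ltW epf); rewrite -mulrA ler_pM2l// ler_pM2l//; lra.
have H0 : 0 <= ep * c * tau by rewrite mulr_ge0// ltW.
split.
- rewrite ltr_distl; apply/andP; split.
    by apply: Hf => //; lra.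
  have : ep * c * tau < ep * c * (G j w + g + e / 2).
    rewrite [ltRHS]mulrDr [_ * (e / 2)]mulrC; lra.
  by rewrite ltr_pM2l//; lra.
- by rewrite ler0_norm; lra.
Qed.

Lemma cvg_grid_argmax w j c : 0 < c -> w j 0 = 0 -> w j t @[t --> +oo] --> -oo ->
  mesh z * (grid_argmax w j c z)%:R @[z --> iterated_oo] --> G j w.
Proof.
move=> c0 w0 wD; apply/cvgrPdist_lt => e e0.
have := grid_argmax_near c0 w0 wD e0; apply: filterS => p; apply: filterS => m /= [h _].
by rewrite distrC.
Qed.

Lemma cvg_grid_max w j c : 0 < c -> w j 0 = 0 -> w j t @[t --> +oo] --> -oo ->
  w j (mesh z * (grid_argmax w j c z)%:R) @[z --> iterated_oo] --> Xbar j w.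
Proof.
move=> c0 w0 wD; apply/cvgrPdist_lt => e e0.
have := grid_argmax_near c0 w0 wD e0; apply: filterS => p; apply: filterS => m /= [_ h].
by rewrite distrC.
Qed.

End grid_argmax.

(** * The network *)

Section network.
Context {R : realType} {n : nat}.
Variable K : 'I_n.+1 -> R.
Hypothesis K_gt0 : forall j : 'I_n.+1, j != ord0 -> 0 < K j.
Implicit Types (j k l : 'I_n.+1).

Lemma Kprod_id k : Kprod K k k = 1.
Proof.
by rewrite /Kprod big_pred0// => i; apply/negP => /andP[/leq_trans/[apply]]; rewrite ltnn.
Qed.

Lemma KprodS k (j : 'I_n) : (k <= j)%N ->
  Kprod K k (snd_ix j) = K (snd_ix j) * Kprod K k (fst_ix j).
Proof.
move=> kj; rewrite /Kprod (bigD1 (snd_ix j))/=; last by rewrite leqnn andbT.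
congr (_ * _); apply: eq_bigl => i; rewrite -andbA; congr (_ && _).
by rewrite -val_eqE/= /bump leq0n add1n andbC -ltn_neqAle ltnS.
Qed.

Lemma Kprod_gt0 k j : 0 < Kprod K k j.
Proof.
apply: prodr_gt0 => i /andP[ki _]; apply: K_gt0.
by apply/eqP => i0; rewrite i0 in ki.
Qed.

Lemma ordS_ind k (Q : 'I_n.+1 -> Prop) : Q k ->
  (forall j : 'I_n, (k <= j)%N -> Q (fst_ix j) -> Q (snd_ix j)) ->
  forall j, (k <= j)%N -> Q j.
Proof.
move=> Qk QS [j jn]; elim: j jn => [|j IH] jn kj.
  by rewrite (_ : Ordinal jn = k)//; apply: val_inj => /=; apply/esym/eqP; rewrite -leqn0.
have [kE|kNj] := eqVneq (val k) j.+1; first by rewrite (_ : Ordinal jn = k)//; apply: val_inj.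
have kj' : (k <= j)%N by rewrite -ltnS ltn_neqAle kNj.
have jn' : (j < n)%N by rewrite -ltnS.
rewrite (_ : Ordinal jn = snd_ix (Ordinal jn')); last exact: val_inj.
apply: QS => //; rewrite (_ : fst_ix _ = Ordinal (ltnW jn)); last exact: val_inj.
exact: IH.
Qed.

Section path.
Variables (w : cadlag_path R n.+1) (U : 'I_n.+1 -> R -> R).
Hypothesis w0 : forall j, w j 0 = 0.
Hypothesis wU : forall (j : 'I_n) t, 0 <= t ->
  w (snd_ix j) t = K (snd_ix j) * w (fst_ix j) t + U (snd_ix j) t.
Hypothesis Umono : forall l, l != ord0 -> forall s t, 0 <= s -> s <= t -> U l s <= U l t.

Lemma network_path k j t : (k <= j)%N -> 0 <= t ->
  w j t = Kprod K k j * w k t + \sum_(l < n.+1 | (k < l <= j)%N) Kprod K l j * U l t.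
Proof.
move=> kj t0; move: j kj; apply: ordS_ind.
  rewrite Kprod_id mul1r big_pred0 ?addr0// => i.
  by apply/negP => /andP[/leq_trans/[apply]]; rewrite ltnn.
move=> j kj IH; rewrite wU// IH KprodS// mulrDr mulrA -addrA; congr (_ + _).
rewrite [RHS](bigD1 (snd_ix j))/=; last by rewrite ltnS kj/=.
rewrite Kprod_id mul1r addrC; congr (_ + _); rewrite mulr_sumr.
apply: eq_big => l.
  rewrite -andbA; congr (_ && _).
  by rewrite -val_eqE/= /bump leq0n add1n andbC -ltn_neqAle ltnS.
by move=> /andP[_ lj]; rewrite KprodS// mulrA.
Qed.

(** Collecting the contributions of [U l] to all coordinates above it produces the argument of
    theta_l in the theorem. *)
Lemma network_sum k (b : 'I_n.+1 -> R) t : 0 <= t ->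
  \sum_(j < n.+1 | (k <= j)%N) b j * w j t =
  (\sum_(j < n.+1 | (k <= j)%N) Kprod K k j * b j) * w k t +
  \sum_(l < n.+1 | (k < l)%N) (\sum_(j < n.+1 | (l <= j)%N) Kprod K l j * b j) * U l t.
Proof.
move=> t0.
under eq_bigr => j kj do rewrite (network_path kj t0) mulrDr mulr_sumr.
rewrite big_split/=; congr (_ + _).
  by rewrite mulr_suml; apply: eq_bigr => j _; rewrite mulrCA mulrA.
rewrite (exchange_big_dep (fun l => (k < l)%N))/=; last by move=> j l _ /andP[].
apply: eq_bigr => l kl; rewrite mulr_suml; apply: eq_big => j.
  by rewrite kl/=; apply/andP/idP => [[]//|lj]; split => //; rewrite (leq_trans _ lj)// ltnW.
by move=> _; rewrite mulrA [b j * _]mulrC.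
Qed.

Lemma network_mono k j : (k <= j)%N ->
  {homo (fun t => w j t - Kprod K k j * w k t) : s t / s <= t}.
Proof.
move=> kj.
pose S t := \sum_(l < n.+1 | (k < l <= j)%N) Kprod K l j * U l t.
have E t : 0 <= t -> w j t - Kprod K k j * w k t = S t.
  by move=> t0; rewrite (network_path kj t0) addrAC subrr add0r.
have Smono s t : 0 <= s -> s <= t -> S s <= S t.
  move=> s0 st; apply: ler_sum => l /andP[kl _]; rewrite ler_pM2l ?Kprod_gt0//.
  by apply: Umono => //; apply/eqP => l0; rewrite l0 in kl.
(* Paths vanish at negative times, so monotonicity across time 0 rests on the difference starting
   from 0. *)
have S0 : S 0 = 0 by rewrite -E// !w0 mulr0 subrr.
move=> s t st; have [s0|s0] := ltP s 0; last by rewrite !E ?Smono// (le_trans s0).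
rewrite !(path_neg _ _ s0) mulr0 subrr.
have [t0|t0] := ltP t 0; first by rewrite !(path_neg _ _ t0) mulr0 subrr.
by rewrite E// -S0 Smono.
Qed.

End path.
End network.

(** * Splitting on the grid *)

(** If [v] were maximal at an earlier index than [u], the strict increase of [u] up to [i] would
    force [v] to increase as well. *)
Lemma first_argmax_le (R : realType) (u v : nat -> R) (c : R) i j : 0 < c ->
  (forall a b, (a <= b)%N -> v a - c * u a <= v b - c * u b) ->
  is_first_argmax u i -> is_first_argmax v j -> (i <= j)%N.
Proof.
move=> c0 mono [u1 _] [_ v2]; rewrite leqNgt; apply/negP => ji.
have := mono _ _ (ltnW ji); have := v2 i.
by have : c * u j < c * u i; [rewrite ltr_pM2l// u1|lra].
Qed.

Lemma first_argmax_shift (R : realType) (v : nat -> R) i j : (i <= j)%N ->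
  is_first_argmax v j -> is_first_argmax (fun a => v (i + a)%N - v i) (j - i)%N.
Proof.
move=> ij [v1 v2]; split=> a; rewrite subnKC// ?ltrD2r ?lerD2r.
  by move=> aji; apply: v1; rewrite -ltn_subRL.
exact: v2.
Qed.

Lemma Kprod_mul (R : realType) n (K : 'I_n.+1 -> R) (k j : 'I_n.+1) : (k <= j)%N ->
  Kprod K ord0 j = Kprod K k j * Kprod K ord0 k.
Proof.
move: j; apply: ordS_ind; first by rewrite Kprod_id mul1r.
by move=> j kj IH; rewrite !KprodS// IH mulrA.
Qed.

Section grid_network.
Context {R : realType} {n : nat}.
Local Notation path := (cadlag_path R n.+1).
Implicit Types (w : path) (j k l : 'I_n.+1).
Variables (P : probability path R) (K : 'I_n.+1 -> R) (Ups : 'I_n.+1 -> R -> path -> R).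
Hypothesis K_gt0 : forall j : 'I_n.+1, j != ord0 -> 0 < K j.

(** The pathwise content of the hypotheses, gathered so that all deterministic arguments are
    confined to a single almost sure event. *)
Definition good_path (w : path) :=
  [/\ forall j, w j 0 = 0,
      forall j, w j t @[t --> +oo] --> -oo,
      forall (j : 'I_n) t, 0 <= t ->
        w (snd_ix j) t = K (snd_ix j) * w (fst_ix j) t + Ups (snd_ix j) t w &
      forall l, l != ord0 -> forall s t, 0 <= s -> s <= t -> Ups l s w <= Ups l t w].

Lemma good_mono (w : path) k j : good_path w -> (k <= j)%N ->
  {homo (fun t => w j t - Kprod K k j * w k t) : s t / s <= t}.
Proof.
move=> [w0 _ wU Um] kj.
by apply: (@network_mono _ _ _ K_gt0 _ (fun l t => Ups l t w)).
Qed.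

Variable z : nat * nat.
Local Notation h := (@mesh R z).
Local Notation cK j := (Kprod K ord0 j).

Definition grid_time (w : path) (j : 'I_n.+1) : R :=
  h * (grid_argmax w j (cK j) z)%:R.

Lemma grid_time_ge0 w j : 0 <= grid_time w j.
Proof. exact: mesh_nat_ge0. Qed.

Lemma good_argmax (w : path) j : good_path w ->
  is_first_argmax (tilted w j (cK j) z) (grid_argmax w j (cK j) z).
Proof.
move=> [w0 wD _ _]; apply: is_first_argmaxP; apply: tilted_argmax_exists => //.
by rewrite ltW// Kprod_gt0.
Qed.

Lemma good_argmax_le (w : path) k j : good_path w -> (k <= j)%N ->
  (grid_argmax w k (cK k) z <= grid_argmax w j (cK j) z)%N.
Proof.
move=> gw kj; apply: (first_argmax_le (Kprod_gt0 K_gt0 k j)) (good_argmax k gw) (good_argmax j gw).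
move=> a b ab; rewrite /tilted (Kprod_mul K kj).
have hab : h * a%:R <= h * b%:R by rewrite ler_pM2l ?mesh_gt0// ler_nat.
(* The tilts cancel because K_1^j is the product of K_k^j and K_1^k. *)
have E x e C c : w j x - e * (C * c * x) - C * (w k x - e * (c * x)) = w j x - C * w k x.
  by ring.
by rewrite !E; exact: good_mono gw kj _ _ hab.
Qed.

(** The tilt penalises later epochs more, so up to the argmax the tilted comparison implies the
    untilted one. *)
Lemma good_grid_max_ge (w : path) j a : good_path w ->
  (a <= grid_argmax w j (cK j) z)%N -> w j (h * a%:R) <= w j (grid_time w j).
Proof.
move=> gw aj; have [_ /(_ a)] := good_argmax j gw; rewrite /tilted.
rewrite -/(grid_time w j).
have hab : h * a%:R <= grid_time w j by rewrite ler_pM2l ?mesh_gt0// ler_nat.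
have e0 : 0 < z.1.+1%:R^-1 :> R by rewrite invr_gt0.
have : z.1.+1%:R^-1 * (cK j * (h * a%:R)) <= z.1.+1%:R^-1 * (cK j * grid_time w j).
  by rewrite (ler_pM2l e0) ler_pM2l ?(Kprod_gt0 K_gt0).
move: (z.1.+1%:R^-1 * _) (z.1.+1%:R^-1 * _) => x y; lra.
Qed.

Lemma good_grid_ge0 (w : path) k j : good_path w -> (k <= j)%N ->
  0 <= w j (grid_time w k).
Proof.
move=> gw kj; have [w0 _ _ _] := gw.
have wk : 0 <= w k (grid_time w k).
  by have := good_grid_max_ge gw (leq0n (grid_argmax w k (cK k) z)); rewrite mulr0 w0.
have := good_mono gw kj (grid_time_ge0 w k); rewrite /= !w0 mulr0 subrr subr_ge0.
by apply: le_trans; rewrite mulr_ge0// ltW// Kprod_gt0.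
Qed.

Lemma measurable_tilted j a : measurable_fun setT (fun w : path => tilted w j (cK j) z a).
Proof. by apply: measurable_funB => //; exact: measurable_coord. Qed.

Lemma measurable_grid_argmax j i :
  measurable [set w : path | grid_argmax w j (cK j) z = i].
Proof. by apply: measurable_first_argmax => a; exact: measurable_tilted. Qed.

Lemma measurable_grid_time j : measurable_fun setT (fun w : path => grid_time w j).
Proof.
apply: (@measurable_fun_nat_index _ _ _ _ (fun i _ => h * i%:R)
  (fun w : path => grid_argmax w j (cK j) z)) => // i; exact: measurable_grid_argmax.
Qed.

Lemma measurable_grid_value i j : measurable_fun setT (fun w : path => w i (grid_time w j)).
Proof. by apply: measurable_path_at; exact: measurable_grid_time. Qed.

Section splitting_at_argmax.
Variables (k : 'I_n.+1) (a b : 'I_n.+1 -> R).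
Hypothesis X_levy : levy_process P (@coord_process R n.+1).
Hypothesis ae_good : {ae P, forall w, good_path w}.
Hypotheses (a0 : forall i, 0 <= a i) (b0 : forall i, 0 <= b i).

Definition grid_total w : R := \sum_(j < n.+1 | (k <= j)%N)
  (a j * grid_time w j + b j * w j (grid_time w j)).
Definition grid_pre w : R := \sum_(j < n.+1 | (k <= j)%N)
  (a j * grid_time w k + b j * w j (grid_time w k)).
Definition grid_post w : R := \sum_(j < n.+1 | (k <= j)%N)
  (a j * (grid_time w j - grid_time w k) +
   b j * (w j (grid_time w j) - w j (grid_time w k))).

Lemma measurable_grid_total : measurable_fun setT grid_total.
Proof.
apply: measurable_sum_cond => j _; apply: measurable_funD; apply: measurable_funM => //.
- exact: measurable_grid_time.
- exact: measurable_grid_value.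
Qed.

Lemma measurable_grid_pre : measurable_fun setT grid_pre.
Proof.
apply: measurable_sum_cond => j _; apply: measurable_funD; apply: measurable_funM => //.
- exact: measurable_grid_time.
- exact: measurable_grid_value.
Qed.

Lemma measurable_grid_post : measurable_fun setT grid_post.
Proof.
apply: measurable_sum_cond => j _; apply: measurable_funD; apply: measurable_funM => //.
- by apply: measurable_funB; exact: measurable_grid_time.
- by apply: measurable_funB; exact: measurable_grid_value.
Qed.

Lemma grid_total_ge0 w : good_path w -> 0 <= grid_total w.
Proof.
move=> gw; apply: sumr_ge0 => j _; apply: addr_ge0; apply: mulr_ge0 => //.
  exact: grid_time_ge0.
exact: good_grid_ge0.
Qed.

Lemma grid_post_ge0 w : good_path w -> 0 <= grid_post w.
Proof.
move=> gw; apply: sumr_ge0 => j kj; apply: addr_ge0; apply: mulr_ge0 => //; rewrite subr_ge0.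
  by rewrite ler_pM2l ?mesh_gt0// ler_nat good_argmax_le.
by apply: good_grid_max_ge => //; exact: good_argmax_le.
Qed.

(** Since the argmaxes of X_j with j >= k do not precede that of X_k, they can be recomputed from
    the shifted walk alone; the post-argmax exponent is thus a functional of the future. *)
Lemma grid_splitting :
  (\int[P]_w (expR (- grid_total w))%:E =
   \int[P]_w (expR (- grid_pre w))%:E * \int[P]_w (expR (- grid_post w))%:E)%E.
Proof.
pose V := (n.+1.-tuple R : measurableType _).
pose xi := increments (@coord_process R n.+1) h.
pose walk w : seqType V := fun i => xi i w.
pose u j (y : seqType V) i :=
  partial_sum y j i - z.1.+1%:R^-1 * (cK j * (h * i%:R)).
have h0 : 0 <= h by rewrite ltW// mesh_gt0.
have mxi i : measurable_fun setT (xi i) by exact: (measurable_increments X_levy h0).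
have iid : iid_seq P xi by exact: (iid_increments X_levy h0).
have mu j i : measurable_fun setT (fun y => u j y i).
  by apply: measurable_funB => //; exact: measurable_partial_sum.
have u_trunc i y e : (e <= i)%N -> u k (seq_trunc i y) e = u k y e.
  by move=> ei; rewrite /u partial_sum_trunc.
have u_shift j i y e : u j (seq_shift i y) e = u j y (i + e)%N - u j y i.
  by rewrite /u partial_sum_shift natrD; ring.
have walkE w j i : good_path w -> partial_sum (walk w) j i = w j (h * i%:R).
  by move=> [w0 _ _ _]; rewrite partial_sum_increments /coord_process w0 subr0.
have uE w j : good_path w -> u j (walk w) = tilted w j (cK j) z.
  by move=> gw; apply/funext => i; rewrite /u walkE.
pose pre i (y : seqType V) : R := \sum_(j < n.+1 | (k <= j)%N)
  (a j * (h * i%:R) + b j * partial_sum y j i).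
pose post (y : seqType V) : R := \sum_(j < n.+1 | (k <= j)%N)
  (a j * (h * (first_argmax (u j y))%:R) + b j * partial_sum y j (first_argmax (u j y))).
pose Phi i y := (expR (- pre i y))%:E.
(* [splitting] asks for a bound by 1 on all sequences, whereas [post] is nonnegative only along good
   paths. *)
pose Psi y := (expR (- Num.max 0 (post y)))%:E.
have mPhi i : measurable_fun setT (Phi i).
  apply: measurable_EFin_expR; apply: measurableT_comp => //.
  apply: measurable_sum_cond => j _; apply: measurable_funD => //.
  by apply: measurable_funM => //; exact: measurable_partial_sum.
have mPsi : measurable_fun setT Psi.
  apply: measurable_EFin_expR; apply: measurableT_comp => //.
  apply: measurable_maxr => //; apply: measurable_sum_cond => j _.
  apply: (@measurable_fun_nat_index _ _ _ _ (fun i y =>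
    a j * (h * i%:R) + b j * partial_sum y j i) (fun y => first_argmax (u j y))).
    move=> i; apply: measurable_funD => //.
    by apply: measurable_funM => //; exact: measurable_partial_sum.
  by move=> i; exact: measurable_first_argmax.
have PhiT i y : Phi i (seq_trunc i y) = Phi i y.
  rewrite /Phi /pre; congr (expR (- _))%:E; apply: eq_bigr => j _.
  by rewrite partial_sum_trunc.
have Phi0 i y : (0 <= Phi i y)%E by rewrite lee_fin expR_ge0.
have Psi0 y : (0 <= Psi y)%E by rewrite lee_fin expR_ge0.
have Psi1 y : (Psi y <= 1)%E by rewrite lee_fin expR_le1 oppr_le0 le_max lexx.
have tau_ex : {ae P, forall w, exists i, is_first_argmax (u k (walk w)) i}.
  apply: filterS ae_good => w gw; exists (grid_argmax w k (cK k) z).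
  by rewrite uE//; exact: good_argmax.
have S := splitting mxi iid (mu k) u_trunc (u_shift k) tau_ex mPhi mPsi PhiT Phi0 Psi0 Psi1.
have mwalk : measurable_fun setT walk by exact: measurable_fun_seq.
have mtau i : measurable [set w | first_argmax (u k (walk w)) = i].
  by apply: measurable_first_argmax => e; exact: measurableT_comp (mu k e) mwalk.
have mI2 : measurable_fun setT (fun w => Phi (first_argmax (u k (walk w))) (walk w)).
  apply: (@measurable_fun_nat_index _ _ _ _ (fun i w => Phi i (walk w))) => // i.
  exact: measurableT_comp (mPhi i) mwalk.
have mI3 : measurable_fun setT
    (fun w => Psi (seq_shift (first_argmax (u k (walk w))) (walk w))).
  apply: (@measurable_fun_nat_index _ _ _ _ (fun i w => Psi (seq_shift i (walk w)))) => // i.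
  apply: (measurableT_comp mPsi).
  exact: measurableT_comp (@measurable_seq_shift _ _ i) mwalk.
have prew w : good_path w -> Phi (first_argmax (u k (walk w))) (walk w) = (expR (- grid_pre w))%:E.
  move=> gw; congr (expR (- _))%:E; apply: eq_bigr => j _.
  by rewrite uE// walkE.
have postw w : good_path w ->
    Psi (seq_shift (first_argmax (u k (walk w))) (walk w)) = (expR (- grid_post w))%:E.
  move=> gw; rewrite /Psi; have -> : post (seq_shift (first_argmax (u k (walk w))) (walk w)) = grid_post w.
    apply: eq_bigr => j kj.
    have kj' := good_argmax_le gw kj.
    have -> : first_argmax (u j (seq_shift (first_argmax (u k (walk w))) (walk w))) =
        (grid_argmax w j (cK j) z - grid_argmax w k (cK k) z)%N.
      apply: first_argmaxE; rewrite [u k _]uE// -/(grid_argmax w k (cK k) z).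
      rewrite (_ : u j _ = fun e => tilted w j (cK j) z (grid_argmax w k (cK k) z + e)%N -
          tilted w j (cK j) z (grid_argmax w k (cK k) z)); last first.
        by apply/funext => e; rewrite u_shift uE.
      by apply: first_argmax_shift => //; exact: good_argmax.
    rewrite [u k _]uE// -/(grid_argmax w k (cK k) z) partial_sum_shift subnKC// !walkE//.
    by rewrite natrB// mulrBr.
  by rewrite max_r ?grid_post_ge0.
have E2 : (\int[P]_w Phi (first_argmax (u k (walk w))) (walk w) =
    \int[P]_w (expR (- grid_pre w))%:E)%E.
  apply: ae_eq_integral => //.
    by apply: measurable_EFin_expR; apply: measurableT_comp => //; exact: measurable_grid_pre.
  by apply: filterS ae_good => w gw _; exact: prew.
have E3 : (\int[P]_w Psi (seq_shift (first_argmax (u k (walk w))) (walk w)) =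
    \int[P]_w (expR (- grid_post w))%:E)%E.
  apply: ae_eq_integral => //.
    by apply: measurable_EFin_expR; apply: measurableT_comp => //; exact: measurable_grid_post.
  by apply: filterS ae_good => w gw _; exact: postw.
rewrite -E2 -E3 -S; apply: ae_eq_integral => //.
- by apply: measurable_EFin_expR; apply: measurableT_comp => //; exact: measurable_grid_total.
- exact: emeasurable_funM.
- apply: filterS ae_good => w gw _; rewrite prew// postw// -EFinM -expRD -opprD.
  rewrite /grid_pre /grid_post -big_split/=; congr (expR (- _))%:E.
  by apply: eq_bigr => j _; rewrite !mulrBr; ring.
Qed.

End splitting_at_argmax.
End grid_network.

Lemma integral_nat_index d (T : measurableType d) (R : realType) (P : probability T R)
    (F : nat -> T -> \bar R) (k : T -> nat) :
  (forall i, measurable_fun setT (F i)) -> (forall i w, (0 <= F i w)%E) ->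
  (forall i, measurable [set w | k w = i]) ->
  (\int[P]_w F (k w) w = \sum_(i <oo) \int[P]_w ((\1_[set w | k w = i] w)%:E * F i w))%E.
Proof.
move=> mF F0 mk.
have F1 i w : (0 <= (\1_[set w | k w = i] w)%:E * F i w)%E by rewrite mule_ge0// lee_fin.
rewrite -integral_nneseries//; last first.
  by move=> i; apply: emeasurable_funM => //; exact/measurable_EFinP/measurable_indic.
apply: eq_integral => w _; rewrite (@nneseriesD1 _ _ (k w))//.
rewrite eseries0 ?adde0; first by rewrite indicE mem_set// mul1e.
by move=> i _ /= iN; rewrite indicE memNset ?mul0e// => /= ki; rewrite ki eqxx in iN.
Qed.

(** * Killing: later drivers evaluated at the grid argmax *)

Section random_time.
Context {R : realType} {n : nat}.
Local Notation path := (cadlag_path R n.+1).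
Implicit Types (w : path) (j k l : 'I_n.+1).
Variables (P : probability path R) (K : 'I_n.+1 -> R) (Ups : 'I_n.+1 -> R -> path -> R).
Hypothesis K_gt0 : forall j : 'I_n.+1, j != ord0 -> 0 < K j.
Hypothesis Ups_sub : forall j : 'I_n.+1, j != ord0 -> subordinator P (Ups j).
Let Z j := if j == ord0 then coord_process ord0 else Ups j.
Hypothesis indep : mutually_independent P (fun j : 'I_n.+1 =>
  sigma_gen [set t : R | 0 <= t] (if j == ord0 then coord_process ord0 else Ups j)).
Hypothesis ae_good : {ae P, forall w, good_path K Ups w}.
Variables (z : nat * nat) (k : 'I_n.+1).
Local Notation h := (@mesh R z).
Local Notation cK j := (Kprod K ord0 j).
Local Notation jointType L := (g_sigma_algebraType (joint_events Z L)).

Lemma measurable_driver j t : 0 <= t -> measurable_fun setT (Z j t).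
Proof.
move=> t0; rewrite /Z; case: eqP => [_|/eqP j0]; first exact: measurable_coord.
by have [[mU _ _ _ _] _] := Ups_sub j0; exact: mU ord0 t t0.
Qed.

(* Almost surely equal to [w k t], but everywhere a function of the drivers
   [Z l], [l <= k]. *)
Definition driven (t : R) w : R := \sum_(l < n.+1 | (l <= k)%N) Kprod K l k * Z l t w.

Lemma drivenE t w : good_path K Ups w -> 0 <= t -> driven t w = w k t.
Proof.
move=> [w0 _ wU _] t0.
rewrite (@network_path _ _ K w (fun l t => Ups l t w) wU ord0 k t)//.
rewrite /driven (bigD1 ord0)//=; congr (_ + _); apply: eq_big => l.
  by rewrite andbC lt0n.
by move=> /andP[_ l0]; rewrite /Z (negbTE l0).
Qed.

Lemma measurable_driven L t : (k < L)%N -> 0 <= t ->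
  measurable_fun setT (driven t : jointType L -> R).
Proof.
move=> kL t0; apply: measurable_sum_cond => l lk; apply: measurable_funM => //.
by apply: measurable_joint_coord => //; exact: leq_ltn_trans kL.
Qed.

Definition driven_argmax w : nat := first_argmax (fun a =>
  driven (h * a%:R) w - z.1.+1%:R^-1 * (cK k * (h * a%:R))).

Lemma driven_argmaxE w : good_path K Ups w -> driven_argmax w = grid_argmax w k (cK k) z.
Proof.
move=> gw; rewrite /driven_argmax /grid_argmax; congr first_argmax.
by apply/funext => a; rewrite drivenE ?mesh_nat_ge0.
Qed.

Lemma measurable_driven_argmax L i : (k < L)%N ->
  measurable ([set w | driven_argmax w = i] : set (jointType L)).
Proof.
move=> kL; apply: (@measurable_first_argmax _ _ (jointType L)) => a.
by apply: measurable_funB => //; apply: measurable_driven => //; exact: mesh_nat_ge0.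
Qed.

Lemma measurable_driven_argmax_path i : measurable [set w : path | driven_argmax w = i].
Proof.
have := @measurable_driven_argmax k.+1 i (ltnSn k).
apply: smallest_sub; first exact: sigma_algebra_measurable.
by apply: joint_events_measurable => *; exact: measurable_driver.
Qed.

(** On the event that the index equals [i], the time is deterministic and the event only involves
    drivers up to [k], so [joint_laplace] applies. The map [s] also allows epochs shifted off the
    argmax, which the exclusion of jumps relies on. *)
Lemma random_time_laplace (g : nat -> path -> \bar R) (s : nat -> nat) (C : 'I_n.+1 -> R) :
  (forall i, measurable_fun setT (g i : jointType k.+1 -> \bar R)) ->
  (forall i w, (0 <= g i w)%E) -> (forall l, 0 <= C l) ->
  (\int[P]_w (g (driven_argmax w) w *
    (expR (- (\sum_(l < n.+1 | (k < l)%N) C l * Ups l (h * (s (driven_argmax w))%:R) w)))%:E) =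
   \int[P]_w (g (driven_argmax w) w *
    (expR (- (\sum_(l < n.+1 | (k < l)%N)
      laplace_exponent P (Ups l) (C l) * (h * (s (driven_argmax w))%:R))))%:E))%E.
Proof.
move=> mg g0 C0.
have mgP i : measurable_fun setT (g i) by apply: measurable_joint (mg i) => *; exact: measurable_driver.
have midx := measurable_driven_argmax_path.
have mU l i : (k < l)%N -> measurable_fun setT (fun w => Ups l (h * i%:R) w).
  move=> kl; have l0 : l != ord0 by apply/eqP => l0; rewrite l0 in kl.
  by have := @measurable_driver l (h * i%:R) (mesh_nat_ge0 z i); rewrite /Z (negbTE l0).
pose F1 i w := (g i w * (expR (- (\sum_(l < n.+1 | (k < l)%N) C l * Ups l (h * (s i)%:R) w)))%:E)%E.
pose F2 i w := (g i w * (expR (- (\sum_(l < n.+1 | (k < l)%N)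
  laplace_exponent P (Ups l) (C l) * (h * (s i)%:R))))%:E)%E.
have mF1 i : measurable_fun setT (F1 i).
  apply: emeasurable_funM; first exact: mgP.
  apply: measurable_EFin_expR.
  apply: measurableT_comp; first exact: oppr_measurable.
  apply: measurable_sum_cond => l kl.
  by apply: measurable_funM; [exact: measurable_cst|exact: mU].
have mF2 i : measurable_fun setT (F2 i).
  by apply: emeasurable_funM; [exact: mgP|exact: measurable_cst].
have F10 i w : (0 <= F1 i w)%E by rewrite mule_ge0// lee_fin expR_ge0.
have F20 i w : (0 <= F2 i w)%E by rewrite mule_ge0// lee_fin expR_ge0.
transitivity (\int[P]_w F1 (driven_argmax w) w)%E; first by [].
transitivity (\int[P]_w F2 (driven_argmax w) w)%E; last by [].
rewrite (integral_nat_index P mF1 F10 midx) (integral_nat_index P mF2 F20 midx).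
apply: eq_eseriesr => i _.
pose f w := ((\1_[set w | driven_argmax w = i] w)%:E * g i w)%E.
have mf : measurable_fun setT (f : jointType k.+1 -> \bar R).
  apply: emeasurable_funM => //; apply/measurable_EFinP; apply: measurable_indic.
  exact: measurable_driven_argmax.
have f0 w : (0 <= f w)%E by rewrite mule_ge0// lee_fin.
have Zsub l : (k.+1 <= l)%N -> subordinator P (Z l).
  move=> kl; have l0 : l != ord0 by apply/eqP => l0; rewrite l0 in kl.
  by rewrite /Z (negbTE l0); exact: Ups_sub.
have kn : (k.+1 <= n.+1 <= n.+1)%N by rewrite leqnn andbT; exact: ltn_ord.
have E := @joint_laplace _ _ _ P _ Z measurable_driver indep k.+1 n.+1 f C z.2 (s i) Zsub C0 mf f0 kn.
have ZE (x : ('I_n.+1) -> (R -> path -> R) -> R) :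
    \sum_(l < n.+1 | (k < l < n.+1)%N) x l (Z l) = \sum_(l < n.+1 | (k < l)%N) x l (Ups l).
  apply: eq_big => l; first by rewrite ltn_ord andbT.
  move=> /andP[kl _]; have l0 : (l == ord0) = false by apply/eqP => l0; rewrite l0 in kl.
  by rewrite /Z l0.
transitivity (\int[P]_w (f w * (expR (- (\sum_(l < n.+1 | (k < l < n.+1)%N) C l * Z l (h * (s i)%:R) w)))%:E))%E.
  apply: eq_integral => w _.
  by rewrite (ZE (fun l Zl => C l * Zl (h * (s i)%:R) w)) muleA.
rewrite -/(mesh z) in E; rewrite E.
apply: eq_integral => w _.
by rewrite (ZE (fun l Zl => laplace_exponent P Zl (C l) * (h * (s i)%:R))) muleA.
Qed.

End random_time.

(** * The drivers do not jump at the maximum *)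

Lemma laplace_exponent_ge0 d (T : measurableType d) (R : realType) (P : probability T R)
    (Y : R -> T -> R) (c : R) : subordinator P Y -> 0 <= c -> 0 <= laplace_exponent P Y c.
Proof.
move=> [[mY _ Y0 _ _] Ymono] c0; rewrite oppr_ge0 unlock; apply: ln_le0.
have mcY : measurable_fun setT (fun w => c * Y 1 w).
  by apply: measurable_funM => //; exact: (mY ord0).
have I1 : (\int[P]_w (expR (- (c * Y 1 w)))%:E <= 1)%E.
  apply: integral_expRN_le1 => //; apply: filterS2 Ymono Y0 => w Ym /(_ ord0) Y0w.
  by rewrite mulr_ge0// -Y0w Ym.
have I0 : (0 <= \int[P]_w (expR (- (c * Y 1 w)))%:E)%E.
  by apply: integral_ge0 => w _; rewrite lee_fin expR_ge0.
by rewrite -lee_fin fineK// ge0_fin_numE// (le_lt_trans I1)// ltry.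
Qed.

Lemma expRNB_le (R : realType) (x y : R) : 0 <= x -> x <= y -> expR (- x) <= expR (- y) + (y - x).
Proof.
move=> x0 xy.
have -> : expR (- y) = expR (- x) * expR (x - y) by rewrite -expRD addKr.
have e1 : expR (- x) <= 1 by rewrite expR_le1 oppr_le0.
have e0 : 0 <= expR (- x) by exact: expR_ge0.
have := expR_ge1Dx (x - y); nra.
Qed.

Section nojump.
Context {R : realType} {n : nat}.
Local Notation path := (cadlag_path R n.+1).
Implicit Types (w : path) (j k l : 'I_n.+1).
Variables (P : probability path R) (K : 'I_n.+1 -> R) (Ups : 'I_n.+1 -> R -> path -> R).
Hypothesis K_gt0 : forall j : 'I_n.+1, j != ord0 -> 0 < K j.
Hypothesis Ups_sub : forall j : 'I_n.+1, j != ord0 -> subordinator P (Ups j).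
Hypothesis indep : mutually_independent P (fun j : 'I_n.+1 =>
  sigma_gen [set t : R | 0 <= t] (if j == ord0 then coord_process ord0 else Ups j)).
Hypothesis ae_good : {ae P, forall w, good_path K Ups w}.

Lemma snd_ix_neq0 (j : 'I_n) : snd_ix j != ord0.
Proof. by rewrite -val_eqE. Qed.

Lemma good_attains w j : good_path K Ups w -> attains_sup w j.
Proof. by move=> [_ wD _ _]; exact: drift_bounded. Qed.

(** For [k <= j] this is theta_{j+1}(1), as the exponents at 0 vanish; the sum is the form produced
    by [random_time_laplace] with indicator weights. *)
Definition driver_rate (k : 'I_n.+1) (j : 'I_n) : R :=
  \sum_(l < n.+1 | (k < l)%N) laplace_exponent P (Ups l) (l == snd_ix j)%:R.

Lemma driver_rate_ge0 k (j : 'I_n) : 0 <= driver_rate k j.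
Proof.
apply: sumr_ge0 => l kl; apply: laplace_exponent_ge0 => //; apply: Ups_sub.
by apply/eqP => l0; rewrite l0 in kl.
Qed.

Lemma subordinator_random_time (k : 'I_n.+1) (j : 'I_n) (z : nat * nat) (s : nat -> nat) :
  (k <= j)%N ->
  (\int[P]_w (expR (- Ups (snd_ix j) (mesh z * (s (driven_argmax K Ups z k w))%:R) w))%:E =
   \int[P]_w (expR (- (driver_rate k j * (mesh z * (s (driven_argmax K Ups z k w))%:R))))%:E)%E.
Proof.
move=> kj.
have := @random_time_laplace _ _ P K Ups Ups_sub indep z k (fun _ _ => 1%E) s
  (fun l => (l == snd_ix j)%:R) (fun=> measurable_cst _) (fun _ _ => lee01) (fun=> ler0n _ _).
under eq_integral do rewrite mul1e.
under [X in _ = X -> _]eq_integral do rewrite mul1e -mulr_suml.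
move=> <-; apply: eq_integral => w _; congr (expR (- _))%:E.
rewrite (bigD1 (snd_ix j))/=; last by rewrite ltnS.
by rewrite eqxx mul1r big1 ?addr0// => l /andP[_ /negbTE ->]; rewrite mul0r.
Qed.

(** The jump at G_k of a path difference that almost surely equals the driver, measured through
    exp(-x) so as to be comparable with Laplace transforms. It is written with the path rather than
    with [Ups], so that it can be measured at the random epoch [G k w]. *)
Definition driver_jump (k : 'I_n.+1) (j : 'I_n) w : R :=
  `|expR (- (left_limit (w (snd_ix j)) (G k w) -
             K (snd_ix j) * left_limit (w (fst_ix j)) (G k w))) -
    expR (- (w (snd_ix j) (G k w) - K (snd_ix j) * w (fst_ix j) (G k w)))|.

Lemma measurable_driver_jump k (j : 'I_n) : measurable_fun setT (driver_jump k j).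
Proof.
have mG := @measurable_G R n.+1 k.
apply: measurableT_comp; first exact: normr_measurable.
apply: measurable_funB; (apply: measurableT_comp; first exact: measurable_expR);
  (apply: measurableT_comp; first exact: oppr_measurable); apply: measurable_funB.
- exact: measurable_left_limit_at.
- apply: measurable_funM; first exact: measurable_cst.
  exact: measurable_left_limit_at.
- exact: measurable_path_at.
- apply: measurable_funM; first exact: measurable_cst.
  exact: measurable_path_at.
Qed.

Lemma good_driver w (j : 'I_n) t : good_path K Ups w -> 0 <= t ->
  w (snd_ix j) t - K (snd_ix j) * w (fst_ix j) t = Ups (snd_ix j) t w.
Proof. by move=> [_ _ wU _] t0; rewrite wU// addrAC subrr add0r. Qed.

Lemma good_driver0 w (j : 'I_n) : good_path K Ups w -> Ups (snd_ix j) 0 w = 0.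
Proof. by move=> gw; rewrite -good_driver//; case: gw => w0 _ _ _; rewrite !w0 mulr0 subrr. Qed.

Lemma driver_jump_le w k (j : 'I_n) (t t' : R) : good_path K Ups w ->
  0 <= t -> 0 <= t' -> (t = 0 \/ t < G k w) -> G k w <= t' ->
  driver_jump k j w <= expR (- Ups (snd_ix j) t w) - expR (- Ups (snd_ix j) t' w).
Proof.
move=> gw t0 t'0 tG Gt'; have [w0 _ _ Um] := gw.
pose v s := w (snd_ix j) s - K (snd_ix j) * w (fst_ix j) s.
pose vL := left_limit (w (snd_ix j)) (G k w) - K (snd_ix j) * left_limit (w (fst_ix j)) (G k w).
have G0 : 0 <= G k w := @G_ge0 _ _ k w.
have vmono : {homo v : s t / s <= t}.
  have kj : (fst_ix j <= snd_ix j)%N by rewrite /= /bump leq0n.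
  have := good_mono K_gt0 gw kj.
  by rewrite KprodS ?leqnn// Kprod_id mulr1.
have vLcvg : v s @[s --> (G k w)^'-] --> vL.
  apply: cvgB; first exact: left_limit_cvg.
  by apply: cvgM; [exact: cvg_cst|exact: left_limit_cvg].
have vLG : vL <= v (G k w).
  apply: cvgr_to_le vLcvg _; near=> s; apply: vmono.
  by near: s; exact: nbhs_left_le.
have tvL : v t <= vL.
  have vlow s : s < G k w -> v s <= vL.
    move=> sG; apply: cvgr_to_ge vLcvg _; near=> x; apply: vmono.
    by near: x; exact: nbhs_left_ge.
  (* For [t = 0] the epoch [G k w] may be 0 too; there both the value and the left limit vanish. *)
  case: tG => [->|]; last exact: vlow.
  have [Gp|Gn] := ltP 0 (G k w); first exact: vlow.
  by rewrite /vL !left_limit_le0// mulr0 subrr /v !w0 mulr0 subrr.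
have Gt : v (G k w) <= v t' by exact: vmono.
rewrite -!good_driver// -/(v t) -/(v t') /driver_jump -/(v (G k w)) -/vL.
rewrite ger0_norm ?subr_ge0 ?ler_expR ?lerN2//.
by rewrite lerB// ler_expR lerN2.
Unshelve. all: by end_near. Qed.

(** Off an event of probability below [e], G_k lies between the epochs [r] grid steps before and
    after the grid argmax. The expected jump is then bounded by a difference of two Laplace
    transforms, which killing turns into exponentials at epochs at most [e *+ 4] apart. *)
Lemma driver_jump_small k (j : 'I_n) (e : R) : (k <= j)%N -> 0 < e ->
  (\int[P]_w (driver_jump k j w)%:E <= (driver_rate k j * (e *+ 4) + e)%:E)%E.
Proof.
move=> kj e0; set Theta := driver_rate k j.
have Theta0 : 0 <= Theta by exact: driver_rate_ge0.
have tau_cvg : {ae P, forall w, grid_time K z w k @[z --> iterated_oo] --> G k w}.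
  apply: filterS ae_good => w [w0 wD _ _]; apply: cvg_grid_argmax => //.
  exact: Kprod_gt0.
have := @iterated_cvg_in_measure _ _ _ P (fun z w => grid_time K z w k) (fun w => G k w)
  (fun z => measurable_grid_time K z k) (@measurable_G _ _ k) e e0 tau_cvg.
move=> [p _ /(_ p (leqnn p))[M _ HM]].
have [N HN] := inv_nat_lt e0.
pose m := maxn M N.
have {HM} Pdev := HM m (leq_maxl M N).
have {HN} := HN m (leq_maxr M N).
pose z := (p, m); rewrite -/(mesh z) => he.
set h := mesh z in he.
have h0 : 0 < h by exact: mesh_gt0.
(* With [h < e], this number of steps spans more than [e], the distance from the argmax to G_k, and
   at most [e *+ 2]. *)
pose r := (Num.truncn (e / h)).+1.
have [re re2] : e < h * r%:R /\ h * r%:R <= e *+ 2.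
  have /andP[h1 h2] := truncn_itv (divr_ge0 (ltW e0) (ltW h0)).
  rewrite mulrC -ltr_pdivrMr//; split => //.
  have : (Num.truncn (e / h))%:R * h <= e by rewrite -ler_pdivlMr.
  by rewrite /r -natr1 mulrDl mul1r; lra.
set idx := driven_argmax K Ups z k.
pose dev := [set w : path | e < `|grid_time K z w k - G k w|].
have mdev : measurable dev.
  apply: measurable_set_lt => //; apply: measurableT_comp => //.
  by apply: measurable_funB; [exact: measurable_grid_time|exact: measurable_G].
have midx i : measurable [set w | idx w = i].
  by apply: (@measurable_driven_argmax_path _ _ P) => //; exact: Ups_sub.
have mU i : measurable_fun setT (fun w => Ups (snd_ix j) (h * i%:R) w).
  have [[mU _ _ _ _] _] := Ups_sub (snd_ix_neq0 j).
  by apply: (mU ord0); exact: mesh_nat_ge0.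
have mUr (s : nat -> nat) : measurable_fun setT
    (fun w => (expR (- Ups (snd_ix j) (h * (s (idx w))%:R) w))%:E).
  apply: measurable_EFin_expR; apply: measurableT_comp; first exact: oppr_measurable.
  by apply: (@measurable_fun_nat_index _ _ _ _ (fun i w => Ups (snd_ix j) (h * (s i)%:R) w) idx).
pose I2 := (\int[P]_w (expR (- Ups (snd_ix j) (h * (idx w + r)%:R) w))%:E)%E.
have mTr (s : nat -> nat) : measurable_fun setT
    (fun w => (expR (- (Theta * (h * (s (idx w))%:R))))%:E).
  by apply: (@measurable_fun_nat_index _ _ _ _ (fun i w => (expR (- (Theta * (h * (s i)%:R))))%:E) idx).
have H1 : (\int[P]_w (driver_jump k j w)%:E + I2 <=
    \int[P]_w (expR (- Ups (snd_ix j) (h * (idx w - r)%:R) w))%:E + P dev)%E.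
  have <- : (\int[P]_w (\1_dev w)%:E = P dev)%E by rewrite integral_indic// setIT.
  have mJ : measurable_fun setT (fun w => (driver_jump k j w)%:E).
    by apply/measurable_EFinP; exact: measurable_driver_jump.
  have mD : measurable_fun setT (fun w => (\1_dev w : R)%:E).
    exact/measurable_EFinP/measurable_indic.
  have mA := mUr (addn^~ r); have mS := mUr (subn^~ r).
  have J0 w : [set: path] w -> (0 <= (driver_jump k j w)%:E)%E by rewrite lee_fin normr_ge0.
  have D0 w : [set: path] w -> (0 <= (\1_dev w : R)%:E)%E by rewrite lee_fin.
  have A0 (s : nat -> nat) w : [set: path] w ->
      (0 <= (expR (- Ups (snd_ix j) (h * (s (idx w))%:R) w))%:E)%E by rewrite lee_fin expR_ge0.
  rewrite -(ge0_integralD P measurableT J0 mJ (A0 (addn^~ r)) mA).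
  rewrite -(ge0_integralD P measurableT (A0 (subn^~ r)) mS D0 mD).
  apply: ae_ge0_le_integral => //.
  - by move=> w _; rewrite adde_ge0// ?J0// (A0 (addn^~ r)).
  - by apply: emeasurable_funD; [exact: mJ|exact: mA].
  - by move=> w _; rewrite adde_ge0// ?D0// (A0 (subn^~ r)).
  - by apply: emeasurable_funD; [exact: mS|exact: mD].
  - apply: filterS ae_good => w gw _; rewrite -!EFinD lee_fin indicE.
    have idxE : h * (idx w)%:R = grid_time K z w k by rewrite /idx driven_argmaxE.
    have tr : h * (idx w + r)%:R = grid_time K z w k + h * r%:R by rewrite natrD mulrDr idxE.
    have [wdev|wdev] := boolP (w \in dev).
      have J1 : driver_jump k j w <= 1.
        have := @driver_jump_le w k j 0 (G k w) gw (lexx _) (G_ge0 _ _) (or_introl erefl) (lexx _).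
        rewrite good_driver0// oppr0 expR0.
        by have := expR_ge0 (- Ups (snd_ix j) (G k w) w); lra.
      have [_ _ _ Um] := gw; have := Um _ (snd_ix_neq0 j) (h * (idx w - r)%:R) (h * (idx w + r)%:R).
      move=> /(_ (mesh_nat_ge0 _ _)) Ule.
      have : expR (- Ups (snd_ix j) (h * (idx w + r)%:R) w) <=
          expR (- Ups (snd_ix j) (h * (idx w - r)%:R) w).
        rewrite ler_expR lerN2; apply: Ule; rewrite ler_pM2l// ler_nat.
        by rewrite (leq_trans (leq_subr _ _))// leq_addr.
      by rewrite mulr1n; move: J1; lra.
    have tauG : `|grid_time K z w k - G k w| <= e.
      by rewrite leNgt; apply/negP => h'; move/negP: wdev; apply; rewrite inE.
    move: tauG; rewrite ler_distl => /andP[tauG1 tauG2].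
    rewrite mulr0n addr0 -lerBrDr; apply: (driver_jump_le j gw); [exact: mesh_nat_ge0|exact: mesh_nat_ge0| |].
      have [ri|ir] := leqP r (idx w); [right|left].
        by rewrite natrB// mulrBr idxE; lra.
      by move: (ltnW ir); rewrite -subn_eq0 => /eqP ->; rewrite mulr0.
    by rewrite tr; lra.
have E2 : I2 = (\int[P]_w (expR (- (Theta * (h * (idx w + r)%:R))))%:E)%E.
  exact: (@subordinator_random_time k j z (addn^~ r) kj).
have I2fin : I2 \is a fin_num.
  rewrite E2 ge0_fin_numE; last by apply: integral_ge0 => w _; rewrite lee_fin expR_ge0.
  rewrite (@le_lt_trans _ _ 1%E) ?ltry//; apply: integral_expRN_le1.
    by apply: (@measurable_fun_nat_index _ _ _ _ (fun i w => Theta * (h * (i + r)%:R)) idx).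
  by apply: nearW => w; rewrite mulr_ge0// mesh_nat_ge0.
have H2 : (\int[P]_w (expR (- Ups (snd_ix j) (h * (idx w - r)%:R) w))%:E <=
    I2 + (Theta * (e *+ 4))%:E)%E.
  rewrite (@subordinator_random_time k j z (subn^~ r) kj) E2.
  apply: (@le_trans _ _ (\int[P]_w ((expR (- (Theta * (h * (idx w + r)%:R))))%:E +
      cst (Theta * (e *+ 4))%:E w))%E).
    apply: ge0_le_integral => //.
    - exact: (mTr (subn^~ r)).
    - by apply: emeasurable_funD; [exact: (mTr (addn^~ r))|exact: measurable_cst].
    - move=> w _; rewrite -EFinD lee_fin.
      have hle : h * (idx w - r)%:R <= h * (idx w + r)%:R.
        by rewrite ler_pM2l// ler_nat (leq_trans (leq_subr _ _))// leq_addr.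
      apply: (le_trans (expRNB_le _ (ler_wpM2l Theta0 hle))).
        by rewrite mulr_ge0// mesh_nat_ge0.
      rewrite lerD2l -mulrBr ler_wpM2l//.
      have : h * (idx w + r)%:R <= h * (idx w - r)%:R + (h * r%:R + h * r%:R).
        rewrite -mulrDr -mulrDr ler_pM2l// -!natrD ler_nat addnA.
        by rewrite leq_add2r addnC -leq_subLR.
      by move: re2; rewrite -mulr_natr => re2; rewrite -[e *+ 4]mulr_natr; lra.
  rewrite ge0_integralD//.
  - rewrite integral_cst//; apply: leeD => //.
    rewrite -[leRHS]mule1; apply: lee_wpmul2l; last exact: probability_le1.
    by rewrite lee_fin mulr_ge0// mulrn_wge0// ltW.
  - exact: (mTr (addn^~ r)).
  - by move=> w _; rewrite lee_fin mulr_ge0// mulrn_wge0// ltW.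
rewrite -(leeD2rE _ _ I2fin); apply: (le_trans H1).
apply: (le_trans (leeD H2 (ltW Pdev))).
by rewrite -addeA -EFinD addeC.
Qed.

Lemma ae_no_jump k (j : 'I_n) : (k <= j)%N ->
  {ae P, forall w, left_limit (w (snd_ix j)) (G k w) -
      K (snd_ix j) * left_limit (w (fst_ix j)) (G k w) =
    w (snd_ix j) (G k w) - K (snd_ix j) * w (fst_ix j) (G k w)}.
Proof.
move=> kj.
have mJ : measurable_fun setT (fun w => (driver_jump k j w)%:E).
  by apply/measurable_EFinP; exact: measurable_driver_jump.
have J0 : (\int[P]_w `|(driver_jump k j w)%:E| = 0)%E.
  have Jge0 w : (0 <= (driver_jump k j w)%:E)%E by rewrite lee_fin normr_ge0.
  under eq_integral do rewrite gee0_abs//.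
  apply/eqP; rewrite eq_le integral_ge0 ?andbT//.
  apply/lee_addgt0Pr => e e0; rewrite add0e.
  set Theta := driver_rate k j.
  have Theta0 : 0 <= Theta by exact: driver_rate_ge0.
  have t0 : 0 < Theta * 4 + 1 by rewrite ltr_wpDl// mulr_ge0.
  (* With this argument the bound of [driver_jump_small] equals [e]. *)
  have e'0 : 0 < e / (Theta * 4 + 1) by rewrite divr_gt0.
  apply: (le_trans (driver_jump_small kj e'0)); rewrite lee_fin.
  have xE : e / (Theta * 4 + 1) * (Theta * 4 + 1) = e by rewrite divfK// gt_eqF.
  move: xE; move: (e / _) => x xE.
  have -> : Theta * (x *+ 4) + x = x * (Theta * 4 + 1) by ring.
  by rewrite xE lexx.
have /(ae_eq_integral_abs P measurableT mJ) := J0.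
apply: filterS => w /(_ Logic.I) /= [] /eqP; rewrite normr_eq0 subr_eq0 => /eqP/expR_inj.
by move/oppr_inj.
Qed.

End nojump.

(** * Splitting in continuous time *)

Section decomposition.
Context {R : realType} {n : nat}.
Local Notation path := (cadlag_path R n.+1).
Implicit Types (w : path) (j k l : 'I_n.+1).
Variables (P : probability path R) (K : 'I_n.+1 -> R) (Ups : 'I_n.+1 -> R -> path -> R).
Hypothesis X_levy : levy_process P (@coord_process R n.+1).
Hypothesis K_gt0 : forall j : 'I_n.+1, j != ord0 -> 0 < K j.
Hypothesis Ups_sub : forall j : 'I_n.+1, j != ord0 -> subordinator P (Ups j).
Hypothesis indep : mutually_independent P (fun j : 'I_n.+1 =>
  sigma_gen [set t : R | 0 <= t] (if j == ord0 then coord_process ord0 else Ups j)).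
Hypothesis ae_good : {ae P, forall w, good_path K Ups w}.
Variables (k : 'I_n.+1) (a b : 'I_n.+1 -> R).
Hypotheses (a0 : forall i, 0 <= a i) (b0 : forall i, 0 <= b i).

Definition load (l : 'I_n.+1) : R := \sum_(i < n.+1 | (l <= i)%N) Kprod K l i * b i.

(** Until G_k all clocks G_j with j >= k run, which gives the first sum; the second is what
    integrating out the drivers after [k] leaves. *)
Definition kill_rate : R := \sum_(j < n.+1 | (k <= j)%N) a j +
  \sum_(l < n.+1 | (k < l)%N) laplace_exponent P (Ups l) (load l).

Definition total_exponent w : R :=
  \sum_(j < n.+1 | (k <= j)%N) (a j * G j w + b j * Xbar j w).
Definition killed_exponent w : R := kill_rate * G k w + load k * Xbar k w.
Definition post_exponent w : R := \sum_(j < n.+1 | (k <= j)%N)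
  (a j * (G j w - G k w) + b j * (Xbar j w - X_at_max k w j)).

Definition grid_kill z w : R :=
  kill_rate * grid_time K z w k + load k * w k (grid_time K z w k).

Lemma load_ge0 l : 0 <= load l.
Proof. by apply: sumr_ge0 => i _; rewrite mulr_ge0// ltW// Kprod_gt0. Qed.

Lemma kill_rate_ge0 : 0 <= kill_rate.
Proof.
apply: addr_ge0; apply: sumr_ge0 => // l kl.
apply: laplace_exponent_ge0; last exact: load_ge0.
by apply: Ups_sub; apply/eqP => l0; rewrite l0 in kl.
Qed.

Lemma measurable_total_exponent : measurable_fun setT total_exponent.
Proof.
apply: measurable_sum_cond => j _; apply: measurable_funD; apply: measurable_funM => //.
- exact: measurable_G.
- exact: measurable_Xbar.
Qed.

Lemma measurable_killed_exponent : measurable_fun setT killed_exponent.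
Proof.
apply: measurable_funD; apply: measurable_funM => //.
- exact: measurable_G.
- exact: measurable_Xbar.
Qed.

Lemma measurable_post_exponent : measurable_fun setT post_exponent.
Proof.
apply: measurable_sum_cond => j _; apply: measurable_funD; apply: measurable_funM => //;
  apply: measurable_funB.
- exact: measurable_G.
- exact: measurable_G.
- exact: measurable_Xbar.
- exact: measurable_X_at_max.
Qed.

Lemma measurable_grid_kill z : measurable_fun setT (grid_kill z).
Proof.
apply: measurable_funD; apply: measurable_funM => //.
- exact: measurable_grid_time.
- exact: measurable_grid_value.
Qed.

(** [network_sum] writes the positions of all X_j at the argmax of X_k in terms of X_k and the later
    drivers; the latter are independent of that argmax and turn into killing. *)
Lemma grid_pre_kill z :
  (\int[P]_w (expR (- grid_pre K z k a b w))%:E = \int[P]_w (expR (- grid_kill z w))%:E)%E.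
Proof.
pose A := \sum_(j < n.+1 | (k <= j)%N) a j.
pose g i w := (expR (- (A * (mesh z * i%:R) + load k * driven K Ups k (mesh z * i%:R) w)))%:E.
pose idx := driven_argmax K Ups z k.
have mg i : measurable_fun setT (g i : g_sigma_algebraType
    (joint_events (fun j => if j == ord0 then coord_process ord0 else Ups j) k.+1) -> \bar R).
  apply: measurable_EFin_expR; apply: measurableT_comp; first exact: oppr_measurable.
  apply: measurable_funD; first exact: measurable_cst.
  apply: measurable_funM; first exact: measurable_cst.
  by apply: measurable_driven => //; exact: mesh_nat_ge0.
have g0 i w : (0 <= g i w)%E by rewrite lee_fin expR_ge0.
have E := @random_time_laplace _ _ P K Ups Ups_sub indep z k g id load mg g0 load_ge0.
have mZ (j : 'I_n.+1) (t : R) : 0 <= t ->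
    measurable_fun setT ((if j == ord0 then coord_process ord0 else Ups j) t).
  by move=> t0; exact: (measurable_driver Ups_sub j t0).
have mgP i : measurable_fun setT (g i) by exact: (measurable_joint mZ (mg i)).
have midx i : measurable [set w | idx w = i].
  by apply: (@measurable_driven_argmax_path _ _ P) => //; exact: Ups_sub.
have mU l i : (k < l)%N -> measurable_fun setT (fun w => Ups l (mesh z * i%:R) w).
  move=> kl; have l0 : l != ord0 by apply/eqP => l0; rewrite l0 in kl.
  by have [[mU _ _ _ _] _] := Ups_sub l0; apply: (mU ord0); exact: mesh_nat_ge0.
pose F1 i w := (g i w * (expR (- (\sum_(l < n.+1 | (k < l)%N) load l * Ups l (mesh z * i%:R) w)))%:E)%E.
pose F2 i w := (g i w * (expR (- (\sum_(l < n.+1 | (k < l)%N)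
  laplace_exponent P (Ups l) (load l) * (mesh z * i%:R))))%:E)%E.
have mF1 : measurable_fun setT (fun w => F1 (idx w) w).
  apply: measurable_fun_nat_index => // i; apply: emeasurable_funM; first exact: mgP.
  apply: measurable_EFin_expR; apply: measurableT_comp; first exact: oppr_measurable.
  apply: measurable_sum_cond => l kl.
  by apply: measurable_funM; [exact: measurable_cst|exact: mU].
have mF2 : measurable_fun setT (fun w => F2 (idx w) w).
  apply: measurable_fun_nat_index => // i; apply: emeasurable_funM; first exact: mgP.
  exact: measurable_cst.
have idxE w : good_path K Ups w -> mesh z * (idx w)%:R = grid_time K z w k.
  by move=> gw; rewrite /idx driven_argmaxE.
have gE w : good_path K Ups w -> g (idx w) w =
    (expR (- (A * grid_time K z w k + load k * w k (grid_time K z w k))))%:E.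
  by move=> gw; rewrite /g idxE// drivenE// grid_time_ge0.
transitivity (\int[P]_w F1 (idx w) w)%E.
  apply: ae_eq_integral => //.
    by apply: measurable_EFin_expR; apply: measurableT_comp => //; exact: measurable_grid_pre.
  apply: filterS ae_good => w gw _; rewrite /F1 gE// idxE// -EFinM -expRD.
  have [_ _ wU _] := gw.
  rewrite /grid_pre big_split/= -mulr_suml.
  rewrite (@network_sum _ _ K w (fun l t => Ups l t w) wU k b _ (grid_time_ge0 _ _ _ _)).
  by rewrite -opprD addrA.
transitivity (\int[P]_w F2 (idx w) w)%E; first exact: E.
apply: ae_eq_integral => //.
  apply: measurable_EFin_expR; apply: measurableT_comp; first exact: oppr_measurable.
  exact: measurable_grid_kill.
apply: filterS ae_good => w gw _; rewrite /F2 gE// idxE// -EFinM -expRD -opprD.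
by rewrite /grid_kill /kill_rate -mulr_suml; congr (expR (- _))%:E; rewrite -/A; ring.
Qed.

(** X_k at the grid argmax tends to its maximum from whichever side G_k is approached, and the
    difference [S] is continuous at G_k; their combination therefore has the limit selected by
    [X_at_max]. *)
Lemma cvg_grid_value w j : (k <= j)%N -> good_path K Ups w ->
  left_limit (w j) (G k w) - Kprod K k j * left_limit (w k) (G k w) =
    w j (G k w) - Kprod K k j * w k (G k w) ->
  w j (grid_time K z w k) @[z --> iterated_oo] --> X_at_max k w j.
Proof.
move=> kj gw nojump; have [w0 wD _ _] := gw.
have c0 : 0 < Kprod K ord0 k by exact: Kprod_gt0.
have wk : attains_sup w k by exact: good_attains gw.
pose S s := w j s - Kprod K k j * w k s.
have cvgS : S s @[s --> G k w] --> S (G k w).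
  apply/left_right_continuousP; split.
    rewrite [X in _ --> X](_ : _ =
      left_limit (w j) (G k w) - Kprod K k j * left_limit (w k) (G k w))//.
    apply: cvgB; first exact: left_limit_cvg.
    by apply: cvgM; [exact: cvg_cst|exact: left_limit_cvg].
  have G0 : 0 <= G k w by exact: G_ge0.
  apply: cvgB; first exact: (path_cadlag w j).1.
  by apply: cvgM; [exact: cvg_cst|exact: (path_cadlag w k).1].
rewrite (X_at_max_nojump nojump) X_at_max_self//.
have -> : (fun z => w j (grid_time K z w k)) =
    (fun z => Kprod K k j * w k (grid_time K z w k) + S (grid_time K z w k)).
  by apply/funext => z; rewrite /S addrC subrK.
apply: cvgD.
  by apply: cvgM; [exact: cvg_cst|exact: cvg_grid_max].
exact: (cvg_comp _ _ (cvg_grid_argmax c0 (w0 k) (wD k)) cvgS).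
Qed.

End decomposition.

Section quasi_product.
Context {R : realType} {n : nat}.
Local Notation path := (cadlag_path R n.+1).
Implicit Types (w : path) (j k l : 'I_n.+1) (a b : 'I_n.+1 -> R).
Variables (P : probability path R) (K : 'I_n.+1 -> R) (Ups : 'I_n.+1 -> R -> path -> R).
Hypothesis X_levy : levy_process P (@coord_process R n.+1).
Hypothesis K_gt0 : forall j : 'I_n.+1, j != ord0 -> 0 < K j.
Hypothesis Ups_sub : forall j : 'I_n.+1, j != ord0 -> subordinator P (Ups j).
Hypothesis indep : mutually_independent P (fun j : 'I_n.+1 =>
  sigma_gen [set t : R | 0 <= t] (if j == ord0 then coord_process ord0 else Ups j)).
Hypothesis ae_good : {ae P, forall w, good_path K Ups w}.

(** Consecutive differences do not jump at G_k, and X_j - K_k^j X_k is a positive combination of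
    them. *)
Lemma ae_no_jump_Kprod k : {ae P, forall w, forall j, (k <= j)%N ->
  left_limit (w j) (G k w) - Kprod K k j * left_limit (w k) (G k w) =
  w j (G k w) - Kprod K k j * w k (G k w)}.
Proof.
have : {ae P, forall w, forall j : 'I_n, (k <= j)%N ->
    left_limit (w (snd_ix j)) (G k w) - K (snd_ix j) * left_limit (w (fst_ix j)) (G k w) =
    w (snd_ix j) (G k w) - K (snd_ix j) * w (fst_ix j) (G k w)}.
  apply: filter_forall => j; have [kj|kj] := boolP (k <= j)%N; last exact: nearW.
  by apply: filterS (ae_no_jump K_gt0 Ups_sub indep ae_good kj).
apply: filterS => w Hw; apply: ordS_ind; first by rewrite Kprod_id !mul1r !subrr.
by move=> j kj IH; have := Hw j kj; rewrite !KprodS//; move: IH; nra.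
Qed.

Lemma expectation_expRN01 (f : path -> R) : measurable_fun setT f ->
  {ae P, forall w, 0 <= f w} ->
  (\int[P]_w (expR (- f w))%:E)%E = (fine 'E_P[fun w => expR (- f w)])%:E.
Proof.
move=> mf f0; rewrite unlock fineK// ge0_fin_numE; last first.
  by apply: integral_ge0 => w _; rewrite lee_fin expR_ge0.
by rewrite (le_lt_trans (integral_expRN_le1 mf f0))// ltry.
Qed.

Section at_k.
Variables (k : 'I_n.+1) (a b : 'I_n.+1 -> R).
Hypotheses (a0 : forall i, 0 <= a i) (b0 : forall i, 0 <= b i).

(** The grid identity in the iterated limit. Only the post-maximum factor involves other coordinates
    at the argmax of X_k, so it alone calls for the absence of jumps. *)
Lemma expectation_split :
  fine 'E_P[fun w => expR (- total_exponent k a b w)] =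
  fine 'E_P[fun w => expR (- killed_exponent P K Ups k a b w)] *
  fine 'E_P[fun w => expR (- post_exponent k a b w)].
Proof.
have cexp (f : nat * nat -> R) (x : R) : f z @[z --> iterated_oo] --> x ->
    expR (- f z) @[z --> iterated_oo] --> expR (- x).
  by move=> fl; apply: continuous_cvg; [exact: continuous_expR|exact: cvgN].
have c0 j : 0 < Kprod K ord0 j by exact: Kprod_gt0.
have cvgG w j : good_path K Ups w -> grid_time K z w j @[z --> iterated_oo] --> G j w.
  by move=> [w0 wD _ _]; exact: cvg_grid_argmax.
have cvgX w j : good_path K Ups w ->
    w j (grid_time K z w j) @[z --> iterated_oo] --> Xbar j w.
  by move=> [w0 wD _ _]; exact: cvg_grid_max.
have cvgM_ (c : R) (f : nat * nat -> R) (x : R) : f z @[z --> iterated_oo] --> x ->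
    c * f z @[z --> iterated_oo] --> c * x.
  by move=> fl; apply: cvgM => //; exact: cvg_cst.
have mexp (f : path -> R) : measurable_fun setT f -> measurable_fun setT (fun w => expR (- f w)).
  move=> mf; apply: measurableT_comp; first exact: measurable_expR.
  exact: measurableT_comp.
have exp01 (f : R) : 0 <= f -> 0 <= expR (- f) <= 1.
  by move=> f0; rewrite expR_ge0 expR_le1 oppr_le0.
have grid_kill_ge0 w z : good_path K Ups w -> 0 <= grid_kill P K Ups k a b z w.
  move=> gw; apply: addr_ge0; apply: mulr_ge0.
  - exact: kill_rate_ge0.
  - exact: grid_time_ge0.
  - exact: load_ge0.
  - exact: good_grid_ge0 gw _.
have Ltotal : fine 'E_P[fun w => expR (- grid_total K z k a b w)] @[z --> iterated_oo] -->
    fine 'E_P[fun w => expR (- total_exponent k a b w)].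
  apply: (@ae_iterated_dominated_cvg _ _ _ P (fun z w => expR (- grid_total K z k a b w))).
  - by move=> z; apply: mexp; exact: measurable_grid_total.
  - by apply: mexp; exact: measurable_total_exponent.
  - by apply: filterS ae_good => w gw z; apply: exp01; exact: grid_total_ge0 gw.
  - apply: filterS ae_good => w gw; apply: cexp; apply: cvg_big => [|j _]; first exact: add_continuous.
    by apply: cvgD; apply: cvgM_; [exact: cvgG|exact: cvgX].
have Lpost : fine 'E_P[fun w => expR (- grid_post K z k a b w)] @[z --> iterated_oo] -->
    fine 'E_P[fun w => expR (- post_exponent k a b w)].
  apply: (@ae_iterated_dominated_cvg _ _ _ P (fun z w => expR (- grid_post K z k a b w))).
  - by move=> z; apply: mexp; exact: measurable_grid_post.
  - by apply: mexp; exact: measurable_post_exponent.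
  - by apply: filterS ae_good => w gw z; apply: exp01; exact: grid_post_ge0 gw.
  - apply: filterS2 ae_good (ae_no_jump_Kprod k) => w gw nj; apply: cexp; apply: cvg_big => [|j kj]; first exact: add_continuous.
    apply: cvgD; apply: cvgM_; apply: cvgB; [exact: cvgG|exact: cvgG|exact: cvgX|].
    by apply: (cvg_grid_value K_gt0 kj gw); exact: nj.
have Lkill : fine 'E_P[fun w => expR (- grid_kill P K Ups k a b z w)] @[z --> iterated_oo] -->
    fine 'E_P[fun w => expR (- killed_exponent P K Ups k a b w)].
  apply: (@ae_iterated_dominated_cvg _ _ _ P (fun z w => expR (- grid_kill P K Ups k a b z w))).
  - by move=> z; apply: mexp; exact: measurable_grid_kill.
  - by apply: mexp; exact: measurable_killed_exponent.
  - by apply: filterS ae_good => w gw z; apply: exp01; exact: grid_kill_ge0 gw.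
  - by apply: filterS ae_good => w gw; apply: cexp; apply: cvgD; apply: cvgM_; [exact: cvgG|exact: cvgX].
have split_z z : fine 'E_P[fun w => expR (- grid_total K z k a b w)] =
    fine 'E_P[fun w => expR (- grid_kill P K Ups k a b z w)] *
    fine 'E_P[fun w => expR (- grid_post K z k a b w)].
  have S := grid_splitting K_gt0 z k X_levy ae_good a0 b0.
  rewrite (grid_pre_kill K_gt0 Ups_sub indep ae_good k a b0 z) in S.
  apply: EFin_inj; rewrite EFinM.
  rewrite -(expectation_expRN01 (f := grid_total K z k a b)); last 2 first.
  - exact: measurable_grid_total.
  - by apply: filterS ae_good => w gw; exact: grid_total_ge0 gw.
  rewrite -(expectation_expRN01 (f := grid_post K z k a b)); last 2 first.
  - exact: measurable_grid_post.
  - by apply: filterS ae_good => w gw; exact: grid_post_ge0 gw.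
  rewrite -(expectation_expRN01 (f := grid_kill P K Ups k a b z)); last 2 first.
  - exact: measurable_grid_kill.
  - by apply: filterS ae_good => w gw; exact: grid_kill_ge0 gw.
  exact: S.
have := cvgM Lkill Lpost.
rewrite (_ : _ \* _ = fun z => fine 'E_P[fun w => expR (- grid_total K z k a b w)]).
  by move=> L2; exact: (cvg_unique (@Rhausdorff R) Ltotal (L2 _)).
by apply/funext => z; rewrite split_z.
Qed.


End at_k.
End quasi_product.

(** * Recursion over the coordinates *)

Section recursion.
Context {R : realType} {n : nat}.
Local Notation path := (cadlag_path R n.+1).
Implicit Types (w : path) (k l : 'I_n.+1) (a b : 'I_n.+1 -> R).
Variables (P : probability path R) (K : 'I_n.+1 -> R) (Ups : 'I_n.+1 -> R -> path -> R).
Hypothesis X_levy : levy_process P (@coord_process R n.+1).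
Hypothesis K_gt0 : forall j : 'I_n.+1, j != ord0 -> 0 < K j.
Hypothesis Ups_sub : forall j : 'I_n.+1, j != ord0 -> subordinator P (Ups j).
Hypothesis indep : mutually_independent P (fun j : 'I_n.+1 =>
  sigma_gen [set t : R | 0 <= t] (if j == ord0 then coord_process ord0 else Ups j)).
Hypothesis ae_good : {ae P, forall w, good_path K Ups w}.
Variables (a b : 'I_n.+1 -> R).
Hypotheses (a0 : forall i, 0 <= a i) (b0 : forall i, 0 <= b i).

(** For j >= k the maximum and its epoch are those of the whole path, shifted; for j < k they
    vanish, since X_j never rises above its level at G_k. *)
Lemma down_law_integral k :
  (\int[down_law P k]_w
     (expR (- (\sum_(i < n.+1) a i * G i w) - (\sum_(i < n.+1) b i * Xbar i w)))%:E =
   (fine 'E_P[fun w => expR (- post_exponent k a b w)])%:E)%E.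
Proof.
pose H w := \sum_(i < n.+1) a i * G i w + \sum_(i < n.+1) b i * Xbar i w.
have mH : measurable_fun setT H.
  by apply: measurable_funD; apply: measurable_sum_cond => j _; apply: measurable_funM => //;
    [exact: measurable_G|exact: measurable_Xbar].
have mE : measurable_fun setT (fun w => (expR (- H w))%:E).
  by apply: measurable_EFin_expR; exact: measurableT_comp.
have mpost := @measurable_post_max R n.+1 k.
have postE w : good_path K Ups w -> H (post_max k w) = post_exponent k a b w.
  move=> gw; rewrite /H -big_split/= /post_exponent [RHS]big_mkcond/=.
  apply: eq_bigr => j _; case: ifPn => [kj|].
    have mono := good_mono K_gt0 gw kj; have C0 := Kprod_gt0 K_gt0 k j.
    by rewrite (post_max_Xbar C0) ?(post_max_G C0)//; exact: good_attains gw.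
  rewrite -ltnNge => jk.
  have mono := good_mono K_gt0 gw (ltnW jk); have C0 := Kprod_gt0 K_gt0 j k.
  rewrite (post_max_Xbar0 C0) ?(post_max_G0 C0) ?mulr0 ?addr0//; exact: good_attains gw.
have post0 : {ae P, forall w, 0 <= post_exponent k a b w}.
  apply: filterS ae_good => w gw; rewrite -postE//; apply: addr_ge0; apply: sumr_ge0 => j _.
    by rewrite mulr_ge0// G_ge0.
  by rewrite mulr_ge0// Xbar_ge0.
have mP := measurable_post_exponent k a b.
rewrite -expectation_expRN01//.
transitivity (\int[pushforward P (fun w => post_max k w)]_w (expR (- H w))%:E)%E.
  rewrite /down_law; congr (integral _ _ _); apply/funext => w.
  by rewrite /H opprD.
have E0 : {in [set: path], forall w, (0 <= (expR (- H w))%:E)%E}.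
  by move=> w _; rewrite lee_fin expR_ge0.
rewrite (ge0_integral_pushforward mpost P measurableT mE E0).
rewrite preimage_setT; apply: ae_eq_integral => //.
- exact: measurableT_comp mE mpost.
- by apply: measurable_EFin_expR; exact: measurableT_comp.
- by apply: filterS ae_good => w gw _; rewrite /= postE.
Qed.

Definition numerator (j : 'I_n) : R := fine 'E_P[fun w => expR
  (- ((\sum_(l < n.+1 | (snd_ix j <= l)%N) a l
       + \sum_(l < n.+1 | (snd_ix j < l)%N) laplace_exponent P (Ups l) (load K b l))
      * G (snd_ix j) w)
   - (\sum_(l < n.+1 | (snd_ix j <= l)%N) Kprod K (snd_ix j) l * b l) * Xbar (snd_ix j) w)].

(** The transform of [killed_exponent] at [fst_ix j] for weights that vanish at that coordinate;
    hence the sums start at [snd_ix j]. *)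
Definition denominator (j : 'I_n) : R := fine 'E_P[fun w => expR
  (- ((\sum_(l < n.+1 | (snd_ix j <= l)%N) a l
       + \sum_(l < n.+1 | (snd_ix j <= l)%N) laplace_exponent P (Ups l) (load K b l))
      * G (fst_ix j) w)
   - (\sum_(l < n.+1 | (snd_ix j <= l)%N) Kprod K (fst_ix j) l * b l) * Xbar (fst_ix j) w)].

Lemma eq_fine_expectation (f g : path -> R) : (forall w, f w = g w) ->
  fine 'E_P[f] = fine 'E_P[g].
Proof. by move=> /funext ->. Qed.

Lemma ltn_fst_ix (j : 'I_n) l : (fst_ix j < l)%N = (snd_ix j <= l)%N.
Proof. by rewrite /= /bump leq0n. Qed.

Lemma post_exponent_rec (j : 'I_n) :
  denominator j * fine 'E_P[fun w => expR (- post_exponent (fst_ix j) a b w)] =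
  numerator j * fine 'E_P[fun w => expR (- post_exponent (snd_ix j) a b w)].
Proof.
pose a' l := if (snd_ix j <= l)%N then a l else 0.
pose b' l := if (snd_ix j <= l)%N then b l else 0.
have a'0 l : 0 <= a' l by rewrite /a'; case: ifP.
have b'0 l : 0 <= b' l by rewrite /b'; case: ifP.
have restrict (F : 'I_n.+1 -> R) (c c' : 'I_n.+1 -> R) :
    (forall l, c' l = if (snd_ix j <= l)%N then c l else 0) ->
    \sum_(l < n.+1 | (fst_ix j <= l)%N) F l * c' l =
    \sum_(l < n.+1 | (snd_ix j <= l)%N) F l * c l.
  move=> cE; rewrite big_mkcond [RHS]big_mkcond/=; apply: eq_bigr => l _; rewrite cE.
  have [jl|_] := boolP (snd_ix j <= l)%N; last by rewrite mulr0 if_same.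
  by rewrite ifT//; move: jl; rewrite -ltn_fst_ix => /ltnW.
have loadE l : (snd_ix j <= l)%N -> load K b' l = load K b l.
  move=> jl; apply: eq_bigr => i li; rewrite /b' ifT//; exact: leq_trans li.
have S1 := expectation_split X_levy K_gt0 Ups_sub indep ae_good (fst_ix j) a'0 b'0.
have S2 := expectation_split X_levy K_gt0 Ups_sub indep ae_good (snd_ix j) a0 b0.
have E1 : fine 'E_P[fun w => expR (- total_exponent (fst_ix j) a' b' w)] =
    fine 'E_P[fun w => expR (- total_exponent (snd_ix j) a b w)].
  apply: eq_fine_expectation => w; congr (expR (- _)).
  rewrite /total_exponent !big_split/=; congr (_ + _).
    under eq_bigr do rewrite mulrC.
    by rewrite (restrict _ a)//; apply: eq_bigr => l _; rewrite mulrC.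
  under eq_bigr do rewrite mulrC.
  by rewrite (restrict _ b)//; apply: eq_bigr => l _; rewrite mulrC.
have E2 : fine 'E_P[fun w => expR (- killed_exponent P K Ups (fst_ix j) a' b' w)] = denominator j.
  apply: eq_fine_expectation => w; rewrite -opprD; congr (expR (- _)).
  rewrite /killed_exponent /kill_rate; congr (_ * _ + _ * _); last exact: restrict.
  congr (_ + _).
    under eq_bigr do rewrite -[a' _]mul1r.
    by rewrite (restrict _ a)//; apply: eq_bigr => l _; rewrite mul1r.
  apply: eq_big => l; first exact: ltn_fst_ix.
  by rewrite ltn_fst_ix => /loadE ->.
have E3 : fine 'E_P[fun w => expR (- killed_exponent P K Ups (snd_ix j) a b w)] = numerator j.
  by apply: eq_fine_expectation => w; rewrite -opprD.
have E4 : fine 'E_P[fun w => expR (- post_exponent (fst_ix j) a' b' w)] =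
    fine 'E_P[fun w => expR (- post_exponent (fst_ix j) a b w)].
  rewrite unlock; congr fine; apply: ae_eq_integral => //.
  - apply: measurable_EFin_expR; apply: measurableT_comp; first exact: oppr_measurable.
    exact: measurable_post_exponent.
  - apply: measurable_EFin_expR; apply: measurableT_comp; first exact: oppr_measurable.
    exact: measurable_post_exponent.
  - apply: filterS ae_good => w gw _; congr (expR (- _))%:E.
    (* Coordinate [fst_ix j] contributes 0 whatever its weights, because X_k at its own argmax is
       its maximum; the other weights are unchanged. *)
    apply: eq_bigr => l; rewrite leq_eqVlt => /predU1P[/val_inj <-|].
      by rewrite X_at_max_self ?subrr ?mulr0//; exact: good_attains gw.
    by rewrite /a' /b' ltn_fst_ix => ->.
apply: etrans (congr1 ( *%R (denominator j)) (esym E4)) _.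
apply: etrans (congr1 ( *%R^~ _) (esym E2)) _.
exact: etrans (esym S1) (etrans E1 (etrans S2 (congr1 ( *%R^~ _) E3))).
Qed.

(** The expectation of a strictly positive variable; this permits the division in the recursion. *)
Lemma denominator_gt0 (j : 'I_n) : 0 < denominator j.
Proof.
pose c1 := \sum_(l < n.+1 | (snd_ix j <= l)%N) a l +
  \sum_(l < n.+1 | (snd_ix j <= l)%N) laplace_exponent P (Ups l) (load K b l).
pose c2 := \sum_(l < n.+1 | (snd_ix j <= l)%N) Kprod K (fst_ix j) l * b l.
have c10 : 0 <= c1.
  apply: addr_ge0; apply: sumr_ge0 => // l jl.
  apply: laplace_exponent_ge0; last exact: load_ge0.
  by apply: Ups_sub; apply/eqP => l0; rewrite l0 in jl.
have c20 : 0 <= c2 by apply: sumr_ge0 => l _; rewrite mulr_ge0// ltW// Kprod_gt0.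
pose f w := c1 * G (fst_ix j) w + c2 * Xbar (fst_ix j) w.
have mf : measurable_fun setT f.
  by apply: measurable_funD; apply: measurable_funM => //; [exact: measurable_G|exact: measurable_Xbar].
have f0 w : 0 <= f w by rewrite addr_ge0// mulr_ge0// ?G_ge0 ?Xbar_ge0.
have -> : denominator j = fine 'E_P[fun w => expR (- f w)].
  by apply: eq_fine_expectation => w; rewrite /f opprD.
rewrite -lte_fin -expectation_expRN01//; last exact: nearW.
by apply: integral_expR_gt0; exact: measurableT_comp.
Qed.

Lemma post_exponent_last : fine 'E_P[fun w => expR (- post_exponent ord_max a b w)] = 1.
Proof.
rewrite unlock -[RHS]/(fine 1%E); congr fine.
transitivity (\int[P]_w cst 1%E w)%E; last first.
  by rewrite integral_cst// mul1e; exact: probability_setT.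
apply: ae_eq_integral => //.
- apply: measurable_EFin_expR; apply: measurableT_comp; first exact: oppr_measurable.
  exact: measurable_post_exponent.
- apply: filterS ae_good => w gw _ /=; rewrite /post_exponent big1 ?oppr0 ?expR0// => l.
  move=> nl; have -> : l = ord_max.
    by apply/val_inj/eqP; rewrite eqn_leq nl andbT -ltnS ltn_ord.
  by rewrite X_at_max_self ?subrr ?mulr0 ?addr0//; exact: good_attains gw.
Qed.

Lemma post_exponent_prod k :
  fine 'E_P[fun w => expR (- post_exponent k a b w)] =
  \prod_(j < n | (k <= j)%N) (numerator j / denominator j).
Proof.
(* The recursion expresses coordinate [k] through the next one, so the induction descends from the
   last coordinate. *)
have [m] := ubnP (n - k); elim: m k => // m IH k nkm.
have [kn|] := eqVneq k ord_max.
  by rewrite kn post_exponent_last big_pred0// => j; apply/negbTE; rewrite -ltnNge ltn_ord.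
move=> kn; have kn' : (k < n)%N.
  by rewrite ltn_neqAle -ltnS ltn_ord andbT; apply: contraNN kn => /eqP kn; apply/eqP/val_inj.
pose j := Ordinal kn'; have kE : k = fst_ix j by exact: val_inj.
have D0 := denominator_gt0 j.
rewrite {1}kE; apply: (mulfI (lt0r_neq0 D0)); rewrite post_exponent_rec.
have -> : \prod_(i < n | (k <= i)%N) (numerator i / denominator i) =
    numerator j / denominator j *
    \prod_(i < n | (snd_ix j <= i)%N) (numerator i / denominator i).
  rewrite (bigD1 j)/=; last exact: leqnn.
  congr (_ * _); apply: eq_bigl => i; rewrite /bump leq0n add1n ltn_neqAle andbC.
  by rewrite -val_eqE eq_sym.
rewrite -IH; last by rewrite /= /bump leq0n add1n; lia.
by rewrite mulrA mulrCA divff ?mulr1// lt0r_neq0.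
Qed.

End recursion.

Unset Implicit Arguments.

(* There are n + 1 coordinates, numbered from 0; [K ord0] and [Ups ord0] do not
   occur. *)
Theorem corollary3p1 (R : realType) (n : nat)
    (P : probability (cadlag_path R n.+1) R)
    (K : 'I_n.+1 -> R)
    (Ups : 'I_n.+1 -> R -> cadlag_path R n.+1 -> R)
    (X_levy : levy_process P (@coord_process R n.+1))
    (condD : forall k : 'I_n.+1,
       {ae P, forall w : cadlag_path R n.+1, w k t @[t --> +oo] --> -oo})
    (K_gt0 : forall j : 'I_n.+1, j != ord0 -> 0 < K j)
    (Ups_sub : forall j : 'I_n.+1, j != ord0 -> subordinator P (Ups j))
    (condG : forall j : 'I_n,
       {ae P, forall w : cadlag_path R n.+1, forall t, 0 <= t ->
          w (snd_ix j) t =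
          K (snd_ix j) * w (fst_ix j) t + Ups (snd_ix j) t w})
    (indep : mutually_independent P (fun j : 'I_n.+1 =>
       sigma_gen [set t : R | 0 <= t]
         (if j == ord0 then coord_process ord0 else Ups j)))
    (k : 'I_n.+1) (alpha beta : 'I_n.+1 -> R)
    (alpha_ge0 : forall i, 0 <= alpha i) (beta_ge0 : forall i, 0 <= beta i) :
  let theta (l : 'I_n.+1) : R :=
    laplace_exponent P (Ups l)
      (\sum_(i < n.+1 | (l <= i)%N) Kprod K l i * beta i) in
  (\int[down_law P k]_w
     (expR (- (\sum_(i < n.+1) alpha i * G i w)
            - (\sum_(i < n.+1) beta i * Xbar i w)))%:E)%E =
  (\prod_(j < n | (k <= j)%N)
     (fine 'E_P[fun w => (expR
        (- ((\sum_(l < n.+1 | (snd_ix j <= l)%N) alpha l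
             + \sum_(l < n.+1 | (snd_ix j < l)%N) theta l) * G (snd_ix j) w)
         - (\sum_(l < n.+1 | (snd_ix j <= l)%N) Kprod K (snd_ix j) l * beta l)
             * Xbar (snd_ix j) w))%R]%E
      /
      fine 'E_P[fun w => (expR
        (- ((\sum_(l < n.+1 | (snd_ix j <= l)%N) alpha l
             + \sum_(l < n.+1 | (snd_ix j <= l)%N) theta l) * G (fst_ix j) w)
         - (\sum_(l < n.+1 | (snd_ix j <= l)%N) Kprod K (fst_ix j) l * beta l)
             * Xbar (fst_ix j) w))%R]%E))%:E.
Proof.
move=> theta.
(* There are finitely many coordinates, so the almost sure conditions share one null set. *)
have ae_good : {ae P, forall w, good_path K Ups w}.
  have [_ _ w0 _ _] := X_levy.
  have wD := filter_forall (ae_filter_ringOfSetsType P) condD.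
  have wU := filter_forall (ae_filter_ringOfSetsType P) condG.
  have Um : {ae P, forall w, forall l, l != ord0 ->
      forall s t, 0 <= s -> s <= t -> Ups l s w <= Ups l t w}.
    apply: filter_forall => l; have [l0|l0] := boolP (l != ord0); last exact: nearW.
    by apply: filterS (Ups_sub l l0).2 => w Hw _; exact: Hw.
  apply: filterS2 (filterI w0 wD) (filterI wU Um) => w [h1 h2] [h3 h4].
  by split.
rewrite (down_law_integral K_gt0 ae_good)//.
by rewrite (post_exponent_prod X_levy K_gt0 Ups_sub indep ae_good).
Qed.
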